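(* Let $\mathfrak g=E(5,10)$ with the $\mathbb Z$-grading of type $(0,1,1,1,1)$ and let $\mathfrak g_0$ be its degree-zero subalgebra. Let $\psi:E(1,6)\to\mathfrak g_0$ be the linear map defined, for $f\in\mathbb C[[t]]$, $X\in\mathfrak{sl}_4$ and $i,j\in\{2,3,4,5\}$, by 1. $\psi(f(t)\partial_t)=f(x_1)\partial_1-\frac14f'(x_1)\sum_{k=2}^5x_k\partial_k$; 2. $\psi(X\otimes f(t))=f(x_1)X$; 3. $\psi(x_ix_j\otimes f(t)dt)=f(x_1)(x_id_{1j}+x_jd_{1i})=-d(f(x_1)x_ix_jd_1)$; 4. $\psi(d_{ij}\otimes f(t)dt)=f(x_1)d_{ij}+\frac12f'(x_1)(x_id_{1j}-x_jd_{1i})=\frac12d\big(f(x_1)(x_id_j-x_jd_i)\big)$. Then $\psi$ is a Lie superalgebra isomorphism.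
   Context: All spaces are over $\mathbb C$. Notation: $\partial_i=\partial/\partial x_i$, $d_i=dx_i$, $d_{ij}=dx_i\wedge dx_j$. **$E(5,10)$.** Its even part is $S_5$, the Lie algebra of zero-divergence vector fields $\sum_{i=1}^5 P_i\partial_i$, $P_i\in\mathbb C[[x_1,\dots,x_5]]$; its odd part is the space $\Omega^2(5)_{cl}$ of closed differential 2-forms with coefficients in $\mathbb C[[x_1,\dots,x_5]]$. The bracket between a vector field and a 2-form is given by the Lie derivative, and the bracket of two odd elements is given by $[f d_{ij},g d_{hk}]=\varepsilon_{ijhk}\,fg\,\partial_{[ijhk]}$ (extended bilinearly), where, if $i,j,h,k$ are distinct, $[ijhk]$ is the remaining element of $\{1,\dots,5\}$ and $\varepsilon_{ijhk}$ is the sign of the permutation $(i,j,h,k,[ijhk])$; otherwise $\varepsilon_{ijhk}=0$. **Grading of type $(0,1,1,1,1)$.** $\deg x_1=\deg\partial_1=0$, $\deg x_i=-\deg\partial_i=1$ for $i=2,\dots,5$, $\deg d=-1$. Then $\mathfrak g=\prod_{j\ge-1}\mathfrak g_j$, and $\mathfrak g_0$ is the subalgebra of degree-0 elements. **$E(1,6)$.** For $\lambda\in\mathbb C$, $\Omega^1(1)^\lambda$ denotes the space of 1-forms $g(t)dt$, $g\in\mathbb C[[t]]$, on which $Y\in W_1=\mathbb C[[t]]\partial_t$ acts by $Y(\omega)=L_Y\omega+\lambda(\operatorname{div}Y)\omega$. The even part is $$E(1,6)_{\bar0}=W_1\oplus(\mathfrak{sl}_4\otimes\mathbb C[[t]])\quad\text{(direct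 sum of Lie algebras)},$$ and the odd part is $$E(1,6)_{\bar1}=(S^2(\mathbb C^4)\otimes\Omega^1(1)^{-1/2})\oplus(\textstyle\bigwedge^2(\mathbb C^4)\otimes\Omega^1(1)^{-3/2})\quad\text{(direct sum of vector spaces)}.$$ Identify $\mathbb C^4=\sum_{i=2}^5\mathbb Cx_i$, $S^2(\mathbb C^4)$ with the quadratic forms in $x_2,\dots,x_5$, $\bigwedge^2(\mathbb C^4)$ with the constant-coefficient 2-forms in $x_2,\dots,x_5$, and $\mathfrak{sl}_4$ with the zero-divergence vector fields $\sum_{i,j=2}^5b_{ij}x_i\partial_j$, $b_{ij}\in\mathbb C$. For a $k$-form $\omega$ ($k\ge1$) in these variables whose coefficients are homogeneous polynomials of degree $m$, put $\int\omega=\frac1{k+m}i_{\mathcal E}\omega$, where $\mathcal E=\sum_{j=2}^5x_j\partial_j$. The action of $E(1,6)_{\bar0}$ on $S^2(\mathbb C^4)\otimes\Omega^1(1)^{-1/2}$ and the action of $W_1$ on $\bigwedge^2(\mathbb C^4)\otimes\Omega^1(1)^{-3/2}$ are the obvious ones. The remaining brackets are, for $f,g\in\mathbb C[[t]]$, $X\in\mathfrak{sl}_4$, $p,q\in S^2(\mathbb C^4)$, $\sigma,\omega\in\bigwedge^2(\mathbb C^4)$: - $[X\otimes f,\omega\otimes g\,dt]=\int(i_X\omega)\otimes f'g\,dt+L_X\omega\otimes fg\,dt$; - $[p\otimes f\,dt,q\otimes g\,dt]=0$; - $[p\otimes f\,dt,\omega\otimes g\,dt]=-(dp\wedge\omega)\otimes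 fg\in\mathfrak{sl}_4\otimes\mathbb C[[t]]$; - $[\sigma\otimes f\,dt,\omega\otimes g\,dt]=fg(\sigma\wedge\omega)+\frac12\big((\int\sigma)\wedge\omega-\sigma\wedge\int\omega\big)\otimes(f'g-fg')\in W_1\oplus(\mathfrak{sl}_4\otimes\mathbb C[[t]])$. Here closed differential 3-forms in the 4 variables $x_2,\dots,x_5$ (resp. differential 4-forms in the 5 variables $t,x_2,\dots,x_5$) are identified with zero-divergence vector fields in the same variables (resp. with vector fields in the one variable $t$) through contraction with the standard volume form $dx_2\wedge dx_3\wedge dx_4\wedge dx_5$ (resp. $dt\wedge dx_2\wedge dx_3\wedge dx_4\wedge dx_5$).
   Formalization: In E(1,6), W_1 acts on sl_4⊗C[[t]] by [f∂_t, X⊗g] = X⊗fg' (not a direct sum of Lie algebras), and the sl_4 term of [σ⊗f dt, ω⊗g dt] has coefficient −1/2 instead of +1/2; as printed, ψ does not preserve these brackets. *)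

(* Defs.v *)
From HB Require Import structures.
From mathcomp Require Import all_boot all_order all_algebra all_fingroup.
From mathcomp Require Import boolp classical_sets functions reals.
From mathcomp Require Import complex mpoly.
Set Implicit Arguments.
Unset Strict Implicit.
Unset Printing Implicit Defensive.
Import GRing.Theory.
Local Open Scope ring_scope.

Definition psr (n : nat) (K : fieldType) := 'X_{1..n} -> K^o.

HB.instance Definition _ n (K : fieldType) :=
  GRing.Lmodule.copy (psr n K) ('X_{1..n} -> K^o).

Section PowerSeries.
Variables (n : nat) (K : fieldType).
Implicit Types (f g h : psr n K) (m : 'X_{1..n}).

Definition psr_one : psr n K := fun m => (m == 0%MM)%:R.

Definition psr_mul f g : psr n K := fun m =>
  \sum_(k : 'X_{1..n < (mdeg m).+1, (mdeg m).+1} | m == (k.1 + k.2)%MM)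
     f k.1 * g k.2.

Definition psr_trunc d f : {mpoly K[n]} :=
  \sum_(k : 'X_{1..n < d}) f k *: 'X_[k].

Lemma psr_truncE d f m : (mdeg m < d)%N -> (psr_trunc d f)@_m = f m.
Proof. exact: mcoeff_mpoly. Qed.

Lemma mcoeffM_congr (p p' q q' : {mpoly K[n]}) m :
  (forall k, (mdeg k <= mdeg m)%N -> p@_k = p'@_k) ->
  (forall k, (mdeg k <= mdeg m)%N -> q@_k = q'@_k) ->
  (p * q)@_m = (p' * q')@_m.
Proof.
move=> Hp Hq; rewrite !mcoeffM; apply: eq_bigr => -[k1 k2] /= _.
by rewrite Hp ?Hq // -ltnS bmdeg.
Qed.

Lemma psr_mulE d f g m : (mdeg m < d)%N ->
  psr_mul f g m = (psr_trunc d f * psr_trunc d g)@_m.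
Proof.
move=> md; rewrite mcoeffM; apply: eq_bigr => -[k1 k2] _ /=.
by rewrite !psr_truncE //; apply: leq_trans md; rewrite bmdeg.
Qed.

Lemma psr_mulA : associative psr_mul.
Proof.
move=> f g h; apply/funext => m; rewrite !(psr_mulE _ _ (ltnSn _)).
transitivity ((psr_trunc (mdeg m).+1 f *
  (psr_trunc (mdeg m).+1 g * psr_trunc (mdeg m).+1 h))@_m).
  by apply: mcoeffM_congr => // k km; rewrite psr_truncE ?ltnS // (psr_mulE _ _ (d := (mdeg m).+1)).
rewrite mulrA.
by apply: mcoeffM_congr => // k km; rewrite psr_truncE ?ltnS // (psr_mulE _ _ (d := (mdeg m).+1)).
Qed.

Lemma psr_mulC : commutative psr_mul.
Proof.
by move=> f g; apply/funext => m; rewrite !(psr_mulE _ _ (ltnSn _)) mulrC.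
Qed.

Lemma psr_mul1 : left_id psr_one psr_mul.
Proof.
move=> f; apply/funext => m; rewrite (psr_mulE _ _ (ltnSn _)).
rewrite -(psr_truncE f (ltnSn (mdeg m))) -[in RHS](mul1r (psr_trunc _ f)).
by apply: mcoeffM_congr => // k km; rewrite psr_truncE ?ltnS // mcoeff1.
Qed.

Lemma psr_mulDl : left_distributive psr_mul +%R.
Proof.
move=> f g h; apply/funext => m; etransitivity; last exact: big_split.
by apply: eq_bigr => k _; exact: mulrDl.
Qed.

Lemma psr_one_neq0 : psr_one != 0.
Proof.
by apply/eqP => /(congr1 (@^~ 0%MM)) /eqP; rewrite /psr_one eqxx oner_eq0.
Qed.

HB.instance Definition _ := GRing.Zmodule_isComNzRing.Build (psr n K)
  psr_mulA psr_mulC psr_mul1 psr_mulDl psr_one_neq0.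

Lemma psr_scaleAl (a : K) f g : a *: (f * g) = a *: f * g.
Proof.
apply/funext => m; etransitivity; first exact: mulr_sumr.
by apply: eq_bigr => k _; exact: mulrA.
Qed.

HB.instance Definition _ := GRing.Lmodule_isLalgebra.Build K (psr n K)
  psr_scaleAl.
HB.instance Definition _ := GRing.Lalgebra_isComAlgebra.Build K (psr n K).

Definition psX (i : 'I_n) : psr n K := fun m => (m == U_(i)%MM)%:R.
Definition pd (i : 'I_n) f : psr n K := fun m => f (m + U_(i))%MM *+ (m i).+1.

End PowerSeries.

Section Calculus.
Variables (n : nat) (K : fieldType).

Definition vf := 'I_n -> psr n K.

(* The value at S is the coefficient of dx_{i_1} /\ ... /\ dx_{i_k}, where
   i_1 < ... < i_k are the elements of S. *)
Definition form := {set 'I_n} -> psr n K.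

Implicit Types (X Y : vf) (a b : form).

Definition vf_d (i : 'I_n) : vf := fun k => (k == i)%:R.
Definition fform (f : psr n K) : form := fun S => if S == finset.set0 then f else 0.
Definition dxm (S : {set 'I_n}) : form := fun T => (T == S)%:R.
Definition dx (i : 'I_n) : form := dxm [set i].

Definition fmul {T : Type} (f : psr n K) (u : T -> psr n K) : T -> psr n K :=
  fun s => f * u s.

Definition ninv (S T : {set 'I_n}) : nat :=
  #|[set ij : 'I_n * 'I_n | [&& ij.1 \in S, ij.2 \in T & (ij.2 < ij.1)%N]]|.

Definition wedge a b : form := fun U =>
  \sum_(S : {set 'I_n} | S \subset U)
     (-1) ^+ ninv S (U :\: S) * (a S * b (U :\: S)).

Definition extd a : form :=
  \sum_(i < n) wedge (dx i) (fun S => pd i (a S)).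

Definition contr X a : form := fun S =>
  \sum_(i < n | i \notin S) (-1) ^+ ninv [set i] S * (X i * a (i |: S)).

Definition lie X a : form := extd (contr X a) + contr X (extd a).

Definition vapp X (f : psr n K) : psr n K := \sum_(i < n) X i * pd i f.
Definition vbr X Y : vf := fun k => vapp X (Y k) - vapp Y (X k).
Definition diverg X : psr n K := \sum_(i < n) pd i (X i).

Definition is_kform (k : nat) a := forall S : {set 'I_n}, #|S| != k -> a S = 0.

End Calculus.

Section E510.
Variable K : fieldType.

(* The variables x_1, ..., x_5 are indexed by 'I_5: x_1 is psX ord0, and
   x_2, ..., x_5 are psX (lift ord0 j) for j : 'I_4. *)

Definition perm_sign5 (i j h k l : 'I_5) : K :=
  if insub [ffun a => tnth [tuple i; j; h; k; l] a] is Some s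
  then (-1) ^+ odd_perm (s : {perm 'I_5}) else 0.

(* [f d_ij, g d_hk] = eps_ijhk f g d/dx_[ijhk], extended bilinearly; the term
   l = [ijhk] is the only one for which perm_sign5 does not vanish. *)
Definition odd_bracket (a b : form 5 K) : vf 5 K := fun l =>
  \sum_(i < 5) \sum_(j < 5 | (i < j)%N) \sum_(h < 5) \sum_(k < 5 | (h < k)%N)
     perm_sign5 i j h k l *: (a [set i; j] * b [set h; k]).

Definition E510_even : lmodType K := vf 5 K.
Definition E510_odd : lmodType K := form 5 K.
Definition E510_space : Type := (E510_even * E510_odd)%type.

Definition E510 : set E510_space :=
  [set u : E510_space | [/\ diverg u.1 = 0, is_kform 2 u.2 & extd u.2 = 0]].

Definition E510_bracket (u v : E510_space) : E510_space :=
  (vbr u.1 v.1 + odd_bracket u.2 v.2, lie u.1 v.2 - lie v.1 u.2).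

Definition xdeg (i : 'I_5) : int := if i == ord0 then 0 else 1.
Definition mondeg (m : 'X_{1..5}) : int := \sum_(i < 5) xdeg i *+ m i.

Definition E510_homog (d : int) : set E510_space :=
  [set u : E510_space |
     (forall i m, u.1 i m != 0 -> mondeg m - xdeg i = d) /\
     (forall (S : {set 'I_5}) m, u.2 S m != 0 ->
        mondeg m + \sum_(i in S) (xdeg i - 1) = d)].

Definition E510_deg (d : int) : set E510_space := E510 `&` E510_homog d.

End E510.

Section E16.
Variable K : fieldType.

(* For a finite-dimensional space V, the tensor product of V and K[[t]] is
   represented by V[[t]], that is by sequences of coefficients in V. *)
Definition tens {V : lmodType K} (v : V) (f : nat -> K^o) : nat -> V :=
  fun k => f k *: v.

Definition cauchy {U V W : lmodType K} (B : U -> V -> W)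
    (u : nat -> U) (v : nat -> V) : nat -> W :=
  fun k => \sum_(i < k.+1) B (u i) (v (k - i)%N).

Definition tder {V : lmodType K} (u : nat -> V) : nat -> V :=
  fun k => u k.+1 *+ k.+1.

Definition smul {V : lmodType K} (f : nat -> K^o) (u : nat -> V) : nat -> V :=
  cauchy (fun (c : K^o) (v : V) => c *: v) f u.

Definition euler : vf 5 K := fun k => if k == ord0 then 0 else psX K k.

Definition integ (k m : nat) (a : form 5 K) : form 5 K :=
  ((k + m)%:R : K)^-1 *: contr euler a.

Definition vol4 : form 5 K := dxm K (~: [set ord0]).

(* The vector field Y in x_2, ..., x_5 such that contr Y vol4 is the given
   3-form in x_2, ..., x_5. *)
Definition vf_of_3form (a : form 5 K) : vf 5 K := fun j =>
  if j == ord0 then 0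
  else (-1) ^+ ninv [set j] (~: [set ord0; j]) * a (~: [set ord0; j]).

(* A constant 4-form c dx_2 /\ ... /\ dx_5 times f(t) is the contraction of
   dt /\ dx_2 /\ ... /\ dx_5 with the vector field c f(t) d/dt. *)
Definition coef_of_4form (a : form 5 K) : K^o := a (~: [set ord0]) 0%MM.

Definition sl4 : set (vf 5 K) :=
  [set X : vf 5 K | (exists b : 'M[K]_4, X = \sum_i \sum_j
              b i j *: fmul (psX K (lift ord0 i)) (vf_d K (lift ord0 j)))
           /\ diverg X = 0].

Definition Sym2 : set (psr 5 K) :=
  [set p : psr 5 K | exists c : 'M[K]_4, p = \sum_i \sum_j
             c i j *: (psX K (lift ord0 i) * psX K (lift ord0 j))].

Definition Alt2 : set (form 5 K) :=
  [set a : form 5 K | exists c : 'M[K]_4, a = \sum_i \sum_j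
             c i j *: wedge (dx K (lift ord0 i)) (dx K (lift ord0 j))].

(* ((f, X), (p, a)) stands for f d/dt + X in the even part and for
   p dt + a dt in the odd part. *)
Definition E16_even : lmodType K := ((nat -> K^o) * (nat -> vf 5 K))%type.
Definition E16_odd : lmodType K := ((nat -> psr 5 K) * (nat -> form 5 K))%type.
Definition E16_space : Type := (E16_even * E16_odd)%type.

Definition E16 : set E16_space :=
  [set u : E16_space | [/\ forall k, sl4 (u.1.2 k), forall k, Sym2 (u.2.1 k)
             & forall k, Alt2 (u.2.2 k)]].

(* f d/dt acting on the coefficient u of u dt: L_Y (u dt) = (f u' + f' u) dt,
   and div Y = f'. *)
Definition dens_act {V : lmodType K} (lam : K) (f : nat -> K^o)
    (u : nat -> V) : nat -> V :=
  smul f (tder u) + smul (tder f) u + lam *: smul (tder f) u.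

Definition bracket_sl4_Alt2 (X : vf 5 K) (a : form 5 K) : psr 5 K :=
  integ 1 1 (contr X a) finset.set0.

Definition bracket_Sym2_Alt2 (p : psr 5 K) (a : form 5 K) : vf 5 K :=
  - vf_of_3form (wedge (extd (fform p)) a).

Definition vol_Alt2 (a b : form 5 K) : K^o := coef_of_4form (wedge a b).

Definition skew_Alt2 (a b : form 5 K) : vf 5 K :=
  vf_of_3form (wedge (integ 2 0 a) b - wedge a (integ 2 0 b)).

(* Two choices here are forced by the Jacobi identity.
   - W_1 acts on sl_4 (x) K[[t]] through its action on K[[t]]: the even part is
     a direct sum of its two subalgebras as a vector space, not a product of
     ideals.
   - The coefficient of skew_Alt2 a b (x) (f' g - f g') in the bracket of
     a (x) f dt and b (x) g dt is -1/2 when 3-forms are read as vector fields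
     through vf_of_3form. It is the sign obtained by reading the 4-form
     1/2 (df g - f dg) /\ ((int a) /\ b - a /\ (int b)) as a contraction of
     dt /\ dx_2 /\ ... /\ dx_5; likewise bracket_Sym2_Alt2 reads
     dt /\ dp /\ a, whence its minus sign. *)
Definition E16_bracket (u v : E16_space) : E16_space :=
  let: ((f, X), (p, a)) := u in
  let: ((g, Y), (q, b)) := v in
  (( smul f (tder g) - smul (tder f) g + cauchy vol_Alt2 a b,
     smul f (tder Y) - smul g (tder X) + cauchy (@vbr 5 K) X Y
     + cauchy bracket_Sym2_Alt2 p b + cauchy bracket_Sym2_Alt2 q a
     - 2%:R^-1 *: (cauchy skew_Alt2 (tder a) b - cauchy skew_Alt2 a (tder b))),
   ( dens_act (- (1 / 2%:R)) f q - dens_act (- (1 / 2%:R)) g p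
     + cauchy (@vapp 5 K) X q - cauchy (@vapp 5 K) Y p
     + cauchy bracket_sl4_Alt2 (tder X) b - cauchy bracket_sl4_Alt2 (tder Y) a,
     dens_act (- (3%:R / 2%:R)) f b - dens_act (- (3%:R / 2%:R)) g a
     + cauchy (@lie 5 K) X b - cauchy (@lie 5 K) Y a)).

(* The sum of x_1^j u_j over j; the terms with j > m_1 do not contribute to
   the coefficient of x^m. *)
Definition at_x1 (u : nat -> psr 5 K) : psr 5 K := fun m =>
  (\sum_(j < (m ord0).+1) psX K ord0 ^+ j * u j) m.

Definition at_x1_fun {T : Type} (u : nat -> T -> psr 5 K) : T -> psr 5 K :=
  fun s => at_x1 (fun j => u j s).

Definition subst_x1 (f : nat -> K^o) : psr 5 K := 
  at_x1 (fun j => (f j : K) *: (1 : psr 5 K)).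

Definition psi (u : E16_space) : E510_space K :=
  let: ((f, X), (p, a)) := u in
  ( fmul (subst_x1 f) (vf_d K ord0) - 4%:R^-1 *: fmul (subst_x1 (tder f)) euler
    + at_x1_fun X,
    at_x1_fun (fun j => wedge (dx K ord0) (extd (fform (p j))))
    + at_x1_fun a
    + at_x1_fun (fun j => wedge (dx K ord0) (integ 2 0 (tder a j)))).

End E16.

Section Superalgebra.
Variable K : fieldType.

(* A superspace is given as a subset of U0 * U1, the first component being
   even and the second one odd. *)
Definition bracket_closed (U : Type) (A : set U) (br : U -> U -> U) : Prop :=
  forall u v, A u -> A v -> A (br u v).

Definition lie_superalgebra_iso (U0 U1 V0 V1 : lmodType K)
    (A : set (U0 * U1)) (brA : U0 * U1 -> U0 * U1 -> U0 * U1)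
    (B : set (V0 * V1)) (brB : V0 * V1 -> V0 * V1 -> V0 * V1)
    (phi : U0 * U1 -> V0 * V1) : Prop :=
  [/\ bracket_closed A brA /\ bracket_closed B brB,
      set_bij A B phi,
      forall (c : K) u v, A u -> A v -> phi (c *: u + v) = c *: phi u + phi v,
      forall u, A u -> (u.2 = 0 -> (phi u).2 = 0) /\ (u.1 = 0 -> (phi u).1 = 0)
    & forall u v, A u -> A v -> phi (brA u v) = brB (phi u) (phi v)].

End Superalgebra.

Section TensorFacts.
Variable K : fieldType.

Definition biscalable (U V W : lmodType K) (B : U -> V -> W) :=
  forall (c d : K) u v, B (c *: u) (d *: v) = (c * d) *: B u v.

Lemma cauchy_tens (U V W : lmodType K) (B : U -> V -> W) u v f g :
  biscalable B -> cauchy B (tens u f) (tens v g) = tens (B u v) (smul f g).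
Proof.
move=> HB; apply/funext => k; rewrite /cauchy /tens /smul /cauchy scaler_suml.
by apply: eq_bigr => i _; rewrite HB.
Qed.

Lemma cauchy0 (U V W : lmodType K) (B : U -> V -> W) :
  biscalable B -> (forall v, cauchy B 0 v = 0) * (forall u, cauchy B u 0 = 0).
Proof.
move=> HB; split=> u; apply/funext => k; rewrite /cauchy big1 // => i _.
  by rewrite -[X in B X _](scale0r (0 : U)) -[u _]scale1r HB mul0r scale0r.
by rewrite -[X in B _ X](scale0r (0 : V)) -[u _]scale1r HB mulr0 scale0r.
Qed.

Lemma smul_biscalable (V : lmodType K) :
  biscalable (fun (c : K^o) (v : V) => c *: v).
Proof.
move=> c d u v; rewrite !scalerA; congr (_ *: _).
by rewrite mulrAC.
Qed.

Lemma smul_tens (V : lmodType K) f (v : V) g :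
  smul f (tens v g) = tens v (smul f g).
Proof.
apply/funext => k; rewrite /tens /smul /cauchy scaler_suml.
by apply: eq_bigr => i _; rewrite scalerA.
Qed.

Lemma tder_tens (V : lmodType K) (v : V) f : tder (tens v f) = tens v (tder f).
Proof. by apply/funext => k; rewrite /tder /tens scalerMnl. Qed.

Lemma tder0 (V : lmodType K) : tder (0 : nat -> V) = 0.
Proof. by apply/funext => k; rewrite /tder mul0rn. Qed.

Lemma tens0 (V : lmodType K) f : tens (0 : V) f = 0.
Proof. by apply/funext => k; rewrite /tens scaler0. Qed.

Lemma dens_act_tens (V : lmodType K) (lam : K) f (v : V) g :
  dens_act lam f (tens v g) = tens v (dens_act lam f g).
Proof.
rewrite /dens_act tder_tens !smul_tens; apply/funext => k.
by rewrite /tens /= !scalerDl; congr (_ + _); exact: scalerA.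
Qed.

Lemma dens_act0 (V : lmodType K) (lam : K) :
  (forall u : nat -> V, dens_act lam 0 u = 0) *
  (forall f, dens_act lam f (0 : nat -> V) = 0).
Proof.
have H := cauchy0 (@smul_biscalable V).
by split=> u; rewrite /dens_act /smul !tder0 !H !(addr0, scaler0).
Qed.

End TensorFacts.

Section CalculusFacts.
Variables (n : nat) (K : fieldType).
Implicit Types (X Y : vf n K) (a b : form n K) (c d : K).

Lemma psr_scaleAr c (f g : psr n K) : f * (c *: g) = c *: (f * g).
Proof. by rewrite -scalerAr. Qed.

Lemma pdZ i c (f : psr n K) : pd i (c *: f) = c *: pd i f.
Proof. by apply/funext => m; rewrite /pd; apply/esym; exact: mulrnAr. Qed.

Lemma pdD i (f g : psr n K) : pd i (f + g) = pd i f + pd i g.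
Proof. by apply/funext => m; exact: mulrnDl. Qed.

Lemma pdM i (f g : psr n K) : pd i (f * g) = pd i f * g + f * pd i g.
Proof.
have E (d : nat) (h : psr n K) (m : 'X_{1..n}) : (mdeg m < d)%N ->
    pd i h m = (mderiv i (psr_trunc d.+1 h))@_m.
  by move=> md; rewrite mcoeff_deriv psr_truncE // mdegD mdeg1 addn1.
apply/funext => m; rewrite (E _ _ _ (ltnSn _)).
set d := (mdeg m).+1.
transitivity ((mderiv i (psr_trunc d.+1 f * psr_trunc d.+1 g))@_m).
  rewrite !mcoeff_deriv psr_truncE ?mdegD ?mdeg1 ?addn1 //.
  by congr (_ *+ _); rewrite -psr_mulE // mdegD mdeg1 addn1.
rewrite mderivM mcoeffD; congr (_ + _).
  rewrite [RHS](psr_mulE _ _ (ltnSn _)); apply: mcoeffM_congr => k km.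
    by rewrite psr_truncE ?ltnS // (E d) // ltnS.
  by rewrite !psr_truncE // ?ltnS // ltnW.
rewrite [RHS](psr_mulE _ _ (ltnSn _)); apply: mcoeffM_congr => k km.
  by rewrite !psr_truncE // ?ltnS // ltnW.
by rewrite psr_truncE ?ltnS // (E d) // ltnS.
Qed.

Lemma pd_psX i j : pd i (psX K j) = (i == j)%:R :> psr n K.
Proof.
apply/funext => m; rewrite /pd /psX.
have -> : ((i == j)%:R : psr n K) m = ((i == j) && (m == 0%MM))%:R :> K.
  by case: (i == j).
case: (eqVneq i j) => [->|ij] /=; last first.
  case: eqP => [/(congr1 (fun x : 'X_{1.. n} => x i))|_]; last by rewrite mul0rn.
  by rewrite mnmDE !mnm1E eqxx eq_sym (negbTE ij) addn1.
have -> : (m + U_(j) == U_(j))%MM = (m == 0%MM).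
  apply/eqP/eqP => [H|->]; last by rewrite add0m.
  by apply/mnmP => k; move: (congr1 (fun x : 'X_{1..n} => x k) H); rewrite mnmDE mnm0E => /eqP; rewrite -[eqbRHS]add0n eqn_add2r => /eqP.
by case: eqP => [->|_]; rewrite ?mnm0E ?mulr1n ?mul0rn.
Qed.

Lemma wedge_biscalable : biscalable (@wedge n K).
Proof.
move=> c d a b; apply/funext => U; rewrite [RHS]scaler_sumr.
apply: eq_bigr => S _; rewrite [RHS]scalerAr; congr (_ * _).
by rewrite -[LHS]/((c *: a S) * (d *: b (U :\: S))) -scalerAl -scalerAr scalerA.
Qed.

Lemma contr_biscalable : biscalable (@contr n K).
Proof.
move=> c d X a; apply/funext => S; rewrite [RHS]scaler_sumr.
apply: eq_bigr => i _; rewrite [RHS]scalerAr; congr (_ * _).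
by rewrite -[LHS]/((c *: X i) * (d *: a (i |: S))) -scalerAl -scalerAr scalerA.
Qed.

Lemma extdZ c a : extd (c *: a) = c *: extd a.
Proof.
rewrite /extd scaler_sumr; apply: eq_bigr => i _.
rewrite -[c]mul1r -wedge_biscalable scale1r; congr wedge.
by apply/funext => S; rewrite mul1r; exact: pdZ.
Qed.

Lemma lie_biscalable : biscalable (@lie n K).
Proof.
move=> c d X a; rewrite /lie contr_biscalable extdZ [extd (d *: a)]extdZ.
by rewrite contr_biscalable scalerDr.
Qed.

Lemma vapp_biscalable : biscalable (@vapp n K).
Proof.
move=> c d X f; rewrite /vapp scaler_sumr; apply: eq_bigr => i _.
by rewrite pdZ -[LHS]/((c *: X i) * (d *: pd i f)) -scalerAl -scalerAr scalerA.
Qed.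

Lemma vbr_biscalable : biscalable (@vbr n K).
Proof.
move=> c d X Y; apply/funext => k.
rewrite -[LHS]/(vapp (c *: X) (d *: Y k) - vapp (d *: Y) (c *: X k)).
by rewrite !vapp_biscalable [d * c]mulrC -scalerBr.
Qed.

End CalculusFacts.

Section FormFacts.
Variables (n : nat) (K : fieldType).
Implicit Types (X Y : vf n K) (a b : form n K) (c d : K).

Lemma wedge_fmulr (f : psr n K) a b : wedge a (fmul f b) = fmul f (wedge a b).
Proof.
apply/funext => U; rewrite [RHS]mulr_sumr; apply: eq_bigr => S _.
by rewrite [RHS]mulrCA; congr (_ * _); exact: mulrCA.
Qed.

Lemma fmulDr (T : Type) (f : psr n K) (u v : T -> psr n K) :
  fmul f (u + v) = fmul f u + fmul f v.
Proof. by apply/funext => s; exact: mulrDr. Qed.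

Lemma fmulZr (T : Type) (f : psr n K) c (u : T -> psr n K) :
  fmul f (c *: u) = c *: fmul f u.
Proof. by apply/funext => s; exact: psr_scaleAr. Qed.

Lemma fmulN (T : Type) (f : psr n K) (u : T -> psr n K) :
  fmul f (- u) = - fmul f u.
Proof. by apply/funext => s; exact: mulrN. Qed.

Lemma wedgeDr a b1 b2 : wedge a (b1 + b2) = wedge a b1 + wedge a b2.
Proof.
apply/funext => U; etransitivity; last exact: big_split.
apply: eq_bigr => S _; rewrite -[RHS]mulrDr; congr (_ * _).
exact: mulrDr.
Qed.

Lemma wedge_dxE (i : 'I_n) b U :
  wedge (dx K i) b U =
  if i \in U then (-1) ^+ ninv [set i] (U :\ i) * b (U :\ i) else 0.
Proof.
rewrite /wedge; case: ifP => iU.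
  rewrite (bigD1 [set i]) /= ?finset.sub1set // big1 ?addr0.
    by rewrite /dx /dxm eqxx mul1r.
  by move=> S /andP[_ /negbTE Si]; rewrite /dx /dxm Si mul0r mulr0.
rewrite big1 // => S SU; rewrite /dx /dxm; case: eqP => [Si|_].
  by move: SU; rewrite Si finset.sub1set iU.
by rewrite mul0r mulr0.
Qed.

Lemma ninv1 (i j : 'I_n) : ninv [set i] [set j] = (j < i)%N :> nat.
Proof.
rewrite /ninv; case: ltnP => ij.
  rewrite (_ : finset _ = [set (i, j)]) ?cards1 //; apply/setP => -[k l].
  rewrite !inE xpair_eqE /=; case: eqP => //= ->; case: eqP => //= -> //.
rewrite (_ : finset _ = finset.set0) ?cards0 //; apply/setP => -[k l].
rewrite !inE /=; case: eqP => //= ->; case: eqP => //= ->.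
by rewrite ltnNge ij.
Qed.

Lemma wedge_dx_dx (i j : 'I_n) U : wedge (dx K i) (dx K j) U =
  if (i != j) && (U == [set i; j]) then (-1) ^+ (j < i)%N else 0.
Proof.
rewrite wedge_dxE /dx /dxm; case: ifP => iU; last first.
  by case: eqP => //= _; case: eqP => // UE; rewrite UE !inE eqxx in iU.
case: (eqVneq i j) => [<-|ij] /=.
  by rewrite (_ : _ == _ = false) ?mulr0 //; apply/eqP => /setP/(_ i);
     rewrite !inE eqxx.
have -> : (U :\ i == [set j]) = (U == [set i; j]).
  apply/eqP/eqP => [H|->]; first by rewrite -(finset.setD1K iU) H.
  by rewrite setU1K // inE.
by case: eqP => [->|_]; rewrite ?mulr0 // setU1K ?inE // mulr1 ninv1.
Qed.

Lemma contr_dx_dx X i j :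
  contr X (wedge (dx K i) (dx K j)) = fmul (X i) (dx K j) - fmul (X j) (dx K i).
Proof.
apply/funext => S; rewrite /contr -[RHS]/(X i * (S == [set j])%:R - X j * (S == [set i])%:R).
case: (eqVneq i j) => [->|ij].
  rewrite subrr big1 // => k _; rewrite wedge_dx_dx eqxx /= !mulr0 //.
have sij : [set i] == [set j] :> {set 'I_n} = false.
  by apply/eqP => /setP/(_ i); rewrite !inE eqxx (negbTE ij).
have Z k : k \notin S -> k |: S = [set i; j] ->
    (k = i /\ S = [set j]) \/ (k = j /\ S = [set i]).
  move=> kS H; have : k \in [set i; j] by rewrite -H !inE eqxx.
  rewrite !inE => /orP[] /eqP ki; [left|right]; split=> //.
    by rewrite -(setU1K kS) H ki setU1K // inE.
  by rewrite -(setU1K kS) H ki finset.setUC setU1K // inE eq_sym.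
case: (eqVneq S [set j]) => [Sj|Sj].
  rewrite Sj eq_sym sij mulr1 mulr0 subr0 (bigD1 i) ?inE //= big1 ?addr0; last first.
    move=> k /andP[kj ki]; rewrite wedge_dx_dx; case: ifP => [/andP[_ /eqP H]|_].
      by case: (Z k _ _); rewrite ?Sj // => -[/eqP]; rewrite ?(negbTE ki) // -Sj => /eqP kj'; rewrite -kj' inE eqxx in kj.
    by rewrite !mulr0.
  rewrite wedge_dx_dx ij eqxx /= ninv1 mulrCA -exprD addnn -mul2n exprM sqrrN expr1n.
  by rewrite expr1n mulr1.
case: (eqVneq S [set i]) => [Si|Si].
  rewrite Si mulr0 mulr1 sub0r (bigD1 j) ?inE 1?eq_sym //= big1 ?addr0; last first.
    move=> k /andP[kj ki]; rewrite wedge_dx_dx; case: ifP => [/andP[_ /eqP H]|_].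
      case: (Z k _ _); rewrite ?Si // => -[/eqP kE SE].
        by rewrite inE kE in kj.
      by rewrite kE in ki.
    by rewrite !mulr0.
  rewrite wedge_dx_dx ij finset.setUC eqxx /= ninv1 mulrCA -exprD.
  have -> : ((i < j)%N + (j < i)%N)%N = 1%N by move: ij; rewrite -val_eqE /=; case: ltngtP.
  by rewrite expr1 mulrN1.
rewrite !mulr0 subr0 big1 // => k kS; rewrite wedge_dx_dx.
case: ifP => [/andP[_ /eqP /(Z k kS)]|_]; last by rewrite !mulr0.
by move=> [] [_ /eqP]; rewrite ?(negbTE Si) ?(negbTE Sj).
Qed.

End FormFacts.

Section PsiFacts.
Variable K : fieldType.
Implicit Types (f g : nat -> K^o) (p : psr 5 K) (X : vf 5 K) (a : form 5 K).

Lemma vf_of_3form_contr X :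
  X ord0 = 0 -> vf_of_3form (contr X (vol4 K)) = X.
Proof.
move=> X0; apply/funext => j; rewrite /vf_of_3form; case: eqP => [->//|/eqP j0].
have H : j |: ~: [set ord0; j] = ~: [set ord0].
  by apply/setP => k; rewrite !inE; case: eqP => [->|]; rewrite ?orbF //= j0.
rewrite /contr (bigD1 j) ?inE ?eqxx ?orbT //= big1 ?addr0; last first.
  move=> i /andP[]; rewrite !inE negbK => /orP[/eqP -> _|/eqP ->].
    by rewrite X0 mul0r mulr0.
  by rewrite eqxx.
rewrite H /vol4 /dxm eqxx mulr1 mulrA -exprD addnn -mul2n exprM sqrrN expr1n.
by rewrite expr1n mul1r.
Qed.

Lemma psX_exp_neq0 j (m : 'X_{1..5}) : (psX K ord0 ^+ j) m != 0 -> m ord0 = j.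
Proof.
elim: j m => [|j IH] m.
  rewrite expr0 -[X in X != _]/((m == 0%MM)%:R : K); case: (eqVneq m 0%MM) => [->|_].
    by rewrite mnm0E.
  by rewrite eqxx.
rewrite exprS; apply: contraNeq => mj; apply/eqP.
apply: big1 => -[k1 k2] /= /eqP mE; rewrite [psX _ _ _]/(_%:R) /psX.
case: eqP => [k1E|_]; last exact: mul0r.
case: (eqVneq ((psX K ord0 ^+ j) k2) 0) => [->|/IH k2E]; first exact: mulr0.
have := congr1 (fun x : 'X_{1..5} => x ord0) mE.
by rewrite mnmDE k1E k2E mnm1E eqxx => /eqP; rewrite (negbTE mj).
Qed.

Lemma psX_exp_mul0 j p (m : 'X_{1..5}) :
  (m ord0 < j)%N -> (psX K ord0 ^+ j * p) m = 0.
Proof.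
move=> mj; apply: big1 => -[k1 k2] /= /eqP mE.
case: (eqVneq ((psX K ord0 ^+ j) k1) 0) => [->|/psX_exp_neq0 k1E].
  exact: mul0r.
have := congr1 (fun x : 'X_{1..5} => x ord0) mE; rewrite mnmDE k1E => mj'.
by rewrite mj' ltnNge leq_addr in mj.
Qed.

Lemma psr_sumE (I : Type) (r : seq I) (P : pred I) (F : I -> psr 5 K) m :
  (\sum_(i <- r | P i) F i) m = \sum_(i <- r | P i) F i m.
Proof. by elim/big_rec2: _ => // i x y _ <-. Qed.

Lemma at_x1E (u : nat -> psr 5 K) (m : 'X_{1..5}) (N : nat) : (m ord0 < N)%N ->
  at_x1 u m = (\sum_(j < N) psX K ord0 ^+ j * u j) m.
Proof.
move=> mN; rewrite /at_x1 !psr_sumE.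
rewrite (big_ord_widen N (fun j => (psX K ord0 ^+ j * u j) m)) //.
rewrite [RHS](bigID (fun j : 'I_N => (j < (m ord0).+1)%N)) /=.
rewrite [X in _ = _ + X]big1 ?addr0 // => j; rewrite ltnS -ltnNge => mj.
exact: psX_exp_mul0.
Qed.

Lemma at_x1_tens p f : at_x1 (tens p f) = subst_x1 f * p.
Proof.
apply/funext => m; set N := (mdeg m).+1.
have mN (k : 'X_{1..5}) : (mdeg k <= mdeg m)%N -> (k ord0 < N)%N.
  by rewrite ltnS; apply: leq_trans; rewrite mdegE (bigD1 ord0) //= leq_addr.
rewrite (at_x1E _ (mN m (leqnn _))).
transitivity (((\sum_(j < N) psX K ord0 ^+ j * ((f j : K) *: (1 : psr 5 K))) * p) m).
  congr ((_ : psr 5 K) m); rewrite mulr_suml; apply: eq_bigr => j _.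
  by rewrite /tens -!scalerAr mulr1 -scalerAl.
apply: eq_bigr => -[k1 k2] _ /=; congr (_ * _); rewrite /subst_x1 (@at_x1E _ _ N) //.
by apply: mN; rewrite -ltnS bmdeg.
Qed.

Lemma at_x1_fun_tens (T : Type) (u : T -> psr 5 K) f :
  at_x1_fun (tens u f) = fmul (subst_x1 f) u.
Proof. by apply/funext => s; exact: at_x1_tens. Qed.

Lemma at_x1_fun0 (T : Type) : at_x1_fun (0 : nat -> T -> psr 5 K) = 0.
Proof.
apply/funext => s; apply/funext => m; rewrite /at_x1_fun /at_x1 big1 // => j _.
by rewrite mulr0.
Qed.

Lemma subst_x10 : subst_x1 (0 : nat -> K^o) = 0.
Proof.
apply/funext => m; rewrite /subst_x1 /at_x1 big1 // => j _.
by rewrite scale0r mulr0.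
Qed.

Lemma fmul0 (T : Type) (u : T -> psr 5 K) : fmul 0 u = 0.
Proof. by apply/funext => s; exact: mul0r. Qed.

Lemma extd_fform (p : psr 5 K) :
  extd (fform p) = \sum_(k < 5) fmul (pd k p) (dx K k).
Proof.
apply: eq_bigr => k _; apply/funext => U.
rewrite wedge_dxE /fform /fmul /dx /dxm; case: ifP => kU; last first.
  by case: eqP => [UE|_]; rewrite ?mulr0 //; rewrite UE inE eqxx in kU.
have -> : (U :\ k == finset.set0) = (U == [set k]).
  apply/eqP/eqP => [H|->]; last by rewrite finset.setDv.
  by rewrite -(finset.setD1K kU) H finset.setU0.
case: eqP => [->|_].
  rewrite finset.setDv (_ : ninv _ _ = 0%N) ?expr0 ?mul1r ?mulr1 //.
  by apply/eqP; rewrite cards_eq0; apply/eqP/setP => -[x y]; rewrite !inE andbF.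
by rewrite mulr0 -(scale0r (0 : psr 5 K)) pdZ !scale0r mulr0.
Qed.

Lemma extd_fform_XX (i j : 'I_5) : extd (fform (psX K i * psX K j)) =
  fmul (psX K i) (dx K j) + fmul (psX K j) (dx K i).
Proof.
rewrite extd_fform (eq_bigr (fun k =>
  fmul (psX K i) (if k == j then dx K k else 0)
  + fmul (psX K j) (if k == i then dx K k else 0))); last first.
  move=> k _; rewrite pdM !pd_psX; apply/funext => U; rewrite /fmul.
  rewrite mulrDl addrC; congr (_ + _); case: eqP => _;
  by rewrite ?(mulr1, mul1r, mulr0, mul0r).
have E (q : psr 5 K) (l : 'I_5) :
    \sum_(k < 5) fmul q (if k == l then dx K k else 0) = fmul q (dx K l).
  rewrite (bigD1 l) //= eqxx big1 ?addr0 // => k /negbTE ->.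
  by apply/funext => s; exact: mulr0.
by rewrite big_split /= !E.
Qed.

Lemma fformZ (c : K) p : fform (c *: p) = c *: fform p.
Proof.
apply/funext => S; rewrite -[RHS]/(c *: fform p S) /fform.
by case: ifP => //; rewrite scaler0.
Qed.

Lemma wedgeZr (c : K) a (b : form 5 K) : wedge a (c *: b) = c *: wedge a b.
Proof. by rewrite -[a in LHS]scale1r wedge_biscalable mul1r. Qed.

Lemma integZ k m (c : K) a : integ k m (c *: a) = c *: integ k m a.
Proof.
rewrite /integ -[euler K]scale1r !contr_biscalable mul1r !scalerA.
by rewrite scale1r mulrC.
Qed.

Lemma psiE_odd p a f g :
  psi ((0, 0), (tens p f, tens a g)) =
  (0, fmul (subst_x1 f) (wedge (dx K ord0) (extd (fform p)))
      + fmul (subst_x1 g) a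
      + fmul (subst_x1 (tder g)) (wedge (dx K ord0) (integ 2 0 a))).
Proof.
rewrite /psi tder0 subst_x10 !fmul0 at_x1_fun0 scaler0 subr0 addr0 tder_tens.
congr (_, _ + _ + _); rewrite -at_x1_fun_tens //; congr at_x1_fun;
  apply/funext => j; rewrite /tens.
  by rewrite fformZ extdZ wedgeZr.
by rewrite integZ wedgeZr.
Qed.

Lemma fform0 : fform (0 : psr 5 K) = 0.
Proof. by rewrite -(scale0r (0 : psr 5 K)) fformZ scale0r. Qed.

Lemma extd0 : extd (0 : form 5 K) = 0.
Proof. by move: (extdZ 0 (0 : form 5 K)); rewrite !scale0r. Qed.

Lemma wedge0r a : wedge a 0 = 0.
Proof. by move: (wedgeZr 0 a 0); rewrite !scale0r. Qed.

Lemma integ0 k m : integ k m (0 : form 5 K) = 0.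
Proof. by move: (integZ k m 0 0); rewrite !scale0r. Qed.

Lemma psiE_even (f : nat -> K^o) X g :
  psi ((f, tens X g), (0, 0)) =
  (fmul (subst_x1 f) (vf_d K ord0)
   - 4%:R^-1 *: fmul (subst_x1 (tder f)) (euler K) + fmul (subst_x1 g) X, 0).
Proof.
rewrite /psi at_x1_fun_tens tder0 at_x1_fun0; congr (_, _).
rewrite [X in at_x1_fun X](_ : _ = 0) ?at_x1_fun0; last first.
  by apply/funext => j; rewrite [extd _](_ : _ = 0) ?wedge0r // fform0 extd0.
rewrite [X in at_x1_fun X](_ : _ = 0) ?at_x1_fun0 ?addr0 //.
by apply/funext => j; rewrite integ0 wedge0r.
Qed.

Lemma fmulf0 (T : Type) (q : psr 5 K) : fmul q (0 : T -> psr 5 K) = 0.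
Proof. by apply/funext => s; exact: mulr0. Qed.

Lemma psi_W1 f : psi ((f, 0), (0, 0)) =
  (fmul (subst_x1 f) (vf_d K ord0)
   - 4%:R^-1 *: fmul (subst_x1 (tder f)) (euler K), 0).
Proof. by have := psiE_even f 0 0; rewrite tens0 fmulf0 addr0. Qed.

Lemma psi_sl4 X f : psi ((0, tens X f), (0, 0)) = (fmul (subst_x1 f) X, 0).
Proof.
by rewrite psiE_even tder0 subst_x10 !fmul0 scaler0 subr0 add0r.
Qed.

Lemma psi_Sym2 (i j : 'I_5) f :
  psi ((0, 0), (tens (psX K i * psX K j) f, 0)) =
  (0, fmul (subst_x1 f)
        (fmul (psX K i) (wedge (dx K ord0) (dx K j))
         + fmul (psX K j) (wedge (dx K ord0) (dx K i)))).
Proof.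
have := psiE_odd (psX K i * psX K j) 0 f 0.
rewrite tens0 integ0 wedge0r !fmulf0 !addr0 => ->.
by rewrite extd_fform_XX wedgeDr !wedge_fmulr.
Qed.

Lemma psi_Alt2 (i j : 'I_5) f : i != ord0 -> j != ord0 ->
  psi ((0, 0), (0, tens (wedge (dx K i) (dx K j)) f)) =
  (0, fmul (subst_x1 f) (wedge (dx K i) (dx K j))
      + 2%:R^-1 *: fmul (subst_x1 (tder f))
          (fmul (psX K i) (wedge (dx K ord0) (dx K j))
           - fmul (psX K j) (wedge (dx K ord0) (dx K i)))).
Proof.
move=> i0 j0; have := psiE_odd 0 (wedge (dx K i) (dx K j)) 0 f.
rewrite tens0 fform0 extd0 wedge0r fmulf0 add0r => ->.
rewrite /integ contr_dx_dx /euler (negbTE i0) (negbTE j0) addn0.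
rewrite wedgeZr wedgeDr -[- fmul _ _]scaleN1r wedgeZr scaleN1r !wedge_fmulr.
by rewrite fmulZr.
Qed.

Lemma extd_fmul_dx (F : psr 5 K) (l : 'I_5) :
  extd (fmul F (dx K l)) = \sum_(k < 5) fmul (pd k F) (wedge (dx K k) (dx K l)).
Proof.
apply: eq_bigr => k _; rewrite -wedge_fmulr; congr wedge; apply/funext => S.
rewrite /fmul /dx /dxm; case: (S == [set l]); first by rewrite !mulr1.
by rewrite !mulr0 -(scale0r (0 : psr 5 K)) pdZ !scale0r.
Qed.

Lemma wedge_dxC (i j : 'I_5) : wedge (dx K i) (dx K j) = - wedge (dx K j) (dx K i).
Proof.
apply/funext => U; rewrite -[RHS]/(- wedge (dx K j) (dx K i) U) !wedge_dx_dx.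
rewrite finset.setUC [j == i]eq_sym; case: ifP => [/andP[ij _]|_]; last by rewrite oppr0.
by move: ij; rewrite -val_eqE /=; case: ltngtP => //; rewrite ?opprK.
Qed.

Lemma wedge_dxx (i : 'I_5) : wedge (dx K i) (dx K i) = 0.
Proof. by apply/funext => U; rewrite wedge_dx_dx eqxx. Qed.

Lemma pd_psX_exp (k : 'I_5) j :
  pd k (psX K ord0 ^+ j.+1) = (k == ord0)%:R * (psX K ord0 ^+ j *+ j.+1).
Proof.
elim: j => [|j IH]; first by rewrite expr1 expr0 pd_psX mulr1n mulr1.
rewrite exprS pdM IH pd_psX [in RHS]mulrS mulrDr; congr (_ + _).
by rewrite mulrCA mulrnAr -exprS.
Qed.

Lemma pd_subst_x1 (k : 'I_5) f :
  pd k (subst_x1 f) = (k == ord0)%:R * subst_x1 (tder f).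
Proof.
apply/funext => m; set N := (mdeg m).+1.
have mN (l : 'X_{1..5}) : (mdeg l <= mdeg m)%N -> (l ord0 < N)%N.
  by rewrite ltnS; apply: leq_trans; rewrite mdegE (bigD1 ord0) //= leq_addr.
have pd_sum (I : Type) (r : seq I) (G : I -> psr 5 K) :
    pd k (\sum_(i <- r) G i) = \sum_(i <- r) pd k (G i).
  elim/big_rec2: _ => [|i x y _ <-]; last by rewrite pdD.
  by have := pdZ k 0 (0 : psr 5 K); rewrite !scale0r.
transitivity (pd k (\sum_(j < N.+1) psX K ord0 ^+ j * ((f j : K) *: (1 : psr 5 K))) m).
  rewrite /pd /subst_x1 (@at_x1E _ _ N.+1) //.
  rewrite mnmDE mnm1E ltnS; apply: leq_trans (mN m (leqnn _)).
  by rewrite -[(m ord0).+1]addn1 leq_add2l; case: eqP.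
have -> : pd k (\sum_(j < N.+1) psX K ord0 ^+ j * ((f j : K) *: (1 : psr 5 K)))
  = (k == ord0)%:R * \sum_(j < N) psX K ord0 ^+ j * ((tder f j : K) *: (1 : psr 5 K)).
  rewrite pd_sum big_ord_recl expr0 mul1r pdZ.
  have -> : pd k (1 : psr 5 K) = 0.
    by have := pdM k (1 : psr 5 K) 1; rewrite !mulr1 mul1r => /eqP;
       rewrite -subr_eq subrr eq_sym => /eqP.
  rewrite scaler0 add0r mulr_sumr; apply: eq_bigr => j _.
  rewrite -scalerAr mulr1 pdZ lift0 pd_psX_exp -[in RHS]scalerAr mulr1 -scalerAr.
  by rewrite /tder mulrnAr -scalerMnr scalerMnl.
rewrite [LHS](psr_mulE _ _ (ltnSn _)) [RHS](psr_mulE _ _ (ltnSn _)).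
apply: mcoeffM_congr => // l lm; rewrite !psr_truncE ?ltnS //.
by rewrite /subst_x1 (@at_x1E _ _ N) // mN.
Qed.

Lemma fmulA (T : Type) (q r : psr 5 K) (u : T -> psr 5 K) :
  fmul (q * r) u = fmul q (fmul r u).
Proof. by apply/funext => s; rewrite /fmul mulrA. Qed.

Lemma fmul_sum (T I : Type) (s : seq I) q (u : I -> T -> psr 5 K) :
  fmul q (\sum_(i <- s) u i) = \sum_(i <- s) fmul q (u i).
Proof.
by elim/big_rec2: _ => [|i x y _ <-]; rewrite ?fmulf0 ?fmulDr.
Qed.

Lemma fmulDl (T : Type) (q r : psr 5 K) (u : T -> psr 5 K) :
  fmul (q + r) u = fmul q u + fmul r u.
Proof. by apply/funext => s; exact: mulrDl. Qed.

Lemma fmul_delta (T : Type) (u : 'I_5 -> T -> psr 5 K) (l : 'I_5) :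
  \sum_(k < 5) fmul (k == l)%:R (u k) = u l.
Proof.
rewrite (bigD1 l) //= eqxx big1 ?addr0; last first.
  by move=> k /negbTE ->; exact: fmul0.
by apply/funext => s; exact: mul1r.
Qed.

Lemma extd_subst_x1 f q (l : 'I_5) :
  extd (fmul (subst_x1 f * q) (dx K l)) =
  fmul (subst_x1 (tder f)) (fmul q (wedge (dx K ord0) (dx K l)))
  + fmul (subst_x1 f) (extd (fmul q (dx K l))).
Proof.
rewrite !extd_fmul_dx fmul_sum -(fmul_delta (fun k => fmul (subst_x1 (tder f))
  (fmul q (wedge (dx K k) (dx K l)))) ord0) -big_split /=.
apply: eq_bigr => k _; rewrite pdM pd_subst_x1 fmulDl.
by rewrite -mulrA !fmulA.
Qed.

Lemma psi_Sym2_exact (i j : 'I_5) f :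
  psi ((0, 0), (tens (psX K i * psX K j) f, 0)) =
  (0, - extd (fmul (subst_x1 f * (psX K i * psX K j)) (dx K ord0))).
Proof.
rewrite psi_Sym2 extd_subst_x1 wedge_dxx !fmulf0 add0r -fmulN.
congr (_, fmul _ _); rewrite extd_fmul_dx -!wedge_fmulr -wedgeDr.
rewrite -extd_fform_XX extd_fform -sumrN.
transitivity (\sum_(k < 5) wedge (dx K ord0) (fmul (pd k (psX K i * psX K j)) (dx K k))).
  by elim/big_rec2: _ => [|k x y _ <-]; rewrite ?wedge0r // wedgeDr.
by apply: eq_bigr => k _; rewrite wedge_fmulr wedge_dxC fmulN.
Qed.

Lemma psi_Alt2_exact (i j : 'I_5) f : i != ord0 -> j != ord0 ->
  2%:R != 0 :> K ->
  psi ((0, 0), (0, tens (wedge (dx K i) (dx K j)) f)) =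
  (0, 2%:R^-1 *: extd (fmul (subst_x1 f * psX K i) (dx K j)
                       - fmul (subst_x1 f * psX K j) (dx K i))).
Proof.
move=> i0 j0 K2; rewrite psi_Alt2 //; congr (_, _).
have extdB (a b : form 5 K) : extd (a - b) = extd a - extd b.
  rewrite -[- extd b]scaleN1r -extdZ scaleN1r /extd -big_split /=.
  apply: eq_bigr => k _; rewrite -wedgeDr; congr wedge.
  by apply/funext => S; exact: pdD.
rewrite extdB !extd_subst_x1 !extd_fmul_dx.
have E (k l : 'I_5) : \sum_(r < 5) fmul (pd r (psX K k)) (wedge (dx K r) (dx K l))
    = wedge (dx K k) (dx K l).
  rewrite -[RHS](fmul_delta (fun r => wedge (dx K r) (dx K l))).
  by apply: eq_bigr => r _; rewrite pd_psX.
rewrite !E [wedge (dx K j) (dx K i)]wedge_dxC [fmul (subst_x1 f) (- _)]fmulN.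
rewrite opprD opprK addrACA -[- fmul (subst_x1 (tder f)) _]fmulN -fmulDr.
rewrite scalerDr -mulr2n -scaler_nat scalerA mulVf // scale1r addrC.
by [].
Qed.

End PsiFacts.

Section E16Facts.
Variable K : fieldType.
Implicit Types (f g : nat -> K^o) (X Y : vf 5 K) (p q : psr 5 K)
  (a b : form 5 K).

Definition in_W1 f : E16_space K := ((f, 0), (0, 0)).
Definition in_sl4 (X : nat -> vf 5 K) : E16_space K := ((0, X), (0, 0)).
Definition in_Sym2 (p : nat -> psr 5 K) : E16_space K := ((0, 0), (p, 0)).
Definition in_Alt2 (a : nat -> form 5 K) : E16_space K := ((0, 0), (0, a)).

Lemma vf_of_3formZ (c : K) a : vf_of_3form (c *: a) = c *: vf_of_3form a.
Proof.
apply/funext => j; rewrite -[RHS]/(c *: vf_of_3form a j) /vf_of_3form.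
by case: ifP => _; rewrite ?scaler0 // -psr_scaleAr.
Qed.

Lemma bracket_sl4_Alt2_biscalable : biscalable (@bracket_sl4_Alt2 K).
Proof.
by move=> c d X a; rewrite /bracket_sl4_Alt2 contr_biscalable integZ.
Qed.

Lemma bracket_Sym2_Alt2_biscalable : biscalable (@bracket_Sym2_Alt2 K).
Proof.
move=> c d p a; rewrite /bracket_Sym2_Alt2 fformZ extdZ wedge_biscalable.
by rewrite vf_of_3formZ scalerN.
Qed.

Lemma vol_Alt2_biscalable : biscalable (@vol_Alt2 K).
Proof. by move=> c d a b; rewrite /vol_Alt2 wedge_biscalable. Qed.

Lemma skew_Alt2_biscalable : biscalable (@skew_Alt2 K).
Proof.
move=> c d a b; rewrite /skew_Alt2 !integZ !wedge_biscalable -scalerBr.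
by rewrite vf_of_3formZ.
Qed.

Let E0 := (cauchy0 (@vbr_biscalable 5 K),
  cauchy0 (@vapp_biscalable 5 K), cauchy0 (@lie_biscalable 5 K),
  cauchy0 bracket_sl4_Alt2_biscalable, cauchy0 bracket_Sym2_Alt2_biscalable,
  cauchy0 vol_Alt2_biscalable, cauchy0 skew_Alt2_biscalable).

Let smul0 (V : lmodType K) : (forall u : nat -> V, smul 0 u = 0) *
  (forall f, smul f (0 : nat -> V) = 0).
Proof. exact: cauchy0 (@smul_biscalable K V). Qed.

Let simp := (E0, smul0, tder0, dens_act0, scaler0, subr0, addr0, add0r, sub0r, oppr0).

Lemma E16_W1_W1 f g : E16_bracket (in_W1 f) (in_W1 g) =
  in_W1 (smul f (tder g) - smul (tder f) g).
Proof. by rewrite /E16_bracket /= !simp. Qed.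

Lemma E16_W1_sl4 f X g : E16_bracket (in_W1 f) (in_sl4 (tens X g)) =
  in_sl4 (tens X (smul f (tder g))).
Proof. by rewrite /E16_bracket /= !simp tder_tens smul_tens. Qed.

Lemma E16_W1_Sym2 f p g : E16_bracket (in_W1 f) (in_Sym2 (tens p g)) =
  in_Sym2 (tens p (dens_act (- (1 / 2%:R)) f g)).
Proof. by rewrite /E16_bracket /= !simp dens_act_tens. Qed.

Lemma E16_W1_Alt2 f a g : E16_bracket (in_W1 f) (in_Alt2 (tens a g)) =
  in_Alt2 (tens a (dens_act (- (3%:R / 2%:R)) f g)).
Proof. by rewrite /E16_bracket /= !simp dens_act_tens. Qed.

Lemma E16_sl4_sl4 X f Y g :
  E16_bracket (in_sl4 (tens X f)) (in_sl4 (tens Y g)) =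
  in_sl4 (tens (vbr X Y) (smul f g)).
Proof.
by rewrite /E16_bracket /= !simp (cauchy_tens _ _ _ _ (@vbr_biscalable 5 K)).
Qed.

Lemma E16_sl4_Sym2 X f p g :
  E16_bracket (in_sl4 (tens X f)) (in_Sym2 (tens p g)) =
  in_Sym2 (tens (vapp X p) (smul f g)).
Proof.
by rewrite /E16_bracket /= !simp (cauchy_tens _ _ _ _ (@vapp_biscalable 5 K)).
Qed.

Lemma E16_sl4_Alt2 X f a g :
  E16_bracket (in_sl4 (tens X f)) (in_Alt2 (tens a g)) =
  in_Sym2 (tens (integ 1 1 (contr X a) finset.set0) (smul (tder f) g))
  + in_Alt2 (tens (lie X a) (smul f g)).
Proof.
rewrite /E16_bracket /= !simp (cauchy_tens _ _ _ _ (@lie_biscalable 5 K)).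
rewrite tder_tens (cauchy_tens _ _ _ _ bracket_sl4_Alt2_biscalable).
by congr (_, (_, _)); rewrite ?simp.
Qed.

Lemma E16_Sym2_Sym2 p f q g :
  E16_bracket (in_Sym2 (tens p f)) (in_Sym2 (tens q g)) = 0.
Proof. by rewrite /E16_bracket /= !simp. Qed.

Lemma E16_Sym2_Alt2 p f a g :
  E16_bracket (in_Sym2 (tens p f)) (in_Alt2 (tens a g)) =
  in_sl4 (tens (- vf_of_3form (wedge (extd (fform p)) a)) (smul f g)).
Proof.
rewrite /E16_bracket /= !simp.
by rewrite (cauchy_tens _ _ _ _ bracket_Sym2_Alt2_biscalable).
Qed.

Lemma E16_Alt2_Alt2 a f b g :
  E16_bracket (in_Alt2 (tens a f)) (in_Alt2 (tens b g)) =
  in_W1 (tens (coef_of_4form (wedge a b)) (smul f g))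
  - 2%:R^-1 *: in_sl4
      (tens (vf_of_3form (wedge (integ 2 0 a) b - wedge a (integ 2 0 b)))
         (smul (tder f) g - smul f (tder g))).
Proof.
rewrite /E16_bracket /= !simp (cauchy_tens _ _ _ _ vol_Alt2_biscalable).
rewrite !tder_tens !(cauchy_tens _ _ _ _ skew_Alt2_biscalable).
congr ((_, _), (_, _)); rewrite /= ?scaler0 ?subr0 //.
rewrite sub0r; congr (- (_ *: _)).
by apply/funext => k; rewrite /tens scalerBl.
Qed.

End E16Facts.

(* Main.v *)
Require Import Defs.
From HB Require Import structures.
From mathcomp Require Import all_boot all_order all_algebra.
From mathcomp Require Import reals complex.
From mathcomp Require Import all_fingroup boolp classical_sets functions mpoly.
From mathcomp Require Import ring.
Require Import Defs.
Set Implicit Arguments.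
Unset Strict Implicit.
Unset Printing Implicit Defensive.
Import GRing.Theory Num.Theory.
Local Open Scope ring_scope.

(* A pair of degree 0 consists of a vector field
   f d/dx_1 + sum_ij M_ij x_i d/dx_j and a 2-form
   sum_ij N_ij x_i dx_1 dx_j + sum_ij w_ij dx_i dx_j, where f and the 4x4
   matrices M, N, w have coefficients in K[[x_1]] and i, j run over 2, ..., 5.
   It belongs to E(5,10) iff f' + tr M = 0 and the skew parts of N and w' agree.
   In coordinates, an element of E(1,6) is a series f together with series of
   matrices B (traceless), c (a quadratic form) and w (a 2-form), and psi is
   M = B - f'/4, N = (c + c^T) + (w' - w'^T)/2, which is solvable in B and c
   exactly under the two conditions above.  Both brackets become expressions in
   these matrices, their derivatives, and the Hodge dual [star W] of a
   skew matrix W; the two sides agree because of the single identity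
   W * star V + V * star W = Pf(W, V) * 1. *)

(** * Power series in x_1 *)

(** The coordinates are deliberately redundant: c counts only through c + c^T and w only through w -
    w^T. Plain matrix products can then serve as coordinates of brackets, and no symmetry condition
    is carried along; the ambiguity is resolved only for injectivity. Each constant has one origin.
    Since tr 1 = 4, subtracting f'/4 turns a traceless B into an M with tr M = -f'. Since
    antisymmetrising twice doubles, adding half of w' - w'^T to a symmetric matrix gives an N with
    the skew part of w'. The obstacle is the even component of the bracket of two odd elements with
    skew matrices W and V. E(1,6) yields the commutator-like terms W' * star V - V * star W' and W *
    star V' - V' * star W, together with -Pf(W, V)'/4 from the field on the line; E(5,10) yields
    only W' * star V and V' * star W. Differentiating the Pfaffian identity writes the scalar term
    through the same four products, and the two unwanted ones cancel. In the matrix identities 1/2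
    is an abstract ring element h with h * 2 = 1. *)

Section PowerSeriesInX1.
Variable K : fieldType.
Implicit Types (f g : nat -> K^o) (p q : psr 5 K) (m : 'X_{1..5}).

Lemma psrDE p q m : (p + q) m = p m + q m. Proof. by []. Qed.
Lemma psrZE (c : K) p m : (c *: p) m = c * p m. Proof. by []. Qed.

Lemma psX_mulE (i : 'I_5) p m :
  (psX K i * p) m = if (0 < m i)%N then p (m - U_(i))%MM else 0.
Proof.
rewrite -[LHS]/(psr_mul _ _ m) (psr_mulE _ _ (d := (mdeg m).+2)) //.
have E k : (mdeg k < (mdeg m).+2)%N ->
    (psr_trunc (mdeg m).+2 (psX K i))@_k = ('X_i : {mpoly K[5]})@_k.
  by move=> kd; rewrite psr_truncE // mcoeffX /psX eq_sym.
rewrite (@mcoeffM_congr _ _ _ 'X_i _ (psr_trunc (mdeg m).+2 p)) //; last first.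
  by move=> k km; rewrite E // ltnS (leq_trans km).
case: ifP => mi.
  have mE : (U_(i) + (m - U_(i)))%MM = m by rewrite addmC submK // lep1mP -lt0n.
  rewrite mulrC -[X in _@_X]mE mcoeffMX psr_truncE //; apply: leq_ltn_trans (ltnW (ltnSn _)).
  by rewrite !mdegE; apply: leq_sum => j _; rewrite mnmBE leq_subr.
rewrite mulrC mcoeffM big1 // => -[k1 k2] /= /eqP mE; rewrite mcoeffX.
case: eqP => [k2E|]; last by rewrite mulr0.
have := congr1 (fun x : 'X_{1..5} => x i) mE.
by rewrite -k2E mnmDE mnm1E eqxx addn1 => mi'; rewrite mi' in mi.
Qed.

Lemma psX_expE (i : 'I_5) j p m :
  (psX K i ^+ j * p) m = if (j <= m i)%N then p (m - U_(i) *+ j)%MM else 0.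
Proof.
elim: j p m => [|j IH] p m; first by rewrite mul1r /= mulm0n subm0.
rewrite exprSr -mulrA IH psX_mulE mnmBE mulmnE mnm1E eqxx mul1n subn_gt0.
have [jm|jm] := ltnP j (m i); last by case: ifP.
by rewrite ltnW // mulmSr submDA.
Qed.

Lemma at_x1_is_linear : linear (@at_x1 K).
Proof.
move=> c u v; apply/funext => m; rewrite psrDE psrZE /at_x1 !psr_sumE mulr_sumr.
by rewrite -big_split; apply: eq_bigr => j _; rewrite /= mulrDr -scalerAr.
Qed.
HB.instance Definition _ := GRing.isLinear.Build K (nat -> psr 5 K) (psr 5 K) _
  (@at_x1 K) at_x1_is_linear.

Lemma subst_x1_is_linear : linear (@subst_x1 K).
Proof.
move=> c f g; rewrite /subst_x1 -linearP; congr at_x1; apply/funext => j.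
by rewrite -[LHS]/((c * f j + g j) *: (1 : psr 5 K)) scalerDl -scalerA.
Qed.

Lemma subst_x1D f g : subst_x1 (f + g) = subst_x1 f + subst_x1 g.
Proof. by have := subst_x1_is_linear 1 f g; rewrite !scale1r. Qed.

Lemma subst_x1Z (c : K) f : subst_x1 (c *: f) = c *: subst_x1 f.
Proof. by have := subst_x1_is_linear c f 0; rewrite subst_x10 !addr0. Qed.

Lemma subst_x1N f : subst_x1 (- f) = - subst_x1 f.
Proof. by rewrite -scaleN1r subst_x1Z scaleN1r. Qed.

(** The summand of index j is a multiple of x_1^j alone. At m every j below m_1 leaves a positive
    power of x_1, so only the last index can contribute. *)
Lemma subst_x1E f m :
  subst_x1 f m = if m == (U_(ord0) *+ m ord0)%MM then f (m ord0) else 0.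
Proof.
rewrite /subst_x1 /at_x1 psr_sumE big_ord_recr big1 /=; last first.
  move=> j _; rewrite psX_expE ltnW // -[LHS]/((f j : K) * (((m - U_(ord0) *+ j)%MM == 0%MM)%:R)).
  case: eqP => [E|_]; last exact: mulr0.
  move: (congr1 (fun x : 'X_{1..5} => x ord0) E).
  rewrite mnmBE mulmnE mnm1E eqxx mul1n mnm0E => /eqP.
  by rewrite subn_eq0 leqNgt ltn_ord.
rewrite add0r psX_expE leqnn [LHS]/(f _ * ((_ == _)%:R)) /=.
have le : (U_(ord0) *+ m ord0 <= m)%MM.
  apply/mnm_lepP => i; rewrite mulmnE mnm1E.
  by case: eqP => [->|_]; rewrite ?mul1n ?mul0n.
have -> : ((m - U_(ord0) *+ m ord0)%MM == 0%MM) = (m == (U_(ord0) *+ m ord0)%MM).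
  apply/eqP/eqP => [E|{1}->]; last by apply/mnmP => i; rewrite mnmBE subnn mnm0E.
  by rewrite -{1}(submK le) E add0m.
by case: (m == _); [exact: mulr1 | exact: mulr0].
Qed.

(** [at_x1_tens] read backwards expands the product along the powers of x_1 in the first factor,
    which is exactly the Cauchy sum. With injectivity below, K[[t]] is thus embedded as a subring of
    the five-variable series. *)
Lemma subst_x1M f g : subst_x1 (smul f g) = subst_x1 f * subst_x1 g.
Proof.
apply/funext => m; rewrite -at_x1_tens /at_x1 psr_sumE subst_x1E /smul /cauchy.
transitivity (\sum_(j < (m ord0).+1)
    f j * (if m == (U_(ord0) *+ m ord0)%MM then g (m ord0 - j)%N else 0)); last first.
  apply: eq_bigr => -[j] /=; rewrite ltnS => jm _.
  rewrite psX_expE jm -[RHS]/((f j : K) * subst_x1 g (m - U_(ord0) *+ j)%MM) subst_x1E.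
  congr (_ * _).
  rewrite mnmBE mulmnE mnm1E eqxx mul1n.
  suff -> : (m - U_(ord0) *+ j == U_(ord0) *+ (m ord0 - j))%MM
          = (m == (U_(ord0) *+ m ord0)%MM) by [].
  apply/eqP/eqP => E; apply/mnmP => i; last first.
    by rewrite mnmBE {1}E !mulmnE mnm1E mulnBr.
  move: (congr1 (fun x : 'X_{1..5} => x i) E); rewrite mnmBE !mulmnE mnm1E.
  by case: eqP => [<-|_]; rewrite ?mul1n // !mul0n subn0.
case: ifP => _ //; rewrite big1 // => j _; exact: mulr0.
Qed.

Lemma subst_x1_inj : injective (@subst_x1 K).
Proof.
move=> f g /(congr1 (fun h : psr 5 K => fun k => h (U_(ord0) *+ k)%MM)) E.
apply/funext => k; move: (congr1 (@^~ k) E).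
by rewrite /= !subst_x1E mulmnE mnm1E eqxx mul1n eqxx.
Qed.

(** For a sequence in the span of finitely many fixed series, the substitution acts on the
    coefficients only. This is how a sequence of scalar matrices becomes one matrix over
    K[[x_1]]. *)
Lemma at_x1_cst (u : nat -> psr 5 K) (I : finType) (c : I -> nat -> K^o)
    (p : I -> psr 5 K) :
  (forall k, u k = \sum_i (c i k : K) *: p i) ->
  at_x1 u = \sum_i p i * subst_x1 (c i).
Proof.
move=> uE; have -> : u = \sum_i tens (p i) (c i).
  by apply/funext => k; rewrite uE fct_sumE.
rewrite linear_sum; apply: eq_bigr => i _; rewrite [RHS]mulrC; exact: at_x1_tens.
Qed.

End PowerSeriesInX1.

(** * Forms in the basis dx_i, dx_i dx_j *)

Section ConstantFormBasis.
Variables (n : nat) (K : fieldType).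
Implicit Types (X : vf n K) (a b : form n K) (w : 'I_n -> 'I_n -> psr n K)
  (r : 'I_n -> psr n K) (S U : {set 'I_n}) (i j k : 'I_n).

Lemma fsumE (T I : Type) (s : seq I) (P : pred I) (F : I -> T -> psr n K) x :
  (\sum_(i <- s | P i) F i) x = \sum_(i <- s | P i) F i x.
Proof. by elim/big_rec2: _ => // i y z _ <-. Qed.

Lemma pd_sum i (I : Type) (s : seq I) (P : pred I) (F : I -> psr n K) :
  pd i (\sum_(l <- s | P l) F l) = \sum_(l <- s | P l) pd i (F l).
Proof.
elim/big_rec2: _ => [|l y z _ <-]; last by rewrite pdD.
by have := pdZ i 0 (0 : psr n K); rewrite !scale0r.
Qed.

Lemma pdN i (f : psr n K) : pd i (- f) = - pd i f.
Proof. by rewrite -scaleN1r pdZ scaleN1r. Qed.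

Lemma pd0 i : pd i (0 : psr n K) = 0.
Proof. by have := pdZ i 0 (0 : psr n K); rewrite !scale0r. Qed.

Lemma pd_1 i : pd i (1 : psr n K) = 0.
Proof.
have := pdM i (1 : psr n K) 1; rewrite !mulr1 mul1r => /eqP.
by rewrite -subr_eq subrr eq_sym => /eqP.
Qed.

Lemma extdD a b : extd (a + b) = extd a + extd b.
Proof.
rewrite /extd -big_split; apply: eq_bigr => i _ /=; rewrite -wedgeDr.
by congr wedge; apply/funext => S; exact: pdD.
Qed.

Lemma extd_sum (I : Type) (s : seq I) (F : I -> form n K) :
  extd (\sum_(l <- s) F l) = \sum_(l <- s) extd (F l).
Proof.
elim/big_rec2: _ => [|l y z _ <-]; last by rewrite extdD.
by have := extdZ 0 (0 : form n K); rewrite !scale0r.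
Qed.

Lemma contrDr X a b : contr X (a + b) = contr X a + contr X b.
Proof.
apply/funext => S; rewrite /contr -[RHS]big_split; apply: eq_bigr => i _.
by rewrite -[RHS]mulrDr -mulrDr.
Qed.

Lemma contr_fmulr X (f : psr n K) a : contr X (fmul f a) = fmul f (contr X a).
Proof.
apply/funext => S; rewrite [RHS]mulr_sumr; apply: eq_bigr => i _.
by rewrite [RHS]mulrCA; congr (_ * _); exact: mulrCA.
Qed.

Lemma contrf0 X : contr X 0 = 0.
Proof.
have := contr_biscalable 1 0 X (0 : form n K).
by rewrite scale1r mul1r !scale0r.
Qed.

Lemma contr_sum X (I : Type) (s : seq I) (F : I -> form n K) :
  contr X (\sum_(l <- s) F l) = \sum_(l <- s) contr X (F l).
Proof.
by elim/big_rec2: _ => [|l y z _ <-]; rewrite ?contrf0 ?contrDr.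
Qed.

Definition form1 r : form n K := \sum_i fmul (r i) (dx K i).
(** The array w need not be skew: the form depends only on w i j - w j i (see [form2_eq]), so
    unsymmetrised arrays such as the partial derivatives in [extd_form1] are allowed. *)
Definition form2 w : form n K :=
  \sum_i \sum_j fmul (w i j) (wedge (dx K i) (dx K j)).

Lemma form1E r j : form1 r [set j] = r j.
Proof.
rewrite /form1 fsumE (bigD1 j) //= big1 ?addr0; last first.
  move=> i ij; rewrite /fmul /dx /dxm; case: eqP => [/setP/(_ i)|]; last by rewrite mulr0.
  by rewrite !inE eqxx (negbTE ij).
by rewrite /fmul /dx /dxm eqxx mulr1.
Qed.

Lemma form2E w S : form2 w S =
  \sum_i \sum_j w i j * wedge (dx K i) (dx K j) S.
Proof. by rewrite /form2 fsumE; apply: eq_bigr => i _; rewrite fsumE. Qed.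

Lemma form2_set2 w i j : (i < j)%N -> form2 w [set i; j] = w i j - w j i.
Proof.
move=> ij; have ij' : i != j by rewrite -val_eqE /= neq_ltn ij.
have E k l : wedge (dx K k) (dx K l) [set i; j] =
    ((k == i) && (l == j))%:R - ((k == j) && (l == i))%:R.
  rewrite wedge_dx_dx; case: (boolP (_ && _)) => [/andP[kl /eqP/setP H]|H].
    move: (H k) (H l); rewrite !inE !eqxx orbT /=.
    case/orP=> /eqP kE; case/orP=> /eqP lE; subst k l; rewrite ?eqxx in kl * => //=.
      by rewrite (negbTE ij') /= subr0 ltnNge ltnW.
    by rewrite ij expr1 eq_sym (negbTE ij') sub0r.
  case: (boolP (_ && _)) => [/andP[/eqP kE /eqP lE]|_].
    by rewrite kE lE ij' eqxx in H.
  case: (boolP (_ && _)) => [/andP[/eqP kE /eqP lE]|_]; last by rewrite subr0.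
  by rewrite kE lE finset.setUC eqxx eq_sym ij' in H.
rewrite form2E (eq_bigr (fun k => (k == i)%:R * w k j - (k == j)%:R * w k i)).
  rewrite sumrB (bigD1 i) //= big1 ?addr0; last by move=> k /negbTE->; rewrite mul0r.
  rewrite eqxx mul1r (bigD1 j) //= big1 ?addr0; last by move=> k /negbTE->; rewrite mul0r.
  by rewrite eqxx mul1r.
move=> k _; rewrite (eq_bigr (fun l => (k == i)%:R * ((l == j)%:R * w k l)
    - (k == j)%:R * ((l == i)%:R * w k l))); last first.
  by move=> l _; rewrite E -!mulnb !natrM; ring.
rewrite sumrB -!mulr_sumr; congr (_ * _ - _ * _).
  by rewrite (bigD1 j) //= big1 ?addr0 ?eqxx ?mul1r // => l /negbTE->; rewrite mul0r.
by rewrite (bigD1 i) //= big1 ?addr0 ?eqxx ?mul1r // => l /negbTE->; rewrite mul0r.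
Qed.

Lemma form2_is_kform w : is_kform 2 (form2 w).
Proof.
move=> S S2; rewrite form2E big1 // => i _; rewrite big1 // => j _.
rewrite wedge_dx_dx; case: ifP => [/andP[ij /eqP SE]|]; last by rewrite mulr0.
by rewrite SE cards2 ij in S2.
Qed.

Lemma kform2_ext a b : is_kform 2 a -> is_kform 2 b ->
  (forall i j, (i < j)%N -> a [set i; j] = b [set i; j]) -> a = b.
Proof.
move=> a2 b2 ab; apply/funext => S; case: (boolP (#|S| == 2)) => [/cards2P|S2].
  move=> [i [j [ij ->]]]; case: (ltngtP i j) => [/ab //|/ab|/eqP].
    by rewrite finset.setUC.
  by rewrite val_eqE (negbTE ij).
by rewrite (a2 _ S2) (b2 _ S2).
Qed.

Lemma form2_eq w w' : (forall i j, (i < j)%N ->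
  w i j - w j i = w' i j - w' j i) -> form2 w = form2 w'.
Proof.
move=> ww'; apply: kform2_ext; try exact: form2_is_kform.
by move=> i j ij; rewrite !form2_set2 // ww'.
Qed.

Lemma contr_form2 X w :
  contr X (form2 w) = form1 (fun j => \sum_i X i * (w i j - w j i)).
Proof.
have -> : contr X (form2 w) = \sum_i \sum_j
    (fmul (X i * w i j) (dx K j) - fmul (X j * w i j) (dx K i)).
  rewrite contr_sum; apply: eq_bigr => i _; rewrite contr_sum; apply: eq_bigr => j _.
  rewrite contr_fmulr contr_dx_dx; apply/funext => S.
  rewrite -[LHS]/(w i j * (X i * dx K j S - X j * dx K i S)).
  rewrite -[RHS]/(X i * w i j * dx K j S - X j * w i j * dx K i S).
  by rewrite mulrBr !mulrA ![w i j * _]mulrC.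
under eq_bigr do rewrite sumrB.
rewrite sumrB [X in X - _]exchange_big -sumrB /=.
apply: eq_bigr => j _; rewrite -sumrB; apply/funext => S.
rewrite fsumE -[RHS]/((\sum_i X i * (w i j - w j i)) * dx K j S) mulr_suml.
apply: eq_bigr => i _.
rewrite -[LHS]/(X i * w i j * dx K j S - X i * w j i * dx K j S); ring.
Qed.

Lemma extd_form1 r : extd (form1 r) = form2 (fun i j => pd i (r j)).
Proof.
rewrite /form1 extd_sum /form2 exchange_big; apply: eq_bigr => j _ /=.
apply: eq_bigr => i _; rewrite -wedge_fmulr; congr wedge; apply/funext => S.
rewrite /fmul /dx /dxm; case: eqP => _; first by rewrite !mulr1.
by rewrite !mulr0 pd0.
Qed.

Lemma extd_fmul_dx_dx (f : psr n K) i j :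
  extd (fmul f (wedge (dx K i) (dx K j))) =
  \sum_k fmul (pd k f) (wedge (dx K k) (wedge (dx K i) (dx K j))).
Proof.
apply: eq_bigr => k _; rewrite -[RHS]wedge_fmulr; congr wedge; apply/funext => S.
(* The components of dx_i dx_j are 0, 1 or -1, so only f is differentiated. *)
rewrite /fmul pdM [X in _ + f * X](_ : _ = 0) ?mulr0 ?addr0 //.
rewrite wedge_dx_dx; case: ifP => _; last exact: pd0.
by case: (j < i)%N; rewrite ?expr0 ?expr1 ?pdN pd_1 ?oppr0.
Qed.

End ConstantFormBasis.

(** * Bilinearity, anticommutation and associativity of wedge products with the dx_i *)

Section DegreeZero.
Variable K : numFieldType.
Local Notation A := (psr 5 K).
Implicit Types (F G : A) (M N L R w v : 'M[A]_4) (a b : form 5 K).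

Lemma ninv_set1 (i : 'I_5) (S : {set 'I_5}) :
  ninv [set i] S = #|[set k in S | (k < i)%N]|.
Proof.
rewrite /ninv -[RHS](card_imset _ (f := fun k => (i, k))); last by move=> k l [].
apply: eq_card => -[x y]; rewrite inE /= inE; apply/idP/imsetP => [/and3P[/eqP -> yS yi]|].
  by exists y => //; rewrite inE yS.
by move=> [z]; rewrite inE => /andP[zS zi] [-> ->]; rewrite eqxx zS.
Qed.

Lemma ninv_set1D1 (i j : 'I_5) (S : {set 'I_5}) : j \in S ->
  ninv [set i] S = ((j < i) + ninv [set i] (S :\ j))%N.
Proof.
move=> jS; rewrite !ninv_set1 (cardsD1 j) !inE jS /=; congr (_ + _)%N.
by apply: eq_card => k; rewrite !inE andbA.
Qed.

(** Counting inversions against U with both indices removed makes the sign symmetric in i and j,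
    except for the factor of exponent (j < i), which is the source of anticommutation. *)
Lemma wedge_dx_dxE (i j : 'I_5) b (U : {set 'I_5}) :
  wedge (dx K i) (wedge (dx K j) b) U =
  if [&& i \in U, j \in U & i != j] then
    (-1) ^+ (ninv [set i] (U :\ i :\ j) + ninv [set j] (U :\ i :\ j) + (j < i))
    * b (U :\ i :\ j)
  else 0.
Proof.
rewrite !wedge_dxE; case: ifP => //= iU; rewrite !inE eq_sym andbC.
case: ifP => [/andP[jU ij]|]; last by rewrite mulr0.
rewrite (@ninv_set1D1 i j); last by rewrite !inE jU eq_sym ij.
by rewrite mulrA -exprD -addnA [X in _ ^+ X]addnC.
Qed.

Lemma wedge_dx_anti (i j : 'I_5) b :
  wedge (dx K i) (wedge (dx K j) b) = - wedge (dx K j) (wedge (dx K i) b).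
Proof.
apply/funext => U; rewrite -[RHS]/(- (wedge (dx K j) (wedge (dx K i) b) U)) !wedge_dx_dxE.
rewrite andbCA [j == i]eq_sym; case: ifP => [/and3P[jU iU ij]|]; last by rewrite oppr0.
have -> : U :\ j :\ i = U :\ i :\ j by apply/setP => k; rewrite !inE andbCA.
rewrite -mulNr; congr (_ * _); rewrite !exprD -[RHS]mulrN; congr (_ * _); first exact: mulrC.
by move: ij; rewrite -val_eqE /=; case: ltngtP => // _ _; rewrite ?opprK.
Qed.

Lemma wedge_dx_nil (i : 'I_5) b : wedge (dx K i) (wedge (dx K i) b) = 0.
Proof. by apply/funext => U; rewrite wedge_dx_dxE eqxx !andbF. Qed.

Lemma wedgeDl a1 a2 b : wedge (a1 + a2) b = wedge a1 b + wedge a2 b.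
Proof.
apply/funext => U; etransitivity; last exact: big_split.
by apply: eq_bigr => S _; rewrite -[RHS]mulrDr -mulrDl.
Qed.

Lemma wedge_fmull F a b : wedge (fmul F a) b = fmul F (wedge a b).
Proof.
apply/funext => U; rewrite [RHS]mulr_sumr; apply: eq_bigr => S _.
by rewrite [RHS]mulrCA; congr (_ * _); rewrite [RHS]mulrA.
Qed.

Lemma wedge0l b : wedge 0 b = 0.
Proof.
by apply/funext => U; apply: big1 => S _; rewrite [X in _ * X]mul0r mulr0.
Qed.

Lemma wedge_suml (I : Type) (s : seq I) (H : I -> form 5 K) b :
  wedge (\sum_(l <- s) H l) b = \sum_(l <- s) wedge (H l) b.
Proof.
by elim/big_rec2: _ => [|l y z _ <-]; rewrite ?wedge0l ?wedgeDl.
Qed.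

Lemma wedge_sumr (I : Type) (s : seq I) (H : I -> form 5 K) b :
  wedge b (\sum_(l <- s) H l) = \sum_(l <- s) wedge b (H l).
Proof.
by elim/big_rec2: _ => [|l y z _ <-]; rewrite ?wedge0r ?wedgeDr.
Qed.

Lemma wedge_dxA (i j : 'I_5) b :
  wedge (wedge (dx K i) (dx K j)) b = wedge (dx K i) (wedge (dx K j) b).
Proof.
apply/funext => U; rewrite wedge_dx_dxE {1}/wedge.
under eq_bigr do rewrite wedge_dx_dx.
case: (boolP [&& _, _ & _]) => [/and3P[iU jU ij]|H]; last first.
  rewrite big1 // => S SU; case: ifP => [/andP[ij /eqP SE]|]; last by rewrite mul0r mulr0.
  by case/negP: H; rewrite ij andbT; apply/andP; split; apply: (fintype.subsetP SU); rewrite SE !inE eqxx ?orbT.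
rewrite (bigD1 [set i; j]) /=; last first.
  by apply/fintype.subsetP => k; rewrite !inE => /orP[]/eqP->.
rewrite ij eqxx /= big1 ?addr0; last first.
  by move=> S /andP[_ /negbTE->]; rewrite mul0r mulr0.
have -> : U :\: [set i; j] = U :\ i :\ j.
  by apply/setP => k; rewrite !inE negb_or -andbA andbCA.
rewrite mulrA -exprD; congr (_ ^+ (_ + _) * _);
move: (U :\ i :\ j) => T.
rewrite !ninv_set1 /ninv.
rewrite -[X in _ = (X + _)%N](card_imset _ (f := fun k => (i, k))); last by move=> k l [].
rewrite -[X in _ = (_ + X)%N](card_imset _ (f := fun k => (j, k))); last by move=> k l [].
(* The inversions of {i, j} against T are the disjoint union of those of i and those of j; the
   intersection is empty because i and j differ. *)
rewrite -cardsUI [X in (_ + X)%N](_ : _ = 0%N) ?addn0.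
  apply: eq_card => -[x y]; rewrite !inE /=.
  apply/and3P/orP => [[/orP[]/eqP-> yT yx]|[]/imsetP[z]].
  - by left; apply/imsetP; exists y; rewrite // inE yT.
  - by right; apply/imsetP; exists y; rewrite // inE yT.
  - by rewrite inE => /andP[zT zi] [-> ->]; rewrite eqxx.
  - by rewrite inE => /andP[zT zi] [-> ->]; rewrite eqxx orbT.
apply/eqP; rewrite cards_eq0; apply/eqP/setP => -[x y]; rewrite !inE.
apply/negbTE/andP => -[/imsetP[z _ [-> _]] /imsetP[t _ [ijE _]]].
by rewrite ijE eqxx in ij.
Qed.

Lemma wedge_form1E (r : 'I_5 -> A) b (U : {set 'I_5}) :
  wedge (form1 r) b U =
  \sum_i if i \in U then (-1) ^+ ninv [set i] (U :\ i) * (r i * b (U :\ i)) else 0.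
Proof.
rewrite /form1 wedge_suml fsumE; apply: eq_bigr => i _.
rewrite wedge_fmull /fmul wedge_dxE; case: ifP => _; last exact: mulr0.
by rewrite mulrCA.
Qed.

End DegreeZero.

(** * Degree-zero fields and forms *)

Section Coordinates.
Variable K : numFieldType.
Local Notation A := (psr 5 K).
Local Notation pd1 := (@pd 5 K ord0).
Local Notation D := (map_mx pd1).
Implicit Types (F G : A) (M N L P R w v : 'M[A]_4) (a b : form 5 K).

Definition xrow : 'rV[A]_4 := \row_i psX K (lift ord0 i).

(** Linear fields act on the row x from the right, so their bracket is M L - L M in this order. That
    F and M involve x_1 only is required separately, through [x1only] and [mx_x1only]. *)
Definition gvf F M : vf 5 K := fun k =>
  if unlift ord0 k is Some j then (xrow *m M) 0 j else F.

Definition lform R : form 5 K :=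
  form1 (fun k => if unlift ord0 k is Some j then (xrow *m R) 0 j else 0).

(** The terms in dx_1 dx_j are stored in row 0 of the array only, so that the coefficient at {1, j}
    is the j-th entry of x N without a factor 2. The matrix w matters only through its skew part. *)
Definition gform N w : form 5 K := form2 (fun i j =>
  if unlift ord0 j is Some j' then
    if unlift ord0 i is Some i' then w i' j' else (xrow *m N) 0 j'
  else 0).

Definition x1only F := forall k, pd (lift ord0 k) F = 0.
Definition mx_x1only M := forall i j, x1only (M i j).

Lemma pd_xrow M j : pd1 ((xrow *m M) 0 j) = (xrow *m D M) 0 j.
Proof.
rewrite !mxE pd_sum; apply: eq_bigr => i _; rewrite !mxE pdM pd_psX.
by rewrite (negbTE (neq_lift _ _)) mul0r add0r.
Qed.

(** Differentiation recovers the matrix from the linear forms. Besides computing brackets, this is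
    what makes the matrix coordinates unique in [gvf_inj] and [gform_inj]. *)
Lemma pd_lift_xrow M k j : mx_x1only M -> pd (lift ord0 k) ((xrow *m M) 0 j) = M k j.
Proof.
move=> M1; rewrite !mxE pd_sum (bigD1 k) //= big1 ?addr0; last first.
  move=> i ik; rewrite !mxE pdM pd_psX M1 mulr0 addr0.
  by rewrite (inj_eq (@lift_inj _ _)) eq_sym (negbTE ik) mul0r.
by rewrite !mxE pdM pd_psX M1 eqxx mulr0 addr0 mul1r.
Qed.

Lemma x1onlyD F G : x1only F -> x1only G -> x1only (F + G).
Proof. by move=> F1 G1 k; rewrite pdD F1 G1 addr0. Qed.

Lemma x1onlyM F G : x1only F -> x1only G -> x1only (F * G).
Proof. by move=> F1 G1 k; rewrite pdM F1 G1 mulr0 mul0r addr0. Qed.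

Lemma x1only_sum (I : Type) (s : seq I) (H : I -> A) :
  (forall i, x1only (H i)) -> x1only (\sum_(i <- s) H i).
Proof. by move=> H1 k; rewrite pd_sum big1 // => i _; rewrite H1. Qed.

Lemma mx_x1onlyD M N : mx_x1only M -> mx_x1only N -> mx_x1only (M + N).
Proof. by move=> M1 N1 i j; rewrite mxE; exact: x1onlyD. Qed.

Lemma mx_x1onlyM M N : mx_x1only M -> mx_x1only N -> mx_x1only (M *m N).
Proof.
by move=> M1 N1 i j; rewrite mxE; apply: x1only_sum => l; exact: x1onlyM.
Qed.

Lemma mx_x1onlyZ F M : x1only F -> mx_x1only M -> mx_x1only (F *: M).
Proof. by move=> F1 M1 i j; rewrite mxE; exact: x1onlyM. Qed.

Lemma mx_x1onlyN M : mx_x1only M -> mx_x1only (- M).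
Proof. by move=> M1 i j k; rewrite mxE pdN M1 oppr0. Qed.

Lemma mx_x1onlyT M : mx_x1only M -> mx_x1only M^T.
Proof. by move=> M1 i j; rewrite mxE. Qed.

Lemma vapp_gvf F M G : vapp (gvf F M) G =
  F * pd1 G + \sum_i (xrow *m M) 0 i * pd (lift ord0 i) G.
Proof.
rewrite /vapp big_ord_recl /gvf unlift_none; congr (_ + _).
by apply: eq_bigr => i _; rewrite liftK.
Qed.

Lemma vbr_gvf F M G L : x1only F -> x1only G -> mx_x1only M -> mx_x1only L ->
  vbr (gvf F M) (gvf G L) =
  gvf (F * pd1 G - G * pd1 F) (F *: D L - G *: D M + M *m L - L *m M).
Proof.
move=> F1 G1 M1 L1; apply/funext => k; rewrite /vbr !vapp_gvf /gvf.
case: unliftP => [j _|_] /=; last first.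
  by rewrite !big1 ?addr0 // => i _; rewrite ?F1 ?G1 mulr0.
rewrite !pd_xrow.
under eq_bigr do rewrite pd_lift_xrow //.
under [in X in _ - (_ + X)]eq_bigr do rewrite pd_lift_xrow //.
rewrite !mulmxDr !mulmxN !mulmxA -!scalemxAr.
move: (xrow *m M) (xrow *m L) (xrow *m D L) (xrow *m D M) => u1 u2 u3 u4.
by rewrite !mxE; ring.
Qed.

Lemma diverg_gvf F M : mx_x1only M -> diverg (gvf F M) = pd1 F + \tr M.
Proof.
move=> M1; rewrite /diverg big_ord_recl /gvf unlift_none; congr (_ + _).
by apply: eq_bigr => i _; rewrite liftK pd_lift_xrow.
Qed.

(** The dx_1-component is quadratic in x_2, ..., x_5, so the result is not an [lform]; it becomes
    linear again only after applying d. *)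
Lemma contr_gform F M N w : contr (gvf F M) (gform N w) = form1 (fun k =>
  if unlift ord0 k is Some j then (xrow *m (F *: N + M *m (w - w^T))) 0 j
  else - \sum_i (xrow *m M) 0 i * (xrow *m N) 0 i).
Proof.
rewrite /gform contr_form2; congr form1; apply/funext => k.
rewrite big_ord_recl /gvf unlift_none; case: unliftP => [j _|_] /=.
  rewrite subr0 mulmxDr mulmxA -scalemxAr; set u := xrow *m M; set y := xrow *m N.
  rewrite !mxE; congr (_ + _); apply: eq_bigr => i _.
  by rewrite liftK !mxE.
rewrite subrr mulr0 add0r -sumrN; apply: eq_bigr => i _.
by rewrite liftK sub0r mulrN.
Qed.

Lemma gform_eq N w N' w' : N = N' -> w - w^T = w' - w'^T -> gform N w = gform N' w'.
Proof.
move=> <- ww'; apply: form2_eq => i j ij.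
case: (unliftP ord0 i) ij => [i' ->|->]; case: (unliftP ord0 j) => [j' ->|->] //= _.
by move: (congr1 (fun u : 'M_4 => u i' j') ww'); rewrite !mxE.
Qed.

(** On a closed form the Lie derivative is d after contraction. The quadratic dx_1-component of the
    contraction has gradient x (N M^T + M N^T), whence the last two terms. *)
Lemma lie_gform F M N w : x1only F -> mx_x1only M -> mx_x1only N -> mx_x1only w ->
  extd (gform N w) = 0 ->
  lie (gvf F M) (gform N w) =
  gform (D (F *: N + M *m (w - w^T)) + N *m M^T + M *m N^T)
        (F *: N + M *m (w - w^T)).
Proof.
move=> F1 M1 N1 w1 dw; rewrite /lie dw contrf0 addr0 contr_gform.
rewrite extd_form1 /gform; set Q := F *: N + _.
have Q1 : mx_x1only Q.
  apply: mx_x1onlyD; first exact: mx_x1onlyZ.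
  by apply/mx_x1onlyM/mx_x1onlyD => //; apply/mx_x1onlyN/mx_x1onlyT.
apply: form2_eq => i j ij.
case: (unliftP ord0 i) ij => [i' ->|->]; case: (unliftP ord0 j) => [j' ->|->] //= _.
  by rewrite !pd_lift_xrow.
rewrite pdN opprK.
have -> : pd (lift ord0 j') (\sum_i (xrow *m M) 0 i * (xrow *m N) 0 i) =
    (xrow *m (N *m M^T + M *m N^T)) 0 j'.
  rewrite pd_sum; under eq_bigr do rewrite pdM !pd_lift_xrow //.
  rewrite big_split /= mulmxDr [RHS]mxE.
  congr (_ + _); rewrite mulmxA [RHS]mxE; apply: eq_bigr => l _.
    by rewrite [X in _ = _ * X]mxE mulrC.
  by rewrite [X in _ = _ * X]mxE.
rewrite pd_xrow subr0 -addrA; set Z := _ + M *m N^T.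
have -> : xrow *m (D Q + Z) = xrow *m D Q + xrow *m Z by exact: mulmxDr.
by rewrite [RHS]mxE.
Qed.

Lemma gformE N w : gform N w =
  \sum_j fmul ((xrow *m N) 0 j) (wedge (dx K ord0) (dx K (lift ord0 j)))
  + \sum_i \sum_j fmul (w i j) (wedge (dx K (lift ord0 i)) (dx K (lift ord0 j))).
Proof.
rewrite /gform /form2 big_ord_recl; congr (_ + _).
  rewrite big_ord_recl !unlift_none /= fmul0 add0r.
  by apply: eq_bigr => j _; rewrite liftK.
apply: eq_bigr => i _; rewrite big_ord_recl unlift_none /= fmul0 add0r.
by apply: eq_bigr => j _; rewrite !liftK.
Qed.

(** Differentiating w produces only dx_1, while differentiating the x_i in front of dx_1 dx_j
    produces dx_i, which anticommutes past dx_1 and gives -N. Closedness thus becomes the vanishing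
    of the skew part of w' - N. *)
Lemma extd_gform N w : mx_x1only N -> mx_x1only w ->
  extd (gform N w) = wedge (dx K ord0) (gform 0 (D w - N)).
Proof.
move=> N1 w1; rewrite !gformE extdD wedgeDr !extd_sum !wedge_sumr.
rewrite [X in _ = X + _]big1 ?add0r; last first.
  by move=> j _; rewrite mulmx0 mxE fmul0 wedge0r.
under eq_bigr => j _.
  rewrite extd_fmul_dx_dx big_ord_recl wedge_dx_nil fmulf0 add0r.
  under eq_bigr do rewrite pd_lift_xrow // wedge_dx_anti fmulN.
  over.
rewrite exchange_big -big_split /=; apply: eq_bigr => i _.
rewrite extd_sum wedge_sumr -big_split /=; apply: eq_bigr => j _.
rewrite extd_fmul_dx_dx big_ord_recl [X in _ + (_ + X)]big1 ?addr0; last first.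
  by move=> k _; rewrite w1 fmul0.
rewrite wedge_fmulr !mxE addrC fmulDl; congr (_ + _).
by apply/funext => S; apply/esym; exact: mulNr.
Qed.

End Coordinates.

(** * The odd bracket and the dual of a skew matrix *)

Section PermutationSign.

(** The Vandermonde determinant of the values of t. Its sign is the signature when t is a
    permutation, and it vanishes when two values agree, which matches the default value 0 of
    [perm_sign5]; unlike [perm_sign5], it can be evaluated. *)
Definition vdm5 (t : 'I_5 -> 'I_5) : int :=
  \prod_(a < 5) \prod_(b < 5)
    (if (a < b)%N then (t b)%:Z - (t a)%:Z else 1).

Lemma perm_sign5E (K : fieldType) (i j h k l : 'I_5) :
  perm_sign5 K i j h k l = (sgz (vdm5 (tnth [tuple i; j; h; k; l])))%:~R.
Proof.
rewrite /perm_sign5; set t := tnth _.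
case: insubP => [s _ sE|].
  have st a : s a = t a by rewrite -pvalE -[pval s]/(val s) sE ffunE.
  have -> : vdm5 t = vdm5 id * (-1) ^+ s.
    pose row_of (u : 'I_5 -> 'I_5) : 'rV[int]_5 := \row_a (u a)%:Z.
    have vE u : vdm5 u = \det (Vandermonde 5 (row_of u)).
      rewrite det_Vandermonde; apply: eq_bigr => a _; rewrite [RHS]big_mkcond.
      by apply: eq_bigr => b _; rewrite !mxE.
    have E : Vandermonde 5 (row_of t) = col_perm s (Vandermonde 5 (row_of id)).
      by apply/matrixP => a b; rewrite !mxE st.
    by rewrite !vE E col_permE det_mulmx det_perm odd_permV.
  rewrite sgzM (_ : sgz (vdm5 id) = 1) ?mul1r; last first.
    by rewrite /vdm5 !big_ord_recl !big_ord0; vm_compute.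
  by case: (odd_perm s); rewrite ?expr0 ?expr1 ?sgzN ?sgz1 ?mulrN1z.
move=> tinj; have [->|v0] := eqVneq (vdm5 t) 0; first by rewrite sgz0.
case/negP: tinj; apply/injectiveP => a b; rewrite !ffunE => tab; apply/eqP.
apply: contraNT v0 => ab; apply/eqP; rewrite /vdm5.
wlog ab' : a b ab tab / (a < b)%N.
  move=> H; case: (ltngtP a b) => [|ba|/val_inj abE]; first exact: H.
    by apply: (H b a) => //; rewrite eq_sym.
  by rewrite abE eqxx in ab.
by rewrite (bigD1 a) //= (bigD1 b) //= ab' tab subrr !mul0r.
Qed.

End PermutationSign.

(* Indices are kept in the shape [ord0] and [lift ord0 _], so that [unlift]
   computes by [unlift_none] and [liftK]. *)
Local Notation o0 := (@Ordinal 4 0 isT).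
Local Notation o1 := (@Ordinal 4 1 isT).
Local Notation o2 := (@Ordinal 4 2 isT).
Local Notation o3 := (@Ordinal 4 3 isT).
Local Notation q0 := (@ord0 4).
Local Notation q1 := (@lift 5 ord0 o0).
Local Notation q2 := (@lift 5 ord0 o1).
Local Notation q3 := (@lift 5 ord0 o2).
Local Notation q4 := (@lift 5 ord0 o3).

Lemma sum4 (V : nmodType) (F : 'I_4 -> V) :
  \sum_i F i = F o0 + F o1 + F o2 + F o3.
Proof.
rewrite !big_ord_recl big_ord0 addr0 !addrA.
by congr (F _ + F _ + F _ + F _); exact: val_inj.
Qed.

Lemma sum5 (V : nmodType) (F : 'I_5 -> V) :
  \sum_i F i = F q0 + F q1 + F q2 + F q3 + F q4.
Proof. by rewrite big_ord_recl sum4 !addrA. Qed.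

Lemma forall4 (P : 'I_4 -> Prop) : P o0 -> P o1 -> P o2 -> P o3 -> forall i, P i.
Proof.
by move=> P0 P1 P2 P3 [[|[|[|[|//]]]] i4]; rewrite (bool_irrelevance i4 isT).
Qed.

Lemma sum_pairs5 (V : nmodType) (F : 'I_5 -> 'I_5 -> V) :
  \sum_(i < 5) \sum_(j < 5 | (i < j)%N) F i j =
  F q0 q1 + F q0 q2 + F q0 q3 + F q0 q4 + F q1 q2 + F q1 q3 + F q1 q4
  + F q2 q3 + F q2 q4 + F q3 q4.
Proof.
under eq_bigr do rewrite big_mkcond /= sum5.
by rewrite sum5 /= ?add0r ?addr0 !addrA.
Qed.

(** The sign of the same Vandermonde product, written on natural numbers so that closed instances
    reduce by [vm_compute]. *)
Definition eps5 (i j h k l : nat) : int :=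
  sgz ((j%:Z - i%:Z) * (h%:Z - i%:Z) * (k%:Z - i%:Z) * (l%:Z - i%:Z)
     * (h%:Z - j%:Z) * (k%:Z - j%:Z) * (l%:Z - j%:Z)
     * (k%:Z - h%:Z) * (l%:Z - h%:Z) * (l%:Z - k%:Z)).

Lemma perm_sign5_eps (K : fieldType) (i j h k l : 'I_5) :
  perm_sign5 K i j h k l = (eps5 i j h k l)%:~R.
Proof.
rewrite perm_sign5E /eps5 /vdm5 !big_ord_recl !big_ord0 /= !(tnth_nth ord0) /=.
by rewrite ?mul1r ?mulr1 !mulrA.
Qed.

Ltac eval_eps5 := repeat match goal with |- context [eps5 ?a ?b ?c ?d ?e] =>
  let v := eval vm_compute in (eps5 a b c d e) in
  change (eps5 a b c d e) with v end.

(** Among the 100 pairs of index pairs, each l keeps the 6 ordered splittings of its complement into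
    two pairs. *)
Lemma eps5_sum (R : pzRingType) (V : lmodType R)
    (T : 'I_5 -> 'I_5 -> 'I_5 -> 'I_5 -> V) (l : 'I_5) :
  \sum_(i < 5) \sum_(j < 5 | (i < j)%N) \sum_(h < 5) \sum_(k < 5 | (h < k)%N)
     (eps5 i j h k l)%:~R *: T i j h k =
  nth 0 [::
    T q1 q2 q3 q4 - T q1 q3 q2 q4 + T q1 q4 q2 q3 + T q2 q3 q1 q4 - T q2 q4 q1 q3 + T q3 q4 q1 q2;
    - T q0 q2 q3 q4 + T q0 q3 q2 q4 - T q0 q4 q2 q3 - T q2 q3 q0 q4 + T q2 q4 q0 q3 - T q3 q4 q0 q2;
    T q0 q1 q3 q4 - T q0 q3 q1 q4 + T q0 q4 q1 q3 + T q1 q3 q0 q4 - T q1 q4 q0 q3 + T q3 q4 q0 q1;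
    - T q0 q1 q2 q4 + T q0 q2 q1 q4 - T q0 q4 q1 q2 - T q1 q2 q0 q4 + T q1 q4 q0 q2 - T q2 q4 q0 q1;
    T q0 q1 q2 q3 - T q0 q2 q1 q3 + T q0 q3 q1 q2 + T q1 q2 q0 q3 - T q1 q3 q0 q2 + T q2 q3 q0 q1] l.
Proof.
rewrite sum_pairs5 !sum_pairs5.
case: (unliftP ord0 l) => [j ->|->]; last first.
  by eval_eps5; rewrite ?scale0r ?addr0 ?add0r ?scale1r ?scaleN1r.
by move: j; apply: forall4; eval_eps5;
   rewrite ?scale0r ?addr0 ?add0r ?scale1r ?scaleN1r.
Qed.

Definition altmx (T : comNzRingType) (W : 'M[T]_4) :=
  (forall i, W i i = 0) /\ (forall i j, W j i = - W i j).

Lemma altmx_asym (T : comNzRingType) (w : 'M[T]_4) : altmx (w - w^T).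
Proof. by split=> [i|i j]; rewrite !mxE ?subrr ?opprB. Qed.

(** The negative of the usual dual, which sends W_01 to W_23. With this sign it is the Pfaffian
    adjugate: W * star W = Pf(W) * 1 for skew W. Only the entries of W above the diagonal are read,
    so the result is always skew. *)
Definition star {T : comNzRingType} (W : 'M[T]_4) : 'M[T]_4 :=
  \matrix_(i, j) nth 0 (nth [::] [::
    [:: 0; - W o2 o3; W o1 o3; - W o1 o2];
    [:: W o2 o3; 0; - W o0 o3; W o0 o2];
    [:: - W o1 o3; W o0 o3; 0; - W o0 o1];
    [:: W o1 o2; - W o0 o2; W o0 o1; 0]] i) j.

(** The polarised Pfaffian, with [pf W W] equal to twice Pf(W); [wedge_gform] identifies it with the
    coefficient of a product of two 2-forms. *)
Definition pf {T : comNzRingType} (W V : 'M[T]_4) : T :=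
  W o0 o1 * V o2 o3 - W o0 o2 * V o1 o3 + W o0 o3 * V o1 o2
  + W o1 o2 * V o0 o3 - W o1 o3 * V o0 o2 + W o2 o3 * V o0 o1.

(** Polarisation of W * star W = Pf(W) * 1, checked entry by entry after expressing everything
    through the six entries above the diagonal. *)
Lemma star_anti (T : comNzRingType) (W V : 'M[T]_4) : altmx W -> altmx V ->
  W *m star V + V *m star W = (pf W V)%:M.
Proof.
move=> [W0 WN] [V0 VN].
have WE := (W0, WN o0 o1, WN o0 o2, WN o0 o3, WN o1 o2, WN o1 o3, WN o2 o3).
have VE := (V0, VN o0 o1, VN o0 o2, VN o0 o3, VN o1 o2, VN o1 o3, VN o2 o3).
apply/matrixP; apply: forall4; apply: forall4;
by rewrite !mxE !sum4 !mxE /= !(WE, VE) ?mulr1n ?mulr0n /pf; ring.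
Qed.

Lemma star_row (T : comNzRingType) (x : 'rV[T]_4) (N P W V : 'M[T]_4) :
  x *m (- (N *m star V + P *m star W)) =
  - ((x *m N) *m star V + (x *m P) *m star W).
Proof. by rewrite mulmxN mulmxDr !mulmxA. Qed.

(** The list has the shape in which [eps5_sum] leaves the last four components of the odd bracket; r
    and y are the dx_1-parts of the two forms, W and V their skew matrices. *)
Lemma star_rowE (T : comNzRingType) (r y : 'rV[T]_4) (W V : 'M[T]_4) (j : 'I_4) :
  nth 0 [::
    - (r 0 o1 * V o2 o3) + r 0 o2 * V o1 o3 - r 0 o3 * V o1 o2
    - W o1 o2 * y 0 o3 + W o1 o3 * y 0 o2 - W o2 o3 * y 0 o1;
    r 0 o0 * V o2 o3 - r 0 o2 * V o0 o3 + r 0 o3 * V o0 o2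
    + W o0 o2 * y 0 o3 - W o0 o3 * y 0 o2 + W o2 o3 * y 0 o0;
    - (r 0 o0 * V o1 o3) + r 0 o1 * V o0 o3 - r 0 o3 * V o0 o1
    - W o0 o1 * y 0 o3 + W o0 o3 * y 0 o1 - W o1 o3 * y 0 o0;
    r 0 o0 * V o1 o2 - r 0 o1 * V o0 o2 + r 0 o2 * V o0 o1
    + W o0 o1 * y 0 o2 - W o0 o2 * y 0 o1 + W o1 o2 * y 0 o0] j =
  (- (r *m star V + y *m star W)) 0 j.
Proof. by move: j; apply: forall4; rewrite !mxE !sum4 !mxE /=; ring. Qed.

Section DualForms.
Variable K : numFieldType.
Local Notation A := (psr 5 K).
Implicit Types (F G : A) (M N L P R w v : 'M[A]_4) (a b : form 5 K).

Lemma odd_bracketE a b l : odd_bracket a b l =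
  \sum_(i < 5) \sum_(j < 5 | (i < j)%N) \sum_(h < 5) \sum_(k < 5 | (h < k)%N)
     (eps5 i j h k l)%:~R *: (a [set i; j] * b [set h; k]).
Proof.
apply: eq_bigr => i _; apply: eq_bigr => j _; apply: eq_bigr => h _.
by apply: eq_bigr => k _; rewrite perm_sign5_eps.
Qed.

Lemma gform_set2_0 N w j : gform N w [set ord0; lift ord0 j] = (xrow K *m N) 0 j.
Proof. by rewrite /gform form2_set2 // unlift_none liftK subr0. Qed.

Lemma gform_set2 N w (i j : 'I_4) : (i < j)%N ->
  gform N w [set lift ord0 i; lift ord0 j] = (w - w^T) i j.
Proof. by move=> ij; rewrite /gform form2_set2 ?lift0 // !liftK !mxE. Qed.

Lemma odd_bracket_gform N w P v :
  odd_bracket (gform N w) (gform P v) =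
  gvf (pf (w - w^T) (v - v^T)) (- (N *m star (v - v^T) + P *m star (w - w^T))).
Proof.
apply/funext => l; rewrite odd_bracketE eps5_sum !gform_set2_0 !gform_set2 //.
rewrite /gvf; case: (unliftP ord0 l) => [j ->|->]; last by [].
by rewrite star_row; exact: star_rowE.
Qed.

End DualForms.

(** * Wedge products of degree-zero forms, and 3-forms read as vector fields *)

Section WedgeOfDegreeZero.
Variable K : numFieldType.
Local Notation A := (psr 5 K).
Implicit Types (F G : A) (M N L P R w v : 'M[A]_4) (a b : form 5 K).

Lemma set5P (S T : {set 'I_5}) : (ord0 \in S) = (ord0 \in T) ->
  (forall i : 'I_4, (lift ord0 i \in S) = (lift ord0 i \in T)) -> S = T.
Proof. by move=> H0 H; apply/setP => i; case: (unliftP ord0 i) => [j ->|->]. Qed.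

Lemma ninv_set1_set2 (i j k : 'I_5) : (j < k)%N ->
  ninv [set i] [set j; k] = ((j < i) + (k < i))%N.
Proof.
move=> jk; rewrite (@ninv_set1D1 _ j) ?inE ?eqxx //; congr (_ + _)%N.
rewrite setU1K ?ninv1 //; first by rewrite inE -val_eqE /= neq_ltn jk.
Qed.

Lemma ninv_set1_set3 (i j k l : 'I_5) : (j < k)%N -> (k < l)%N ->
  ninv [set i] [set j; k; l] = ((j < i) + (k < i) + (l < i))%N.
Proof.
move=> jk kl; rewrite (@ninv_set1D1 _ l) ?inE ?eqxx ?orbT // addnC; congr (_ + _)%N.
rewrite finset.setUC setU1K ?ninv_set1_set2 // !inE -!val_eqE /= negb_or.
by rewrite !neq_ltn kl (ltn_trans jk kl) !orbT.
Qed.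

Lemma wedge_form1_set3 (r : 'I_5 -> A) b (i j k : 'I_5) : (i < j)%N -> (j < k)%N ->
  wedge (form1 r) b [set i; j; k] =
  r i * b [set j; k] - r j * b [set i; k] + r k * b [set i; j].
Proof.
move=> ij jk; have ik := ltn_trans ij jk.
have nij : i == j = false by rewrite -val_eqE /= ltn_eqF.
have nik : i == k = false by rewrite -val_eqE /= ltn_eqF.
have njk : j == k = false by rewrite -val_eqE /= ltn_eqF.
have Si : [set i; j; k] :\ i = [set j; k].
  apply/setP => l; rewrite !inE; case: (eqVneq l i) => [->|] //=.
  by rewrite nij nik.
have Sj : [set i; j; k] :\ j = [set i; k].
  apply/setP => l; rewrite !inE; case: (eqVneq l j) => [->|] //=; last by rewrite orbF.
  by rewrite [j == i]eq_sym nij njk.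
have Sk : [set i; j; k] :\ k = [set i; j].
  apply/setP => l; rewrite !inE; case: (eqVneq l k) => [->|] /=; last by rewrite orbF.
  by rewrite ![k == _]eq_sym nik njk.
rewrite wedge_form1E -big_mkcond (bigD1 i) ?inE ?eqxx //= (bigD1 j) /=; last first.
  by rewrite !inE eqxx orbT [j == i]eq_sym nij.
rewrite (bigD1 k) /=; last by rewrite !inE eqxx orbT ![k == _]eq_sym nik njk.
rewrite big1 ?addr0; last first.
  by move=> l /andP[/andP[/andP[]]]; rewrite !inE => /orP[/orP[]|] /eqP->; rewrite eqxx.
have ji : (j < i)%N = false by rewrite ltnNge ltnW.
have ki : (k < i)%N = false by rewrite ltnNge ltnW.
have kj : (k < j)%N = false by rewrite ltnNge ltnW.
rewrite Si Sj Sk !ninv_set1_set2 // ij ik jk ji ki kj !addrA.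
by rewrite !(expr0, expr1, mul1r, mulN1r, sqrrN, expr1n).
Qed.

Lemma wedge_form1_gform (r : 'I_5 -> A) P v (i j k : 'I_4) : (i < j)%N -> (j < k)%N ->
  wedge (form1 r) (gform P v) [set lift ord0 i; lift ord0 j; lift ord0 k] =
  r (lift ord0 i) * (v - v^T) j k - r (lift ord0 j) * (v - v^T) i k
  + r (lift ord0 k) * (v - v^T) i j.
Proof.
by move=> ij jk; rewrite wedge_form1_set3 ?lift0 // !gform_set2 //; apply: ltn_trans jk.
Qed.

Lemma setC_0 : ~: [set q0; q1] = [set q2; q3; q4] /\ ~: [set q0; q2] = [set q1; q3; q4]
  /\ ~: [set q0; q3] = [set q1; q2; q4] /\ ~: [set q0; q4] = [set q1; q2; q3].
Proof. by do !split; (apply: set5P; first by rewrite !inE); apply: forall4; rewrite !inE. Qed.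

Lemma wedge_form2_form1 (z : 'I_5 -> 'I_5 -> A) (r : 'I_5 -> A) :
  wedge (form2 z) (form1 r) = wedge (form1 r) (form2 z).
Proof.
rewrite /form1 wedge_sumr wedge_suml; apply: eq_bigr => k _.
rewrite wedge_fmulr wedge_fmull; congr fmul.
rewrite /form2 wedge_suml wedge_sumr; apply: eq_bigr => i _.
rewrite wedge_suml wedge_sumr; apply: eq_bigr => j _.
rewrite wedge_fmull wedge_fmulr wedge_dxA; congr fmul.
by rewrite [wedge (dx K j) _]wedge_dxC -scaleN1r wedgeZr scaleN1r wedge_dx_anti opprK.
Qed.

Lemma vf_of_3form_lform R P v :
  vf_of_3form (wedge (lform R) (gform P v)) = gvf 0 (R *m star (v - v^T)).
Proof.
have [E1 [E2 [E3 E4]]] := setC_0.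
apply/funext => l; rewrite /vf_of_3form /gvf.
case: (unliftP ord0 l) => [j ->|->]; last by [].
rewrite eq_sym (negbTE (neq_lift _ _)) mulmxA /lform.
move: j; apply: forall4;
  rewrite ?(E1, E2, E3, E4) wedge_form1_gform // !liftK ninv_set1_set3 //=;
  move: (xrow K *m R) (v - v^T) => r V; rewrite !mxE !sum4 !mxE /=; ring.
Qed.

Lemma wedge_gform_lform R N w :
  wedge (gform N w) (lform R) = wedge (lform R) (gform N w).
Proof. exact: wedge_form2_form1. Qed.

Lemma wedge_gform N w P v :
  wedge (gform N w) (gform P v) (~: [set ord0]) = pf (w - w^T) (v - v^T).
Proof.
(* Writing the left factor as the sum of dx_i times the 1-form of row i of its array reduces the
   4-form to the known products of a 1-form with a 2-form. *)
pose z (i j : 'I_5) : A := if unlift ord0 j is Some j' then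
  if unlift ord0 i is Some i' then w i' j' else (xrow K *m N) 0 j' else 0.
have -> : wedge (gform N w) (gform P v) =
    \sum_i wedge (dx K i) (wedge (form1 (z i)) (gform P v)).
  rewrite {1}/gform -/z {1}/form2 wedge_suml; apply: eq_bigr => i _.
  rewrite wedge_suml /form1 wedge_suml wedge_sumr; apply: eq_bigr => j _.
  by rewrite !wedge_fmull wedge_fmulr wedge_dxA.
rewrite fsumE sum5 !wedge_dxE.
have U0 : (q0 \in ~: [set q0]) = false by rewrite !inE.
have U1 j : lift q0 j \in ~: [set q0] by rewrite !inE eq_sym neq_lift.
have D (j : 'I_4) : ~: [set q0] :\ lift q0 j = ~: [set q0; lift q0 j].
  by apply/setP => k; rewrite !inE negb_or andbC.
have [E1 [E2 [E3 E4]]] := setC_0.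
rewrite U0 !U1 add0r !D E1 E2 E3 E4 !wedge_form1_gform // !ninv_set1_set3 // /z !liftK.
move: (v - v^T) => V.
rewrite /pf !mxE /=; ring.
Qed.

End WedgeOfDegreeZero.

(** * E(1,6) in coordinates *)

Section LinearSequences.
Variables (K : fieldType) (V W : lmodType K) (phi : V -> W).
Variable phi_linear : linear phi.
Implicit Types u v : nat -> V.

HB.instance Definition _ := GRing.isLinear.Build K V W _ phi phi_linear.

Lemma lin_compD u v : phi \o (u + v) = (phi \o u) + (phi \o v).
Proof. by apply/funext => k; exact: linearD. Qed.

Lemma lin_compN u : phi \o (- u) = - (phi \o u).
Proof. by apply/funext => k; exact: linearN. Qed.

Lemma lin_compZ (c : K) u : phi \o (c *: u) = c *: (phi \o u).
Proof. by apply/funext => k; exact: linearZ. Qed.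

Lemma lin_tder u : tder (phi \o u) = phi \o tder u.
Proof. by apply/funext => k; rewrite /tder /= linearMn. Qed.

(** A bilinear operation has to be computed in coordinates on constant elements only; the extension
    to series follows from linearity of the target coordinates. *)
Lemma lin_cauchy (V1 V2 W1 W2 : lmodType K) (f1 : V1 -> W1) (f2 : V2 -> W2)
    (beta : W1 -> W2 -> W) (gamma : V1 -> V2 -> V) (s : nat -> V1) (t : nat -> V2) :
  (forall x y, beta (f1 x) (f2 y) = phi (gamma x y)) ->
  cauchy beta (f1 \o s) (f2 \o t) = phi \o cauchy gamma s t.
Proof.
move=> H; apply/funext => k; rewrite /cauchy /= linear_sum.
by apply: eq_bigr => i _; rewrite /= H.
Qed.

Lemma lin_smul (f : nat -> K^o) u : smul f (phi \o u) = phi \o smul f u.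
Proof.
apply/funext => k; rewrite /smul /cauchy /= linear_sum.
by apply: eq_bigr => i _; rewrite /= linearZ.
Qed.

Lemma lin_dens_act c (f : nat -> K^o) u :
  dens_act c f (phi \o u) = phi \o dens_act c f u.
Proof. by rewrite /dens_act lin_tder !lin_smul !lin_compD lin_compZ. Qed.

End LinearSequences.

Section CoordinatesOfE16.
Variable K : numFieldType.
Local Notation A := (psr 5 K).
Local Notation D := (map_mx (@pd 5 K ord0)).
Implicit Types (b c w : 'M[K]_4) (M N R : 'M[A]_4).

Definition cst b : 'M[A]_4 := map_mx (in_alg A) b.

(** No factor 1/2 is included, so applying [asym] twice doubles; the halves in the coordinate form
    of [psi] compensate for this. *)
Definition asym (T : comNzRingType) (w : 'M[T]_4) := w - w^T.
Definition sym (T : comNzRingType) (c : 'M[T]_4) := c + c^T.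

Definition vfm b : vf 5 K := gvf 0 (cst b).
Definition qf c : psr 5 K := (xrow K *m cst c *m (xrow K)^T) 0 0.
Definition al w : form 5 K := gform 0 (cst w).

Lemma gvfD (F G : A) M N : gvf F M + gvf G N = gvf (F + G) (M + N).
Proof.
apply/funext => l; rewrite -[LHS]/(gvf F M l + gvf G N l) /gvf.
by case: unliftP => // j _; rewrite mulmxDr [RHS]mxE.
Qed.

Lemma gvfZ (F : A) (a : K) M : a *: gvf F M = gvf (a *: F) (a%:A *: M).
Proof.
apply/funext => l; rewrite -[LHS]/(a *: gvf F M l) /gvf.
by case: unliftP => // j _; rewrite -scalemxAr [RHS]mxE -scalerAl mul1r.
Qed.

Lemma gformD (N w N' w' : 'M[A]_4) : gform N w + gform N' w' = gform (N + N') (w + w') :> form 5 K.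
Proof.
apply/funext => S; rewrite -[LHS]/(gform N w S + gform N' w' S) /gform !form2E.
rewrite -big_split; apply: eq_bigr => i _; rewrite -big_split; apply: eq_bigr => j _ /=.
rewrite -mulrDl; congr (_ * _); case: unliftP => [j' _|_]; last exact: addr0.
by case: unliftP => [i' _|_]; rewrite ?mulmxDr [RHS]mxE.
Qed.

Lemma gformZ (a : K) (N w : 'M[A]_4) : a *: gform N w = gform (a%:A *: N) (a%:A *: w) :> form 5 K.
Proof.
apply/funext => S; rewrite -[LHS]/(a *: gform N w S) /gform !form2E.
rewrite scaler_sumr; apply: eq_bigr => i _; rewrite scaler_sumr; apply: eq_bigr => j _ /=.
rewrite scalerAl; congr (_ * _); case: unliftP => [j' _|_]; last exact: scaler0.
by case: unliftP => [i' _|_]; rewrite -?scalemxAr [RHS]mxE -scalerAl mul1r.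
Qed.

Lemma cstZ (a : K) b : cst (a *: b) = a%:A *: cst b.
Proof. by rewrite /cst map_mxZ. Qed.

Lemma vfm_is_linear : linear vfm.
Proof.
move=> a b b'; rewrite /vfm gvfZ gvfD scaler0 addr0 -cstZ.
by rewrite /cst map_mxD.
Qed.

Lemma al_is_linear : linear al.
Proof.
move=> a b b'; rewrite /al gformZ gformD scaler0 addr0 -cstZ.
by rewrite /cst map_mxD.
Qed.

Lemma qf_is_linear : linear qf.
Proof.
move=> a b b'; rewrite /qf /cst map_mxD map_mxZ mulmxDr mulmxDl -scalemxAr -scalemxAl.
by rewrite [LHS]mxE [X in X + _]mxE -scalerAl mul1r.
Qed.

Lemma asym_cst (w : 'M[K]_4) : asym (cst w) = cst (asym w).
Proof. by rewrite /asym /cst map_mxB map_trmx. Qed.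

Lemma cst_x1only b : mx_x1only (cst b).
Proof.
by move=> i j k; rewrite mxE /= pdZ pd_1 scaler0.
Qed.

Lemma D_cst b : D (cst b) = 0.
Proof.
by apply/matrixP => i j; rewrite !mxE /= pdZ pd_1 scaler0.
Qed.

Lemma x1only0 : x1only (0 : A). Proof. by move=> k; rewrite pd0. Qed.

Lemma mx_x1only0 : mx_x1only (0 : 'M[A]_4).
Proof. by move=> i j k; rewrite mxE pd0. Qed.

Lemma cstM b b' : cst (b *m b') = cst b *m cst b'.
Proof. by rewrite /cst map_mxM. Qed.

Lemma cstB b b' : cst (b - b') = cst b - cst b'.
Proof. by rewrite /cst map_mxB. Qed.

Lemma cstD b b' : cst (b + b') = cst b + cst b'.
Proof. by rewrite /cst map_mxD. Qed.

Lemma cst_tr b : cst b^T = (cst b)^T.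
Proof. by rewrite /cst map_trmx. Qed.

Lemma star_map (R T : comNzRingType) (f : {rmorphism R -> T}) (W : 'M[R]_4) :
  map_mx f (star W) = star (map_mx f W).
Proof.
by apply/matrixP; apply: forall4; apply: forall4; rewrite !mxE /= ?rmorph0 ?rmorphN ?mxE.
Qed.

Lemma pf_map (R T : comNzRingType) (f : {rmorphism R -> T}) (W V : 'M[R]_4) :
  f (pf W V) = pf (map_mx f W) (map_mx f V).
Proof. by rewrite /pf !mxE !(rmorphD, rmorphN, rmorphM). Qed.

Lemma cst_star w : cst (star w) = star (cst w).
Proof. exact: star_map. Qed.

Lemma scale0mx (w : 'M[A]_4) : (0 : A) *: w = 0. Proof. exact: scale0r. Qed.

Lemma vbr_vfm b b' : vbr (vfm b) (vfm b') = vfm (b *m b' - b' *m b).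
Proof.
rewrite /vfm vbr_gvf; try exact: x1only0; try exact: cst_x1only.
by rewrite mul0r subr0 !scale0mx subr0 add0r cstB !cstM.
Qed.

End CoordinatesOfE16.

Section CoordinatesOfE16.
Variable K : numFieldType.
Local Notation A := (psr 5 K).
Local Notation D := (map_mx (@pd 5 K ord0)).
Implicit Types (b c w : 'M[K]_4) (M N R : 'M[A]_4).

Lemma extd_al w : extd (al w) = 0.
Proof.
rewrite /al extd_gform; [|exact: mx_x1only0|exact: cst_x1only].
rewrite D_cst subr0 gformE mulmx0 big1 => [|j _]; last by rewrite mxE fmul0.
rewrite add0r big1 ?wedge0r // => i _; rewrite big1 // => j _.
by rewrite mxE fmul0.
Qed.

Lemma sym_tr (T : comNzRingType) (c : 'M[T]_4) : (sym c)^T = sym c.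
Proof. by rewrite /sym linearD /= trmxK addrC. Qed.

Lemma pd_qf (k : 'I_4) c : pd (lift ord0 k) (qf c) = (xrow K *m cst (sym c)) 0 k.
Proof.
have C := @cst_x1only _ c.
rewrite /qf mxE pd_sum; under eq_bigr do rewrite pdM (pd_lift_xrow _ _ C).
rewrite big_split /= cstD cst_tr mulmxDr [RHS]mxE addrC; congr (_ + _).
  rewrite (bigD1 k) //= big1 ?addr0; last first.
    move=> i ik; rewrite [X in pd _ X]mxE [X in pd _ X]mxE pd_psX.
    by rewrite (inj_eq (@lift_inj _ _)) eq_sym (negbTE ik) mulr0.
  by rewrite [X in pd _ X]mxE [X in pd _ X]mxE pd_psX eqxx mulr1.
rewrite [RHS]mxE; apply: eq_bigr => i _; rewrite mulrC.
by congr (_ * _); [rewrite [LHS]mxE | rewrite [RHS]mxE].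
Qed.

Lemma pd0_qf c : pd ord0 (qf c) = 0.
Proof.
have X0 i : pd ord0 (xrow K 0 i) = 0 by rewrite mxE pd_psX (negbTE (neq_lift _ _)).
rewrite /qf mxE pd_sum big1 // => i _.
by rewrite pdM pd_xrow D_cst mulmx0 [X in pd _ X]mxE X0 mxE mul0r mulr0 addr0.
Qed.

(** The gradient of the quadratic form is x (c + c^T). The resulting matrix is not symmetric, which
    is harmless because [qf] sees only the symmetric part. *)
Lemma vapp_vfm_qf b c : vapp (vfm b) (qf c) = qf (b *m sym c).
Proof.
rewrite /vfm vapp_gvf mul0r add0r; under eq_bigr do rewrite pd_qf.
have -> : qf (b *m sym c) =
    ((xrow K *m cst b) *m (xrow K *m cst (sym c))^T) 0 0.
  by rewrite trmx_mul -cst_tr sym_tr /qf cstM !mulmxA.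
by rewrite [RHS]mxE; apply: eq_bigr => i _; rewrite [X in _ = _ * X]mxE.
Qed.

Lemma extd_fform_qf c : extd (fform (qf c)) = lform (cst (sym c)).
Proof.
rewrite extd_fform; apply: eq_bigr => k _; congr fmul.
by case: (unliftP ord0 k) => [j ->|->]; rewrite ?pd_qf ?pd0_qf.
Qed.

Lemma wedge_dx0_lform R : wedge (dx K ord0) (lform R) = gform R 0.
Proof.
rewrite /lform /form1 big_ord_recl unlift_none fmul0 add0r wedge_sumr gformE.
rewrite [X in _ = _ + X]big1 ?addr0.
  by apply: eq_bigr => i _; rewrite liftK wedge_fmulr.
by move=> i _; rewrite big1 // => j _; rewrite mxE fmul0.
Qed.

Lemma euler_gvf : euler K = gvf 0 1%:M.
Proof.
apply/funext => l; rewrite /euler /gvf mulmx1.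
by case: (unliftP ord0 l) => [j ->|->]; rewrite // eq_sym (negbTE (neq_lift _ _)) mxE.
Qed.

Lemma contr_gvf0_gform0 M (w : 'M[A]_4) : contr (gvf 0 M) (gform 0 w) = lform (M *m asym w).
Proof.
rewrite contr_gform scale0mx add0r; congr form1; apply/funext => k.
case: unliftP => // _; rewrite mulmx0 big1 ?oppr0 // => i _.
by rewrite [X in _ * X]mxE mulr0.
Qed.

Lemma lformZ (a : K) R : a *: lform R = lform (a%:A *: R).
Proof.
apply/funext => S; rewrite -[LHS]/(a *: lform R S) /lform /form1 !fsumE scaler_sumr.
apply: eq_bigr => k _; rewrite [LHS]scalerAl; congr (_ * _).
case: unliftP => [j _|_]; last exact: scaler0.
by rewrite -scalemxAr [RHS]mxE -scalerAl mul1r.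
Qed.

Lemma integ_gform (w : 'M[A]_4) : integ 2 0 (gform 0 w) = lform (2^-1%:A *: asym w).
Proof. by rewrite /integ addn0 euler_gvf contr_gvf0_gform0 mul1mx lformZ. Qed.

Lemma integ_al w : integ 2 0 (al w) = lform (cst (2^-1 *: asym w)).
Proof. by rewrite cstZ -asym_cst; exact: integ_gform. Qed.

Lemma wedge_al_lform w R : wedge (al w) (lform R) = wedge (lform R) (al w).
Proof. exact: wedge_gform_lform. Qed.

Lemma contr_euler_lform R :
  contr (euler K) (lform R) finset.set0 = (xrow K *m R *m (xrow K)^T) 0 0.
Proof.
rewrite /contr big_mkcond big_ord_recl /= {1}/euler eqxx mul0r mulr0.
rewrite inE add0r [RHS]mxE; apply: eq_bigr => i _.
rewrite inE /= finset.setU0 /lform form1E liftK ninv_set1.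
rewrite (_ : [set _ in _ | _] = finset.set0) ?cards0 ?expr0 ?mul1r; last first.
  by apply/setP => k; rewrite !inE.
rewrite mulrC; congr (_ * _); rewrite /euler eq_sym (negbTE (neq_lift _ _)).
by rewrite !mxE.
Qed.

Lemma qfZ (a : K) c : qf (a *: c) = a *: qf c.
Proof.
by rewrite /qf cstZ -scalemxAr -scalemxAl [LHS]mxE -scalerAl mul1r.
Qed.

Lemma bracket_sl4_Alt2_coord b w :
  bracket_sl4_Alt2 (vfm b) (al w) = qf (2^-1 *: (b *m asym w)).
Proof.
rewrite /bracket_sl4_Alt2 /vfm /al contr_gvf0_gform0 asym_cst -cstM.
rewrite -[LHS]/(2%:R^-1 *: contr (euler K) _ finset.set0) contr_euler_lform.
by rewrite qfZ.
Qed.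

Lemma gvfN (F : A) M : - gvf F M = gvf (- F) (- M).
Proof.
apply/funext => l; rewrite -[LHS]/(- gvf F M l) /gvf.
by case: unliftP => // j _; rewrite mulmxN [RHS]mxE.
Qed.

Lemma vfmN b : vfm (- b) = - vfm b.
Proof. by rewrite /vfm gvfN oppr0; congr gvf; exact: map_mxN. Qed.

Lemma vfmD b b' : vfm (b + b') = vfm b + vfm b'.
Proof. by rewrite /vfm gvfD addr0 cstD. Qed.

Lemma vf_of_3form_coord c w :
  vf_of_3form (wedge (lform (cst c)) (al w)) = vfm (c *m star (asym w)).
Proof. by rewrite /al vf_of_3form_lform -/(asym _) asym_cst -cst_star -cstM. Qed.

Lemma bracket_Sym2_Alt2_coord c w :
  bracket_Sym2_Alt2 (qf c) (al w) = vfm (- (sym c *m star (asym w))).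
Proof.
by rewrite /bracket_Sym2_Alt2 extd_fform_qf vf_of_3form_coord vfmN.
Qed.

Lemma vol_Alt2_coord w v : vol_Alt2 (al w) (al v) = pf (asym w) (asym v).
Proof.
rewrite /vol_Alt2 /coef_of_4form /al wedge_gform -!/(asym _) !asym_cst.
rewrite -(pf_map (in_alg A)) -[LHS]/((pf (asym w) (asym v)) * (0%MM == 0%MM :> 'X_{1..5})%:R).
by rewrite eqxx mulr1.
Qed.

Lemma vf_of_3formB a a' : vf_of_3form (a - a') = vf_of_3form a - vf_of_3form a' :> vf 5 K.
Proof.
apply/funext => j; rewrite -[RHS]/(vf_of_3form a j - vf_of_3form a' j) /vf_of_3form.
by case: ifP => _; rewrite ?subrr // -mulrBr.
Qed.

Lemma skew_Alt2_coord w v : skew_Alt2 (al w) (al v) =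
  vfm (2^-1 *: (asym w *m star (asym v) - asym v *m star (asym w))).
Proof.
have E : vf_of_3form (wedge (al w) (integ 2 0 (al v))) =
    vfm (2^-1 *: asym v *m star (asym w)).
  by rewrite integ_al wedge_al_lform vf_of_3form_coord.
rewrite /skew_Alt2 vf_of_3formB E integ_al vf_of_3form_coord.
by rewrite -vfmN -vfmD; congr vfm; rewrite -!scalemxAl scalerBr.
Qed.

Lemma lie_vfm_al b w : lie (vfm b) (al w) = al (b *m asym w).
Proof.
rewrite /vfm /al lie_gform; try exact: x1only0; try exact: cst_x1only;
  try exact: mx_x1only0; last exact: extd_al.
rewrite scale0mx add0r -/(asym _) asym_cst -cstM D_cst trmx0 mul0mx mulmx0.
by rewrite !addr0.
Qed.

End CoordinatesOfE16.

(** * The bracket of E(1,6) on sequences of scalar matrices *)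

Section BracketOfE16.
Variable K : numFieldType.
Implicit Types (f g : nat -> K^o) (B c w : nat -> 'M[K]_4).

Definition e16 f B c w : E16_space K :=
  ((f, @vfm K \o B), (@qf K \o c, @al K \o w)).

Definition f_br f (w : nat -> 'M[K]_4) g w' : nat -> K^o :=
  smul f (tder g) - smul (tder f) g +
  cauchy (fun w w' : 'M[K]_4 => pf (asym w) (asym w') : K^o) w w'.

Definition B_br f B c w g B' c' w' : nat -> 'M[K]_4 :=
  smul f (tder B') - smul g (tder B) +
  cauchy (fun b b' : 'M[K]_4 => b *m b' - b' *m b) B B' +
  cauchy (fun c w : 'M[K]_4 => - (sym c *m star (asym w))) c w' +
  cauchy (fun c w : 'M[K]_4 => - (sym c *m star (asym w))) c' w
  - 2%:R^-1 *: (
  cauchy (fun w w' : 'M[K]_4 =>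
    2^-1 *: (asym w *m star (asym w') - asym w' *m star (asym w))) (tder w) w' -
  cauchy (fun w w' : 'M[K]_4 =>
    2^-1 *: (asym w *m star (asym w') - asym w' *m star (asym w))) w (tder w')).

Definition c_br f B c w g B' c' w' : nat -> 'M[K]_4 :=
  dens_act (- (1 / 2%:R)) f c' - dens_act (- (1 / 2%:R)) g c +
  cauchy (fun b c : 'M[K]_4 => b *m sym c) B c' -
  cauchy (fun b c : 'M[K]_4 => b *m sym c) B' c +
  cauchy (fun b w : 'M[K]_4 => 2^-1 *: (b *m asym w)) (tder B) w' -
  cauchy (fun b w : 'M[K]_4 => 2^-1 *: (b *m asym w)) (tder B') w.

Definition w_br f B w g B' w' : nat -> 'M[K]_4 :=
  dens_act (- (3%:R / 2%:R)) f w' - dens_act (- (3%:R / 2%:R)) g w +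
  cauchy (fun b w : 'M[K]_4 => b *m asym w) B w' -
  cauchy (fun b w : 'M[K]_4 => b *m asym w) B' w.

Lemma E16_bracket_e16 f B c w g B' c' w' :
  E16_bracket (e16 f B c w) (e16 g B' c' w') =
  e16 (f_br f w g w') (B_br f B c w g B' c' w') (c_br f B c w g B' c' w')
      (w_br f B w g B' w').
Proof.
have Lv := @vfm_is_linear K; have Lq := @qf_is_linear K; have La := @al_is_linear K.
rewrite /E16_bracket /e16; congr ((_, _), (_, _)).
- by congr (_ + _); apply/funext => k; apply: eq_bigr => i _; exact: vol_Alt2_coord.
- rewrite /B_br !(lin_compD Lv, lin_compN Lv, lin_compZ Lv).
  congr (_ - _ + _ + _ + _ - _ *: (_ - _)).
  + by rewrite (lin_tder Lv) (lin_smul Lv).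
  + by rewrite (lin_tder Lv) (lin_smul Lv).
  + exact: (lin_cauchy Lv _ _ (@vbr_vfm K)).
  + exact: (lin_cauchy Lv _ _ (@bracket_Sym2_Alt2_coord K)).
  + exact: (lin_cauchy Lv _ _ (@bracket_Sym2_Alt2_coord K)).
  + by rewrite (lin_tder La); exact: (lin_cauchy Lv _ _ (@skew_Alt2_coord K)).
  + by rewrite (lin_tder La); exact: (lin_cauchy Lv _ _ (@skew_Alt2_coord K)).
- rewrite /c_br !(lin_compD Lq, lin_compN Lq).
  congr (_ - _ + _ - _ + _ - _).
  + by rewrite (lin_dens_act Lq) /dens_act !(lin_compD Lq).
  + by rewrite (lin_dens_act Lq) /dens_act !(lin_compD Lq).
  + exact: (lin_cauchy Lq _ _ (@vapp_vfm_qf K)).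
  + exact: (lin_cauchy Lq _ _ (@vapp_vfm_qf K)).
  + by rewrite (lin_tder Lv); exact: (lin_cauchy Lq _ _ (@bracket_sl4_Alt2_coord K)).
  + by rewrite (lin_tder Lv); exact: (lin_cauchy Lq _ _ (@bracket_sl4_Alt2_coord K)).
- rewrite /w_br !(lin_compD La, lin_compN La).
  congr (_ - _ + _ - _).
  + by rewrite (lin_dens_act La) /dens_act !(lin_compD La).
  + by rewrite (lin_dens_act La) /dens_act !(lin_compD La).
  + exact: (lin_cauchy La _ _ (@lie_vfm_al K)).
  + exact: (lin_cauchy La _ _ (@lie_vfm_al K)).
Qed.

End BracketOfE16.

(** * From sequences of scalar matrices to matrices over K[[x_1]] *)

Section Hat.
Variable K : numFieldType.
Local Notation A := (psr 5 K).
Local Notation D := (map_mx (@pd 5 K ord0)).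
Implicit Types (f g : nat -> K^o) (B C c w : nat -> 'M[K]_4).

(** An injective translation that turns Cauchy products into matrix products and [tder] into d/dx_1,
    so that the comparison of brackets takes place in a matrix ring with a derivation. *)
Definition hat B : 'M[A]_4 := \matrix_(i, j) subst_x1 (fun k => B k i j : K^o).

Lemma subst_x1_sum (I : Type) (s : seq I) (F : I -> nat -> K^o) :
  subst_x1 (\sum_(i <- s) F i) = \sum_(i <- s) subst_x1 (F i).
Proof.
by elim/big_rec2: _ => [|i y z _ <-]; [exact: subst_x10 | rewrite subst_x1D].
Qed.

Lemma hatD B C : hat (B + C) = hat B + hat C.
Proof.
apply/matrixP => i j; rewrite !mxE -subst_x1D; congr subst_x1.
by apply/funext => k; exact: mxE.
Qed.

Lemma hatN B : hat (- B) = - hat B.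
Proof.
apply/matrixP => i j; rewrite !mxE -subst_x1N; congr subst_x1.
by apply/funext => k; exact: mxE.
Qed.

Lemma hatZ (a : K) B : hat (a *: B) = a%:A *: hat B.
Proof.
apply/matrixP => i j; rewrite !mxE -scalerAl mul1r -subst_x1Z; congr subst_x1.
by apply/funext => k; exact: mxE.
Qed.

Lemma hat_comp_trmx B : hat (trmx \o B) = (hat B)^T.
Proof. by apply/matrixP => i j; rewrite !mxE; congr subst_x1; apply/funext => k; rewrite /= mxE. Qed.

Lemma hat_smul f B : hat (smul f B) = subst_x1 f *: hat B.
Proof.
apply/matrixP => i j; rewrite !mxE -subst_x1M; congr subst_x1.
by apply/funext => k; rewrite /smul /cauchy summxE; apply: eq_bigr => l _; rewrite mxE.
Qed.

Lemma hat_tder B : hat (tder B) = D (hat B).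
Proof.
apply/matrixP => i j; rewrite !mxE pd_subst_x1 eqxx mul1r; congr subst_x1.
by apply/funext => k; rewrite /tder mulmxnE.
Qed.

Lemma hat_x1only B : mx_x1only (hat B).
Proof.
by move=> i j k; rewrite mxE pd_subst_x1 eq_sym (negbTE (neq_lift _ _)) mul0r.
Qed.

Lemma subst_x1only f : x1only (subst_x1 f).
Proof. by move=> k; rewrite pd_subst_x1 eq_sym (negbTE (neq_lift _ _)) mul0r. Qed.

Lemma hat_cauchyM B C : hat (cauchy (@mulmx K 4 4 4) B C) = hat B *m hat C.
Proof.
apply/matrixP => i j; rewrite !mxE; under eq_bigr do rewrite !mxE -subst_x1M.
rewrite -subst_x1_sum; congr subst_x1; apply/funext => k.
rewrite fct_sumE /cauchy summxE exchange_big /=.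
by apply: eq_bigr => l _; rewrite mxE.
Qed.

(** Pulled back from commutativity of the five-variable series through the embedding, which avoids
    reindexing the Cauchy sum. *)
Lemma smulC f g : smul f g = smul g f.
Proof. by apply: subst_x1_inj; rewrite !subst_x1M mulrC. Qed.

(** This serves the second term of each commutator: the scalar coefficients commute although the
    matrices do not, so the swapped convolution is the product in the swapped order. *)
Lemma hat_cauchyMr B C :
  hat (cauchy (fun b c : 'M[K]_4 => c *m b) B C) = hat C *m hat B.
Proof.
apply/matrixP => i j; rewrite !mxE; under eq_bigr do rewrite !mxE -subst_x1M smulC.
rewrite -subst_x1_sum; congr subst_x1; apply/funext => k.
rewrite fct_sumE /cauchy summxE exchange_big /=.
by apply: eq_bigr => l _; rewrite mxE; apply: eq_bigr => r _; exact: mulrC.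
Qed.

Lemma hat_star B : hat (star (T:=K) \o B) = star (hat B).
Proof.
apply/matrixP; apply: forall4; apply: forall4; rewrite !mxE /= ?mxE -?subst_x1N;
 try (by congr subst_x1; apply/funext => k; rewrite /= !mxE);
 rewrite -[RHS]subst_x10; by congr subst_x1; apply/funext => k; rewrite /= !mxE.
Qed.

Lemma hat_asym B : hat (@asym K \o B) = asym (hat B).
Proof.
rewrite /asym -hat_comp_trmx -hatN -hatD; congr hat.
Qed.

Lemma hat_sym B : hat (@sym K \o B) = sym (hat B).
Proof.
by rewrite /sym -hat_comp_trmx -hatD; congr hat.
Qed.

Lemma subst_x1_pf B C :
  subst_x1 (cauchy (fun w w' : 'M[K]_4 => pf w w' : K^o) B C) = pf (hat B) (hat C).
Proof.
rewrite /pf !mxE -!subst_x1M -!subst_x1N -!subst_x1D; congr subst_x1.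
by apply/funext => k; rewrite /cauchy !big_split /= !sumrN.
Qed.

End Hat.

(** * psi in coordinates, and the morphism identity *)

Section PsiInCoordinates.
Variable K : numFieldType.
Local Notation A := (psr 5 K).
Local Notation pd1 := (@pd 5 K ord0).
Local Notation D := (map_mx (@pd 5 K ord0)).
Implicit Types (f g : nat -> K^o) (B C c w : nat -> 'M[K]_4).

Lemma at_x1_fun_vfm B : at_x1_fun (@vfm K \o B) = gvf 0 (hat B).
Proof.
apply/funext => l; rewrite /at_x1_fun /gvf.
case: (unliftP ord0 l) => [j ->|->]; last first.
  rewrite [X in at_x1 X](_ : _ = 0) ?raddf0 //.
  by apply/funext => k; rewrite /= /vfm /gvf unlift_none.
rewrite (@at_x1_cst _ _ _ (fun i k => B k i j) (fun i => psX K (lift ord0 i))).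
  by rewrite [RHS]mxE; apply: eq_bigr => i _; rewrite !mxE.
move=> k; rewrite /= /vfm /gvf liftK mxE; apply: eq_bigr => i _.
by rewrite !mxE /= -scalerAr mulr1.
Qed.

Lemma at_x1_fun_al w : at_x1_fun (@al K \o w) = gform 0 (hat w).
Proof.
apply/funext => S; rewrite /at_x1_fun.
pose d (ij : 'I_4 * 'I_4) : A := wedge (dx K (lift ord0 ij.1)) (dx K (lift ord0 ij.2)) S.
have E (u : 'M[A]_4) : gform 0 u S = \sum_ij u ij.1 ij.2 * d ij.
  rewrite gformE big1 => [|j _]; last by rewrite mulmx0 mxE fmul0.
  rewrite add0r fsumE -(pair_bigA _ (fun i j => u i j * d (i, j))) /=.
  by apply: eq_bigr => i _; rewrite fsumE.
rewrite (@at_x1_cst _ _ _ (fun ij k => w k ij.1 ij.2) d).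
  by rewrite E; apply: eq_bigr => ij _; rewrite mxE mulrC.
move=> k; rewrite /= /al E; apply: eq_bigr => ij _.
by rewrite mxE /= -scalerAl mul1r.
Qed.

Lemma at_x1_fun_gform0 B :
  at_x1_fun (fun k => gform (cst (B k)) 0) = gform (hat B) 0.
Proof.
apply/funext => S; rewrite /at_x1_fun.
pose d (ij : 'I_4 * 'I_4) : A := psX K (lift ord0 ij.1) * wedge (dx K ord0) (dx K (lift ord0 ij.2)) S.
have E (u : 'M[A]_4) : gform u 0 S = \sum_ij u ij.1 ij.2 * d ij.
  rewrite gformE [X in _ + X]big1 => [|i _]; last first.
    by rewrite big1 // => j _; rewrite mxE fmul0.
  rewrite addr0 fsumE -(pair_bigA _ (fun i j => u i j * d (i, j))) /= exchange_big /=.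
  apply: eq_bigr => j _; rewrite /fmul mxE mulr_suml; apply: eq_bigr => i _.
  by rewrite mxE /d mulrA [u i j * _]mulrC.
rewrite (@at_x1_cst _ _ _ (fun ij k => B k ij.1 ij.2) d).
  by rewrite E; apply: eq_bigr => ij _; rewrite mxE mulrC.
move=> k; rewrite E; apply: eq_bigr => ij _.
by rewrite mxE /= -scalerAl mul1r.
Qed.

Lemma fmul_vf_d (F : A) : fmul F (vf_d K ord0) = gvf F 0.
Proof.
apply/funext => l; rewrite /fmul /vf_d /gvf.
case: (unliftP ord0 l) => [j ->|->]; last by rewrite eqxx mulr1.
by rewrite eq_sym (negbTE (neq_lift _ _)) mulr0 mulmx0 mxE.
Qed.

Lemma fmul_euler (F : A) : fmul F (euler K) = gvf 0 F%:M.
Proof.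
apply/funext => l; rewrite euler_gvf /fmul /gvf.
case: unliftP => [j _|_]; last exact: mulr0.
by rewrite mulmx1 mul_mx_scalar [RHS]mxE.
Qed.

Lemma subst_x1_tder f : subst_x1 (tder f) = pd1 (subst_x1 f).
Proof. by rewrite pd_subst_x1 eqxx mul1r. Qed.

Lemma psi_e16 f B c w : psi (e16 f B c w) =
  (gvf (subst_x1 f) (hat B - (4%:R^-1%:A * pd1 (subst_x1 f))%:M),
   gform (sym (hat c) + 2^-1%:A *: asym (D (hat w))) (hat w)).
Proof.
rewrite /psi /e16; congr (_, _).
  rewrite at_x1_fun_vfm fmul_vf_d fmul_euler subst_x1_tder gvfZ gvfN gvfD gvfD.
  congr gvf; first by rewrite scaler0 subr0 addr0.
  by rewrite add0r addrC scale_scalar_mx.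
rewrite at_x1_fun_al.
have -> : at_x1_fun (fun j => wedge (dx K ord0) (extd (fform (((@qf K) \o c) j)))) =
    gform (sym (hat c)) 0.
  rewrite -hat_sym -at_x1_fun_gform0; congr at_x1_fun; apply/funext => j.
  by rewrite /= extd_fform_qf wedge_dx0_lform.
have -> : at_x1_fun (fun j => wedge (dx K ord0) (integ 2 0 (tder (@al K \o w) j))) =
    gform (2^-1%:A *: asym (D (hat w))) 0.
  rewrite -hat_tder -hat_asym -hatZ -at_x1_fun_gform0 (lin_tder (@al_is_linear K)).
  by congr at_x1_fun; apply/funext => j; rewrite /= integ_al wedge_dx0_lform.
by rewrite !gformD !addr0 !add0r.
Qed.

End PsiInCoordinates.

(** * Identities between matrices over a commutative ring with an inverse of 2 *)

Lemma addr_sub4 (V : zmodType) (a b a' b' : V) :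
  a - b + a' - b' = a + a' - (b + b').
Proof. by rewrite opprD addrA (addrAC a). Qed.

Lemma addr_sub6 (V : zmodType) (a b a' b' a'' b'' : V) :
  a - b + a' - b' + a'' - b'' = a + a' + a'' - (b + b' + b'').
Proof. by rewrite (addr_sub4 a b) addr_sub4. Qed.

Section MatrixIdentities.
Variable T : comNzRingType.
Implicit Types (M N X Y B V W P v c : 'M[T]_4) (F G h : T).

(** Here F1 and v1 stand for the derivatives of F and v. Antisymmetrising the right side doubles h
    into 1 and the quarter into a half, and removes the symmetric C. *)
Lemma w_half h F F1 B C v v1 : h * 2%:R = 1 -> C^T = C ->
  asym (F *: v1 - (h * F1) *: v + B *m asym v) =
  asym (F *: (C + h *: asym v1) + (B - (h * h * F1)%:M) *m asym v).
Proof.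
move=> h2 CT; rewrite mulmxBl mul_scalar_mx.
move: (B *m asym v) => Z; apply/matrixP => i j.
have Cij : C j i = C i j by rewrite -{1}CT mxE.
have h2N : - h * 2%:R = - 1 by rewrite mulNr h2.
by rewrite !mxE Cij; ring: h2 h2N.
Qed.

(** The dx_1-part of the action of an even element on an odd one, with derivatives replaced by
    independent letters: the left side is rebuilt from the E(1,6) coordinates, the right side is the
    expansion of [lie_gform]. *)
Lemma N_half h F F1 F2 B B1 C C1 c c1 v v1 v2 : h * 2%:R = 1 ->
  C = sym c -> C1 = sym c1 ->
  sym (F *: c1 + (h * F1) *: c + B *m C + h *: (B1 *m asym v))
  + h *: asym (F1 *: v1 + F *: v2 - (h * F1) *: v1 - (h * F2) *: v
               + B1 *m asym v + B *m asym v1) =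
  F1 *: (C + h *: asym v1) + F *: (C1 + h *: asym v2)
  + (B1 - (h * h * F2)%:M) *m asym v + (B - (h * h * F1)%:M) *m asym v1
  + (C + h *: asym v1) *m (B - (h * h * F1)%:M)^T
  + (B - (h * h * F1)%:M) *m (C + h *: asym v1)^T.
Proof.
move=> h2 CE C1E.
have CT : C^T = C by rewrite CE sym_tr.
have VE i j : asym v i j = v i j - v j i by rewrite !mxE.
have V1E i j : asym v1 i j = v1 i j - v1 j i by rewrite !mxE.
have V1T : (asym v1)^T = - asym v1 by rewrite /asym linearB /= trmxK opprB.
move: (asym v) (asym v1) VE V1E V1T => V V1 VE V1E V1T.
have PT : (C + h *: V1)^T = C - h *: V1 by rewrite linearD linearZ /= CT V1T scalerN.
have MT u : (B - u%:M)^T = B^T - u%:M by rewrite linearB /= tr_scalar_mx.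
rewrite PT MT !(mulmxBl, mulmxBr, mulmxDl) -!scalemxAl -!scalemxAr.
rewrite !mul_scalar_mx !mul_mx_scalar.
have -> : C *m B^T = (B *m C)^T by rewrite trmx_mul CT.
have -> : V1 *m B^T = - (B *m V1)^T by rewrite trmx_mul V1T mulNmx opprK.
move: (B *m C) (B *m V1) (B1 *m V) => Z Z1 Z2; apply/matrixP => i j.
rewrite CE C1E !mxE !VE !V1E; apply: subr0_eq.
(* The difference of the two sides vanishes only modulo the relation on h; the second factor is its
   quotient by 2h - 1. *)
transitivity ((h * 2%:R - 1) *
  (F1 * (c i j + c j i) * (h + 1) + Z2 i j + Z1 i j)); first by ring.
by rewrite h2 subrr mul0r.
Qed.

(** For the 2-form part the Lie derivative of dt contributes 1 and the twist -3/2, leaving -1/2; in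
    [half_one], for the quadratic part, the twist -1/2 leaves 1/2. *)
Lemma half_three h F : h * 2%:R = 1 -> F + - (h * 3%:R) * F = - (h * F).
Proof.
move=> h2; apply: subr0_eq; transitivity ((1 - h * 2%:R) * F); first by ring.
by rewrite h2 subrr mul0r.
Qed.

Lemma half_one h F : h * 2%:R = 1 -> F + - h * F = h * F.
Proof.
move=> h2; apply: subr0_eq; transitivity ((1 - h * 2%:R) * F); first by ring.
by rewrite h2 subrr mul0r.
Qed.

(** X1, Y1, X2, Y2 stand for W' * star V, V * star W', W * star V', V' * star W, and p for the
    derivative of Pf(W, V). Replacing p by the sum of the four, the quarter of X1 - Y1 - X2 + Y2 and
    the quarter of p add up to half of X1 + Y2, which is what the w'/2 part of N contributes to the
    odd bracket. *)
Lemma B_even_identity h F F1 F2 G G1 G2 (p : T) X1 X2 Y1 Y2 :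
    forall B B1 C C1 S S' : 'M[T]_4, h * 2%:R = 1 ->
  p%:M = (X1 + Y1) + (X2 + Y2) ->
  F *: C1 - G *: B1 + (B *m C - C *m B) - S - S'
  - h *: (h *: (X1 - Y1) - h *: (X2 - Y2))
  - (h * h * (F * G2 - G * F2 + p))%:M =
  F *: (C1 - (h * h * G2)%:M) - G *: (B1 - (h * h * F2)%:M)
  + (B - (h * h * F1)%:M) *m (C - (h * h * G1)%:M)
  - (C - (h * h * G1)%:M) *m (B - (h * h * F1)%:M)
  - (S + h *: X1 + (S' + h *: Y2)).
Proof.
move=> B B1 C C1 S S' h2 PE.
rewrite !(mulmxBl, mulmxBr) !mul_scalar_mx !mul_mx_scalar.
rewrite (_ : (h * h * (F * G2 - G * F2 + p))%:M =
  (h * h * (F * G2 - G * F2))%:M + (h * h) *: (X1 + Y1 + (X2 + Y2))); last first.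
  by rewrite -PE scale_scalar_mx -raddfD -mulrDr.
move: (B *m C) (C *m B) => Z Z'; apply/matrixP => i j; rewrite !mxE.
case: (i == j); rewrite ?mulr1n ?mulr0n; apply: subr0_eq;
transitivity ((1 - h * 2%:R) * (h * (X1 i j + Y2 i j))); try ring;
by rewrite h2 subrr mul0r.
Qed.

(** The composite subterms become variables tied by equations, so that the identity applies directly
    to a goal in which the derivatives are not yet expanded. *)
Lemma B_even_identity_eq h F F1 F2 G G1 G2 (p q : T) X1 X2 Y1 Y2 B B1 C C1
    (S S' B2 C2 Q Q' : 'M[T]_4) : h * 2%:R = 1 ->
  p%:M = (X1 + Y1) + (X2 + Y2) -> q = F * G2 - G * F2 + p ->
  C2 = C1 - (h * h * G2)%:M -> B2 = B1 - (h * h * F2)%:M ->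
  Q = S + h *: X1 -> Q' = S' + h *: Y2 ->
  F *: C1 - G *: B1 + (B *m C - C *m B) - S - S'
  - h *: (h *: (X1 - Y1) - h *: (X2 - Y2)) - (h * h * q)%:M =
  F *: C2 - G *: B2
  + (B - (h * h * F1)%:M) *m (C - (h * h * G1)%:M)
  - (C - (h * h * G1)%:M) *m (B - (h * h * F1)%:M) - (Q + Q').
Proof. by move=> h2 pE -> -> -> -> ->; exact: B_even_identity. Qed.

Lemma pf_leibniz M M' N N' : pf M' N + pf M N' =
  (M' o0 o1 * N o2 o3 + M o0 o1 * N' o2 o3)
  - (M' o0 o2 * N o1 o3 + M o0 o2 * N' o1 o3)
  + (M' o0 o3 * N o1 o2 + M o0 o3 * N' o1 o2)
  + (M' o1 o2 * N o0 o3 + M o1 o2 * N' o0 o3)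
  - (M' o1 o3 * N o0 o2 + M o1 o3 * N' o0 o2)
  + (M' o2 o3 * N o0 o1 + M o2 o3 * N' o0 o1).
Proof. by rewrite /pf; ring. Qed.

End MatrixIdentities.

(** * The derivation d/dx_1 on matrices *)

Section Derivation.
Variable K : numFieldType.
Local Notation A := (psr 5 K).
Local Notation pd1 := (@pd 5 K ord0).
Local Notation D := (map_mx (@pd 5 K ord0)).
Implicit Types (F G : A) (M N : 'M[A]_4).

Lemma DD M N : D (M + N) = D M + D N.
Proof. by apply/matrixP => i j; rewrite !mxE pdD. Qed.

Lemma DN M : D (- M) = - D M.
Proof. by apply/matrixP => i j; rewrite !mxE pdN. Qed.

Lemma DT M : D M^T = (D M)^T.
Proof. by apply/matrixP => i j; rewrite !mxE. Qed.

Lemma DZ F M : D (F *: M) = pd1 F *: M + F *: D M.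
Proof. by apply/matrixP => i j; rewrite !mxE pdM. Qed.

Lemma DM M N : D (M *m N) = D M *m N + M *m D N.
Proof.
apply/matrixP => i j; rewrite !mxE pd_sum -big_split; apply: eq_bigr => k _.
by rewrite !mxE pdM.
Qed.

Lemma D_scalar F : D (F%:M : 'M[A]_4) = (pd1 F)%:M.
Proof.
by apply/matrixP => i j; rewrite !mxE; case: (i == j); rewrite ?mulr1n ?mulr0n ?pd0.
Qed.

Lemma D_asym M : D (asym M) = asym (D M).
Proof. by rewrite /asym DD DN DT. Qed.

Lemma D_sym M : D (sym M) = sym (D M).
Proof. by rewrite /sym DD DT. Qed.

Lemma pd1_pf M N : pd1 (pf M N) = pf (D M) N + pf M (D N).
Proof.
by rewrite pf_leibniz {1}/pf !(pdD, pdN, pdM) !mxE.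
Qed.

Lemma pd_cst (i : 'I_5) (a : K) : pd i (a%:A : A) = 0.
Proof.
by rewrite pdZ pd_1 scaler0.
Qed.

End Derivation.

(** * The bracket of E(1,6) as an expression in matrices over K[[x_1]] *)

Section Homomorphism.
Variable K : numFieldType.
Local Notation A := (psr 5 K).
Local Notation pd1 := (@pd 5 K ord0).
Local Notation D := (map_mx (@pd 5 K ord0)).
Implicit Types (f g : nat -> K^o) (B C c w : nat -> 'M[K]_4).
Local Notation h := (2%:R^-1%:A : A).

Lemma half2 : h * 2%:R = 1.
Proof. by rewrite -scalerAl mul1r -scaler_nat scalerA mulVf ?scale1r ?pnatr_eq0. Qed.

Lemma quarterE : 4%:R^-1%:A = h * h.
Proof.
by rewrite -scalerAl mul1r scalerA -invfM -natrM.
Qed.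

Lemma hat_br_asym (U V : nat -> 'M[K]_4) :
  hat (cauchy (fun b w : 'M[K]_4 => b *m asym w) U V) = hat U *m asym (hat V).
Proof. by rewrite -hat_asym -hat_cauchyM. Qed.

Lemma hat_br_sym (U V : nat -> 'M[K]_4) :
  hat (cauchy (fun b c : 'M[K]_4 => b *m sym c) U V) = hat U *m sym (hat V).
Proof. by rewrite -hat_sym -hat_cauchyM. Qed.

Lemma cauchyZ (U V W : lmodType K) (a : K) (beta : U -> V -> W) (u : nat -> U) (v : nat -> V) :
  cauchy (fun x y => a *: beta x y) u v = a *: cauchy beta u v.
Proof. by apply/funext => k; rewrite [RHS]scaler_sumr. Qed.

Lemma cauchyB (U V W : lmodType K) (beta gamma : U -> V -> W) (u : nat -> U) (v : nat -> V) :
  cauchy (fun x y => beta x y - gamma x y) u v = cauchy beta u v - cauchy gamma u v.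
Proof. by apply/funext => k; rewrite /cauchy sumrB. Qed.

Lemma cauchyN (U V W : lmodType K) (beta : U -> V -> W) (u : nat -> U) (v : nat -> V) :
  cauchy (fun x y => - beta x y) u v = - cauchy beta u v.
Proof. by apply/funext => k; rewrite /cauchy sumrN. Qed.

Lemma hat_star_asym w : hat ((@star K \o @asym K) \o w) = star (asym (hat w)).
Proof. by rewrite -hat_asym -hat_star. Qed.

Lemma hat_star_mul (phi : 'M[K]_4 -> 'M[K]_4) (U V : nat -> 'M[K]_4) :
  hat (cauchy (fun b w : 'M[K]_4 => phi b *m star (asym w)) U V) =
  hat (phi \o U) *m star (asym (hat V)).
Proof. by rewrite -hat_star_asym -hat_cauchyM. Qed.

Lemma hat_star_mulr (U V : nat -> 'M[K]_4) :
  hat (cauchy (fun w b : 'M[K]_4 => asym b *m star (asym w)) U V) =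
  asym (hat V) *m star (asym (hat U)).
Proof. by rewrite -hat_star_asym -hat_asym -hat_cauchyMr. Qed.

Lemma hat_w_br f B w g B' w' :
  hat (w_br f B w g B' w') =
  (subst_x1 f *: D (hat w') - (h * pd1 (subst_x1 f)) *: hat w' + hat B *m asym (hat w'))
  - (subst_x1 g *: D (hat w) - (h * pd1 (subst_x1 g)) *: hat w + hat B' *m asym (hat w)).
Proof.
have E (f' : nat -> K^o) (u : nat -> 'M[K]_4) : hat (dens_act (- (3%:R / 2%:R)) f' u) =
    subst_x1 f' *: D (hat u) - (h * pd1 (subst_x1 f')) *: hat u.
  rewrite /dens_act !hatD hatZ !hat_smul hat_tder subst_x1_tder -addrA; congr (_ + _).
  rewrite scalerA -scalerDl -scaleNr; congr (_ *: _).
  have -> : (- (3%:R / 2%:R))%:A = - (h * 3%:R) :> A.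
    by rewrite scaleNr -scalerAl mul1r -scaler_nat scalerA mulrC.
  exact: half_three half2.
rewrite /w_br 3!hatD !hatN !E !hat_br_asym.
exact: addr_sub4.
Qed.

Lemma hat_c_br f B c w g B' c' w' :
  hat (c_br f B c w g B' c' w') =
  (subst_x1 f *: D (hat c') + (h * pd1 (subst_x1 f)) *: hat c' + hat B *m sym (hat c')
   + h *: (D (hat B) *m asym (hat w')))
  - (subst_x1 g *: D (hat c) + (h * pd1 (subst_x1 g)) *: hat c + hat B' *m sym (hat c)
   + h *: (D (hat B') *m asym (hat w))).
Proof.
have E (f' : nat -> K^o) (u : nat -> 'M[K]_4) : hat (dens_act (- (1 / 2%:R)) f' u) =
    subst_x1 f' *: D (hat u) + (h * pd1 (subst_x1 f')) *: hat u.
  rewrite /dens_act !hatD hatZ !hat_smul hat_tder subst_x1_tder -addrA; congr (_ + _).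
  rewrite scalerA -scalerDl; congr (_ *: _).
  rewrite mul1r scaleNr; exact: half_one half2.
have E' (U V : nat -> 'M[K]_4) :
    hat (cauchy (fun b w : 'M[K]_4 => 2^-1 *: (b *m asym w)) (tder U) V) =
    h *: (D (hat U) *m asym (hat V)).
  by rewrite cauchyZ hatZ hat_br_asym hat_tder.
rewrite /c_br 5!hatD !hatN !E !E' !hat_br_sym.
exact: addr_sub6.
Qed.

Lemma hat_B_br f B c w g B' c' w' :
  hat (B_br f B c w g B' c' w') =
  subst_x1 f *: D (hat B') - subst_x1 g *: D (hat B)
  + (hat B *m hat B' - hat B' *m hat B)
  - sym (hat c) *m star (asym (hat w')) - sym (hat c') *m star (asym (hat w))
  - h *: (h *: (asym (D (hat w)) *m star (asym (hat w'))
                - asym (hat w') *m star (asym (D (hat w))))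
        - h *: (asym (hat w) *m star (asym (D (hat w')))
                - asym (D (hat w')) *m star (asym (hat w)))).
Proof.
rewrite /B_br !(cauchyZ, cauchyB, cauchyN) !(hatD, hatN, hatZ) !hat_smul !hat_tder.
rewrite hat_cauchyM hat_cauchyMr !hat_star_mul !hat_star_mulr !hat_sym !hat_asym.
by rewrite !hat_tder.
Qed.

Lemma subst_f_br f w g w' :
  subst_x1 (f_br f w g w') =
  subst_x1 f * pd1 (subst_x1 g) - subst_x1 g * pd1 (subst_x1 f)
  + pf (asym (hat w)) (asym (hat w')).
Proof.
rewrite /f_br !subst_x1D subst_x1N !subst_x1M !subst_x1_tder [in RHS](mulrC (subst_x1 g)).
by congr (_ + _); rewrite -!hat_asym -subst_x1_pf.
Qed.

End Homomorphism.

(** * Compatibility of psi with the brackets *)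

Section PsiMorphism.
Variable K : numFieldType.
Local Notation A := (psr 5 K).
Local Notation pd1 := (@pd 5 K ord0).
Local Notation D := (map_mx (@pd 5 K ord0)).
Local Notation h := (2%:R^-1%:A : A).
Implicit Types (f g : nat -> K^o) (B c w : nat -> 'M[K]_4).

Lemma asymB (T : comNzRingType) (u v : 'M[T]_4) : asym (u - v) = asym u - asym v.
Proof. by rewrite /asym linearB /= !opprD !opprK !addrA (addrAC u). Qed.

Lemma symB (T : comNzRingType) (u v : 'M[T]_4) : sym (u - v) = sym u - sym v.
Proof. by rewrite /sym linearB /= addrACA opprD. Qed.

(** The symmetric summand disappears and the doubling cancels t. With u = w' this says that the
    image of [psi] satisfies the closedness condition, whatever c is. *)
Lemma asym_half (T : comNzRingType) (t : T) (c u : 'M[T]_4) : t * 2%:R = 1 ->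
  asym (sym c + t *: asym u) = asym u.
Proof.
move=> t2; apply/matrixP => i j; rewrite !mxE; apply: subr0_eq.
transitivity ((t * 2%:R - 1) * (u i j - u j i)); first by ring.
by rewrite t2 subrr mul0r.
Qed.

Lemma gform00 : gform 0 0 = 0 :> form 5 K.
Proof.
rewrite gformE mulmx0 !big1 ?addr0 // => i _; last by rewrite mxE fmul0.
by rewrite big1 // => j _; rewrite mxE fmul0.
Qed.

Lemma gform_closed (c v : 'M[A]_4) : mx_x1only c -> mx_x1only v ->
  mx_x1only (D v) -> extd (gform (sym c + h *: asym (D v)) v) = 0.
Proof.
move=> c1 v1 dv1; rewrite extd_gform //; last first.
  have asym1 (u : 'M[A]_4) : mx_x1only u -> mx_x1only (asym u).
    by move=> u1; apply: mx_x1onlyD => //; apply/mx_x1onlyN/mx_x1onlyT.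
  apply: mx_x1onlyD; first by apply: mx_x1onlyD => //; exact: mx_x1onlyT.
  by apply: mx_x1onlyZ; [move=> k; exact: pd_cst | exact: asym1].
rewrite (@gform_eq _ 0 _ 0 0) ?gform00 ?wedge0r //.
rewrite -![_ - _^T]/(asym _) asymB asym_half ?subrr ?half2 //.
by rewrite /asym trmx0 subrr.
Qed.

(** The even element (F, b) acts on the odd element (c, v), and X, Y are its contributions to the w-
    and c-coordinates of the bracket. The odd component of a general bracket is the difference of
    two such terms, combined by [gform_sub]. *)
Lemma lie_half (F : A) (b c v : 'M[A]_4) :
  x1only F -> x1only (pd1 F) -> mx_x1only b -> mx_x1only c -> mx_x1only v ->
  mx_x1only (D v) ->
  let X := F *: D v - (h * pd1 F) *: v + b *m asym v in
  let Y := F *: D c + (h * pd1 F) *: c + b *m sym c + h *: (D b *m asym v) in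
  lie (gvf F (b - (h * h * pd1 F)%:M)) (gform (sym c + h *: asym (D v)) v) =
  gform (sym Y + h *: asym (D X)) X.
Proof.
move=> F1 F1' b1 c1 v1 dv1 X Y.
have h1 : x1only h by move=> k; exact: pd_cst.
have asym1 (u : 'M[A]_4) : mx_x1only u -> mx_x1only (asym u).
  by move=> u1; apply: mx_x1onlyD => //; apply/mx_x1onlyN/mx_x1onlyT.
have ph : pd1 h = 0 by exact: pd_cst.
have M1 : mx_x1only (b - (h * h * pd1 F)%:M).
  apply: mx_x1onlyD => //; apply: mx_x1onlyN => i j k; rewrite mxE.
  case: (i == j); rewrite ?mulr0n ?pd0 // mulr1n.
  by have := x1onlyM (x1onlyM h1 h1) F1'; apply.
have N1 : mx_x1only (sym c + h *: asym (D v)).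
  apply: mx_x1onlyD; first by apply: mx_x1onlyD => //; exact: mx_x1onlyT.
  exact: (mx_x1onlyZ h1 (asym1 _ dv1)).
rewrite (lie_gform F1 M1 N1 v1 (gform_closed c1 v1 dv1)).
(* Second components need to agree only up to their symmetric part, which is [w_half]; the first
   components are compared by [N_half]. *)
apply: gform_eq; last first.
  rewrite -![_ - _^T]/(asym _); apply/esym; rewrite /X; apply: w_half; first exact: half2.
  exact: sym_tr.
rewrite -![v - v^T]/(asym v) /X /Y.
set b' := b - _; set P := sym c + _.
have DP : D P = sym (D c) + h *: asym (D (D v)).
  by rewrite /P DD DZ ph scale0r add0r D_sym D_asym.
have Db' : D b' = D b - (h * h * pd1 (pd1 F))%:M.
  rewrite /b' DD DN D_scalar; congr (_ - _%:M).
  by rewrite !pdM ph mulr0 mul0r add0r mul0r add0r.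
have -> : D (F *: P + b' *m asym v) =
  pd1 F *: P + F *: (sym (D c) + h *: asym (D (D v)))
  + (D b - (h * h * pd1 (pd1 F))%:M) *m asym v + b' *m asym (D v).
  by rewrite DD DZ DM D_asym DP Db' addrA.
have -> : D (F *: D v - (h * pd1 F) *: v + b *m asym v) =
  pd1 F *: D v + F *: D (D v) - (h * pd1 F) *: D v - (h * pd1 (pd1 F)) *: v
  + D b *m asym v + b *m asym (D v).
  rewrite DD DD DN DZ DZ DM D_asym pdM ph mul0r add0r.
  have opp2 (V : zmodType) (x y : V) : - (x + y) = - y - x by rewrite opprD addrC.
  by rewrite opp2 !addrA.
apply/esym; apply: N_half; [exact: half2 | by [] | by []].
Qed.

Lemma gform_sub (u u' v v' : 'M[A]_4) :
  gform (sym u + h *: asym (D v)) v - gform (sym u' + h *: asym (D v')) v' =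
  gform (sym (u - u') + h *: asym (D (v - v'))) (v - v') :> form 5 K.
Proof.
have -> : sym (u - u') + h *: asym (D (v - v')) =
    (sym u + h *: asym (D v)) - (sym u' + h *: asym (D v')).
  have -> : asym (D (v - v')) = asym (D v) - asym (D v') by rewrite DD DN asymB.
  rewrite symB; move: (sym u) (sym u') (asym (D v)) (asym (D v')) => z z' y y'.
  by rewrite scalerBr opprD addrACA.
move: (sym u + _) (sym u' + _) => N N'.
have -> : - gform N' v' = gform (- N') (- v') :> form 5 K.
  by rewrite -scaleN1r gformZ !scaleN1r.
exact: gformD.
Qed.

Lemma psi_morph f B c w g B' c' w' :
  psi (E16_bracket (e16 f B c w) (e16 g B' c' w')) =
  E510_bracket (psi (e16 f B c w)) (psi (e16 g B' c' w')).
Proof.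
rewrite E16_bracket_e16; apply: etrans (psi_e16 _ _ _ _) _.
apply: etrans (esym (congr2 (@E510_bracket K) (psi_e16 f B c w) (psi_e16 g B' c' w'))).
rewrite -[RHS]/(vbr (gvf _ _) (gvf _ _) + odd_bracket (gform _ _) (gform _ _),
  lie (gvf _ _) (gform _ _) - lie (gvf _ _) (gform _ _)).
rewrite hat_w_br hat_c_br hat_B_br subst_f_br quarterE.
have F1 := @subst_x1only K f; have G1 := @subst_x1only K g.
have F2 : x1only (pd1 (subst_x1 f)) by rewrite -subst_x1_tder; exact: subst_x1only.
have G2 : x1only (pd1 (subst_x1 g)) by rewrite -subst_x1_tder; exact: subst_x1only.
have hatD1 (u : nat -> 'M[K]_4) : mx_x1only (D (hat u)) by rewrite -hat_tder; exact: hat_x1only.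
have [b1 c1 v1] := And3 (@hat_x1only K B) (@hat_x1only K c) (@hat_x1only K w).
have [b1' c1' v1'] := And3 (@hat_x1only K B') (@hat_x1only K c') (@hat_x1only K w').
have dv1 := hatD1 w; have dv1' := hatD1 w'.
have scal1 (u : A) : x1only u -> mx_x1only ((h * h * u)%:M : 'M[A]_4).
  move=> u1 i j k; rewrite mxE; case: (i == j); rewrite ?mulr0n ?pd0 // mulr1n.
  by rewrite !pdM !pd_cst u1 !(mulr0, mul0r, addr0).
rewrite !lie_half // odd_bracket_gform vbr_gvf //; try (by apply: mx_x1onlyD => //; apply: mx_x1onlyN; exact: scal1).
clear hatD1 scal1.
(* From here on the coordinates are arbitrary series and matrices in x_1. *)
move: (subst_x1 f) (subst_x1 g) (hat B) (hat c) (hat w) (hat B') (hat c') (hat w')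
  F1 G1 F2 G2 b1 c1 v1 b1' c1' v1' dv1 dv1' => F G {}B {}c {}w {}B' {}c' {}w' *.
congr (_, _).
  rewrite gvfD -![_ - _^T]/(asym _); congr gvf.
  have E (p : A) : pd1 (F * pd1 G - G * pd1 F + p) =
      F * pd1 (pd1 G) - G * pd1 (pd1 F) + pd1 p.
    by rewrite !(pdD, pdN, pdM) opprD addrACA [pd1 F * _]mulrC subrr add0r.
  have ph2 (u : A) : pd1 (h * h * u) = h * h * pd1 u.
    by rewrite !pdM !pd_cst mul0r mulr0 addr0 mul0r add0r.
  have split (u v z : 'M[A]_4) : (u + h *: v) *m z = u *m z + h *: (v *m z).
    by rewrite mulmxDl scalemxAl.
  have DBe (b : 'M[A]_4) (u : A) : D (b - (h * h * u)%:M) = D b - (h * h * pd1 u)%:M.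
    by rewrite DD DN D_scalar ph2.
  (* The Pfaffian identity enters here, applied to (W', V) and to (W, V') after the Leibniz rule. *)
  have PE : (pd1 (pf (asym w) (asym w')))%:M =
      (asym (D w) *m star (asym w') + asym w' *m star (asym (D w)))
      + (asym w *m star (asym (D w')) + asym (D w') *m star (asym w)).
    have scalD (u v : A) : (u + v)%:M = u%:M + v%:M :> 'M[A]_4 by exact: raddfD.
    rewrite pd1_pf !D_asym scalD.
    by congr (_ + _); apply/esym; apply: star_anti; exact: altmx_asym.
  exact: (B_even_identity_eq _ _ _ _ (half2 K) PE (E _) (DBe _ _) (DBe _ _) (split _ _ _) (split _ _ _)).
exact: esym (gform_sub _ _ _ _).
Qed.

End PsiMorphism.

(** * Bijectivity *)

Section SpacesInCoordinates.
Variable K : numFieldType.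
Local Notation A := (psr 5 K).
Local Notation pd1 := (@pd 5 K ord0).
Local Notation D := (map_mx (@pd 5 K ord0)).
Implicit Types (f g : nat -> K^o) (B C c w M N : nat -> 'M[K]_4) (b : 'M[K]_4).

Lemma vfmE b : vfm b = \sum_i \sum_j
  b i j *: fmul (psX K (lift ord0 i)) (vf_d K (lift ord0 j)).
Proof.
apply/funext => l; rewrite fsumE /vfm /gvf.
transitivity (\sum_i \sum_j b i j *: (psX K (lift ord0 i) * (l == lift ord0 j)%:R)); last first.
  by apply: eq_bigr => i _; rewrite fsumE.
case: (unliftP ord0 l) => [k ->|->]; last first.
  rewrite big1 // => i _; rewrite big1 // => j _.
  by rewrite (negbTE (neq_lift _ _)) mulr0 scaler0.
rewrite mxE; apply: eq_bigr => i _; rewrite (bigD1 k) //= eqxx mulr1 big1 ?addr0.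
  by rewrite !mxE /= -scalerAr mulr1.
by move=> j jk; rewrite (inj_eq (@lift_inj _ _)) eq_sym (negbTE jk) mulr0 scaler0.
Qed.

Lemma qfE b : qf b = \sum_i \sum_j
  b i j *: (psX K (lift ord0 i) * psX K (lift ord0 j)).
Proof.
rewrite /qf mxE exchange_big; apply: eq_bigr => j _ /=.
rewrite [X in X * _]mxE mulr_suml; apply: eq_bigr => i _.
by rewrite !mxE /= -scalerAr mulr1 -scalerAl.
Qed.

Lemma alE b : al b = \sum_i \sum_j
  b i j *: wedge (dx K (lift ord0 i)) (dx K (lift ord0 j)).
Proof.
rewrite /al gformE big1 => [|j _]; last by rewrite mulmx0 mxE fmul0.
rewrite add0r; apply: eq_bigr => i _; apply: eq_bigr => j _; apply/funext => S.
by rewrite /fmul mxE /= -scalerAl mul1r.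
Qed.

Lemma cst_eq0 (a : K) : a%:A = 0 :> A -> a = 0.
Proof.
move/(congr1 (fun p : A => p 0%MM)); rewrite -[LHS]/(a * (0%MM == 0%MM :> 'X_{1..5})%:R).
by rewrite eqxx mulr1.
Qed.

Lemma sl4P (X : vf 5 K) : sl4 X <-> exists2 b : 'M[K]_4, X = vfm b & \tr b = 0.
Proof.
have tr_cst b : \tr (cst b) = (\tr b)%:A
  by rewrite /mxtrace scaler_suml; apply: eq_bigr => i _; rewrite mxE.
split=> [[[b XE] X0]|[b -> b0]].
  exists b; rewrite ?vfmE //; apply: cst_eq0; rewrite -tr_cst.
  move: X0; rewrite XE -vfmE /vfm diverg_gvf; last exact: cst_x1only.
  by rewrite pd0 add0r.
split; first by exists b; rewrite vfmE.
by rewrite /vfm diverg_gvf ?pd0 ?add0r ?tr_cst ?b0 ?scale0r //; exact: cst_x1only.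
Qed.

(** Membership provides matrices for each coefficient separately; the axiom of choice assembles them
    into sequences. *)
Lemma E16P (u : E16_space K) : E16 u <-> exists f B c w, (forall k, \tr (B k) = 0) /\ u = e16 f B c w.
Proof.
split=> [|[f [B [c [w [B0 ->]]]]]]; last first.
  split=> k /=; first by apply/sl4P; exists (B k).
    by exists (c k); rewrite /= qfE.
  by exists (w k); rewrite /= alE.
case: u => -[f X] [p a] [/= HX Hp Ha].
have HX' k : exists b : 'M[K]_4, X k = vfm b /\ \tr b = 0.
  by have [b Xb b0] := (sl4P (X k)).1 (HX k); exists b.
have [B HB] := choice HX'; have [c Hc] := choice Hp; have [w Hw] := choice Ha.
exists f, B, c, w; split=> [k|]; first by have [] := HB k.
congr ((_, _), (_, _)); apply/funext => k.
- by have [] := HB k.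
- by rewrite Hc /= qfE.
- by rewrite Hw /= alE.
Qed.

Lemma hat_inj : injective (@hat K).
Proof.
move=> B C /matrixP BC; apply/funext => k; apply/matrixP => i j.
move: (BC i j); rewrite !mxE => /subst_x1_inj /(congr1 (fun s => s k)).
exact.
Qed.

Lemma trace_hat B : \tr (hat B) = subst_x1 (fun k => \tr (B k) : K^o).
Proof.
rewrite /mxtrace; under eq_bigr do rewrite mxE.
by rewrite -subst_x1_sum; congr subst_x1; apply/funext => k; rewrite fct_sumE.
Qed.

Lemma trace_hat0 B : (forall k, \tr (B k) = 0) <-> \tr (hat B) = 0.
Proof.
rewrite trace_hat -(subst_x10 K); split=> [B0|/subst_x1_inj E k].
  by congr subst_x1; apply/funext => k; rewrite B0.
by move: (congr1 (fun s => s k) E).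
Qed.

(** A symmetric matrix times a skew one has trace zero, and [star v] is skew for every v. *)
Lemma trace_sym_star (T : comNzRingType) (c v : 'M[T]_4) : \tr (sym c *m star v) = 0.
Proof. by rewrite /mxtrace !sum4 !mxE !sum4 !mxE /=; ring. Qed.

(** The trace of W * star V is 2 Pf(W, V), which is symmetric in W and V. *)
Lemma trace_star (T : comNzRingType) (W V : 'M[T]_4) : altmx W -> altmx V ->
  \tr (W *m star V - V *m star W) = 0.
Proof.
move=> [W0 WN] [V0 VN].
have WE := (W0, WN o0 o1, WN o0 o2, WN o0 o3, WN o1 o2, WN o1 o3, WN o2 o3).
have VE := (V0, VN o0 o1, VN o0 o2, VN o0 o3, VN o1 o2, VN o1 o3, VN o2 o3).
by rewrite /mxtrace !sum4 !mxE !sum4 !mxE /= !(WE, VE); ring.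
Qed.

Lemma trace_D (M : 'M[A]_4) : \tr (D M) = pd1 (\tr M).
Proof. by rewrite /mxtrace pd_sum; apply: eq_bigr => i _; rewrite mxE. Qed.

Lemma trace_B_br f B c w g B' c' w' :
  (forall k, \tr (B k) = 0) -> (forall k, \tr (B' k) = 0) ->
  forall k, \tr (B_br f B c w g B' c' w' k) = 0.
Proof.
move=> /trace_hat0 B0 /trace_hat0 B0'; apply/trace_hat0; rewrite hat_B_br.
have tr0 (u v : 'M[A]_4) : \tr (asym u *m star (asym v) - asym v *m star (asym u)) = 0.
  by apply: trace_star; exact: altmx_asym.
have trB (u v : 'M[A]_4) : \tr (u - v) = \tr u - \tr v by exact: raddfB.
have trD (u v : 'M[A]_4) : \tr (u + v) = \tr u + \tr v by exact: raddfD.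
have trB0 (u v : 'M[A]_4) : \tr u = 0 -> \tr v = 0 -> \tr (u - v) = 0.
  by rewrite trB => -> ->; rewrite subrr.
have trZ0 (a : A) (u : 'M[A]_4) : \tr u = 0 -> \tr (a *: u) = 0.
  by rewrite mxtraceZ => ->; rewrite mulr0.
apply: (trB0 _ _); last by apply: (trZ0 _ _); apply: (trB0 _ _); apply: (trZ0 _ _); exact: tr0.
do 2! (apply: (trB0 _ _); last exact: trace_sym_star).
have trC (u v : 'M[A]_4) : \tr (u *m v - v *m u) = 0.
  by rewrite trB mxtrace_mulC subrr.
rewrite trD trC addr0.
by apply: (trB0 _ _); apply: (trZ0 _ _); rewrite trace_D ?B0 ?B0' pd0.
Qed.

Lemma E16_closed : bracket_closed (@E16 K) (@E16_bracket K).
Proof.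
move=> u v /E16P [f [B [c [w [B0 ->]]]]] /E16P [g [B' [c' [w' [B0' ->]]]]].
rewrite E16_bracket_e16; apply/E16P; do 4 eexists; split; last by [].
exact: trace_B_br.
Qed.

Definition deg0 f M N w : E510_space K :=
  (gvf (subst_x1 f) (hat M), gform (hat N) (hat w)).

(** Zero divergence and closedness read coefficient by coefficient; [deg0_condE] is the same
    condition on series. *)
Definition deg0_cond f M N w :=
  (forall k, tder f k + \tr (M k) = 0) /\ (forall k, asym (N k) = asym (tder w k)).

Lemma deg0_condE f M N w : deg0_cond f M N w <->
  pd1 (subst_x1 f) + \tr (hat M) = 0 /\ asym (hat N) = asym (D (hat w)).
Proof.
rewrite -subst_x1_tder trace_hat -subst_x1D -hat_tder -!hat_asym -(subst_x10 K).
split=> [[fM Nw]|[/subst_x1_inj fM /hat_inj Nw]].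
  by split; [congr subst_x1 | congr hat]; apply/funext => k; [exact: fM | exact: Nw].
by split=> k; [exact: (congr1 (fun s => s k) fM) | exact: (congr1 (fun s => s k) Nw)].
Qed.

Definition psi_M f B : nat -> 'M[K]_4 := fun k => B k - (4%:R^-1 * (tder f k : K))%:M.
Definition psi_N c w : nat -> 'M[K]_4 := fun k => sym (c k) + 2%:R^-1 *: asym (tder w k).

Lemma psi_e16_deg0 f B c w : psi (e16 f B c w) = deg0 f (psi_M f B) (psi_N c w) w.
Proof.
have EM : hat B - (4%:R^-1%:A * pd1 (subst_x1 f))%:M = hat (psi_M f B).
  rewrite (_ : psi_M f B = B - (fun k => (4%:R^-1 * (tder f k : K))%:M)) //.
  rewrite hatD hatN; congr (_ - _); apply/matrixP => i j; rewrite !mxE.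
  rewrite -subst_x1_tder -scalerAl mul1r -subst_x1Z.
  case: (eqVneq i j) => [<-|ij]; rewrite ?mulr1n ?mulr0n.
    by congr subst_x1; apply/funext => k; rewrite mxE eqxx mulr1n.
  rewrite -[LHS](subst_x10 K); congr subst_x1; apply/funext => k.
  by rewrite mxE (negbTE ij) mulr0n.
have EN : sym (hat c) + 2^-1%:A *: asym (D (hat w)) = hat (psi_N c w).
  rewrite (_ : psi_N c w = (@sym K \o c) + 2%:R^-1 *: (@asym K \o tder w)) //.
  by rewrite hatD hatZ hat_sym hat_asym hat_tder.
by rewrite psi_e16 EM EN.
Qed.

Lemma quarter_mul4 (t : K) : (4%:R^-1 * t) *+ 4 = t.
Proof. by rewrite -mulrnAl -mulr_natr mulVf ?mul1r ?pnatr_eq0. Qed.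

Lemma psi_cond f B c w : (forall k, \tr (B k) = 0) ->
  deg0_cond f (psi_M f B) (psi_N c w) w.
Proof.
move=> B0; split=> k; last first.
  by rewrite /psi_N; apply: asym_half; rewrite mulVf ?pnatr_eq0.
by rewrite /psi_M raddfB /= B0 mxtrace_scalar sub0r quarter_mul4 subrr.
Qed.

Lemma deg0_psi f M N w : deg0_cond f M N w ->
  exists B c, (forall k, \tr (B k) = 0) /\ deg0 f M N w = psi (e16 f B c w).
Proof.
move=> [fM Nw]; pose B k := M k + (4%:R^-1 * (tder f k : K))%:M.
(* By the closedness condition N - asym(w')/2 is symmetric, so half of it is a matrix whose [sym]
   gives it back. *)
pose c k := 2%:R^-1 *: (N k - 2%:R^-1 *: asym (tder w k)).
exists B, c; split=> [k|].
  by rewrite /B raddfD /= mxtrace_scalar quarter_mul4 addrC fM.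
rewrite psi_e16_deg0; have -> : psi_M f B = M.
  by apply/funext => k; rewrite /psi_M /B addrK.
suff -> : psi_N c w = N by [].
apply/funext => k; rewrite /psi_N; apply/matrixP => i j.
have Nij : N k i j - N k j i = tder w k i j - tder w k j i.
  by move/matrixP/(_ i j): (Nw k); rewrite !mxE.
have half : 2%:R^-1 * 2%:R = 1 :> K by rewrite mulVf ?pnatr_eq0.
rewrite !mxE; move: (2%:R^-1 : K) half => t t2.
move: (N k i j) (N k j i) (tder w k i j) (tder w k j i) Nij => a a' v v' E.
have {E}-> : a' = a - (v - v') by rewrite -E opprB addrC subrK.
apply: subr0_eq; transitivity ((t * 2%:R - 1) * a); first by ring.
by rewrite t2 subrr mul0r.
Qed.

Lemma gvf_inj (F G : A) (M N : 'M[A]_4) : mx_x1only M -> mx_x1only N ->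
  gvf F M = gvf G N -> F = G /\ M = N.
Proof.
move=> M1 N1 E; split; first by have := congr1 (fun X : vf 5 K => X ord0) E; rewrite /gvf unlift_none.
apply/matrixP => i j; rewrite -(pd_lift_xrow i j M1) -(pd_lift_xrow i j N1).
by have := congr1 (fun X : vf 5 K => X (lift ord0 j)) E; rewrite /gvf liftK => ->.
Qed.

Lemma altmx_ext (T : comNzRingType) (U V : 'M[T]_4) : altmx U -> altmx V ->
  (forall i j : 'I_4, (i < j)%N -> U i j = V i j) -> U = V.
Proof.
move=> [U0 UN] [V0 VN] UV; apply/matrixP => i j.
case: (ltngtP i j) => [/UV //|ji|/val_inj <-]; last by rewrite U0 V0.
by rewrite (UN j i) (VN j i) UV.
Qed.

Lemma gform_inj (M v N w : 'M[A]_4) : mx_x1only M -> mx_x1only N ->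
  gform M v = gform N w -> M = N /\ asym v = asym w.
Proof.
move=> M1 N1 E; split.
  apply/matrixP => i j; rewrite -(pd_lift_xrow i j M1) -(pd_lift_xrow i j N1).
  by rewrite -(gform_set2_0 M v) -(gform_set2_0 N w) E.
apply: altmx_ext; try exact: altmx_asym.
by move=> i j ij; rewrite /asym -(gform_set2 M v ij) -(gform_set2 N w ij) E.
Qed.

Lemma qfD b b' : qf (b + b') = qf b + qf b'.
Proof. by rewrite /qf /cst map_mxD mulmxDr mulmxDl [LHS]mxE. Qed.

Lemma qf_tr b : qf b^T = qf b.
Proof.
have tr11 (z : 'M[A]_1) : z^T 0 0 = z 0 0 by rewrite mxE.
by rewrite /qf -[RHS]tr11 !trmx_mul trmxK cst_tr mulmxA.
Qed.

Lemma qf_sym b : qf b = 2%:R^-1 *: qf (sym b).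
Proof.
rewrite /sym qfD qf_tr -mulr2n -scaler_nat scalerA mulVf ?scale1r //.
by rewrite pnatr_eq0.
Qed.

Lemma al_asym b b' : asym b = asym b' -> al b = al b'.
Proof.
move=> E; apply: gform_eq; first by [].
exact: (etrans (asym_cst b) (etrans (congr1 (@cst K) E) (esym (asym_cst b')))).
Qed.

(** The image determines f and B, but only sym c and asym w; these suffice because they determine
    the quadratic form and the 2-form. *)
Lemma psi_inj : {in @E16 K &, injective (@psi K)}.
Proof.
move=> u v; rewrite !inE => /E16P [f [B [c [w [_ ->]]]]] /E16P [g [B' [c' [w' [_ ->]]]]].
move=> E.
have {}E := etrans (esym (psi_e16_deg0 f B c w)) (etrans E (psi_e16_deg0 g B' c' w')).
have [/subst_x1_inj fg /hat_inj BB'] := gvf_inj (@hat_x1only _ _) (@hat_x1only _ _) (congr1 fst E).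
have [/hat_inj cc'] := gform_inj (@hat_x1only _ _) (@hat_x1only _ _) (congr1 snd E).
rewrite -!hat_asym => /hat_inj ww'; rewrite {}fg in BB' *.
have wk k : asym (w k) = asym (w' k) by exact: (congr1 (fun s => s k) ww').
have -> : B = B'.
  by apply/funext => k; move: (congr1 (fun s => s k) BB') => /addIr.
(* Hence the correction asym(w')/2 inside [psi_N] is known from asym w, and subtracting it isolates
   sym c. *)
have asym_tder (y : nat -> 'M[K]_4) k : asym (tder y k) = asym (y k.+1) *+ k.+1.
  by rewrite /tder /asym raddfMn mulrnBl.
have sc k : sym (c k) = sym (c' k).
  move: (congr1 (fun s => s k) cc'); rewrite /psi_N.
  suff -> : asym (tder w k) = asym (tder w' k) by move/addIr.
  by rewrite !asym_tder wk.
have -> : e16 g B' c w = e16 g B' c' w.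
  rewrite /e16; suff -> : @qf K \o c = @qf K \o c' by [].
  by apply/funext => k /=; rewrite qf_sym sc -qf_sym.
rewrite /e16; suff -> : @al K \o w = @al K \o w' by [].
by apply/funext => k; exact: al_asym.
Qed.

End SpacesInCoordinates.

(** * Homogeneous elements of degree zero, linearity, parity, and the isomorphism *)

Section DegreeZeroPart.
Variable K : numFieldType.
Local Notation A := (psr 5 K).
Local Notation pd1 := (@pd 5 K ord0).
Local Notation D := (map_mx (@pd 5 K ord0)).
Implicit Types (f g : nat -> K^o) (B C c w M N : nat -> 'M[K]_4) (b : 'M[K]_4).
Implicit Types (p : A) (m : 'X_{1..5}).

Lemma xdeg_lift (i : 'I_4) : xdeg (lift ord0 i) = 1.
Proof. by rewrite /xdeg eq_sym (negbTE (neq_lift _ _)). Qed.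

Lemma xdeg0 : xdeg ord0 = 0.
Proof. by []. Qed.

Lemma mondegE m : mondeg m = (\sum_(i < 4) m (lift ord0 i))%N%:Z.
Proof.
rewrite /mondeg [LHS]big_ord_recl /= xdeg0 mul0rn add0r.
under eq_bigr do rewrite xdeg_lift.
by rewrite -natr_sum natz.
Qed.

(** Homogeneity in x_2, ..., x_5 alone, since x_1 has weight 0. *)
Definition hom_deg (d : nat) p :=
  forall m, p m != 0 -> (\sum_(i < 4) m (lift ord0 i))%N = d.

Lemma hom_sum (I : finType) d (F : I -> A) :
  (forall i, hom_deg d (F i)) -> hom_deg d (\sum_i F i).
Proof.
move=> H m; rewrite psr_sumE => s0.
have [i Fi] : exists i, F i m != 0; last exact: H Fi.
apply: contrapT => no; move/eqP: s0; apply; apply: big1 => i _.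
by apply/eqP; apply: contrapT => /negP Fi; apply: no; exists i.
Qed.

Lemma mnm_x1P m : (\sum_(i < 4) m (lift ord0 i))%N = 0%N <->
  m = (U_(ord0) *+ m ord0)%MM.
Proof.
split=> [/eqP|->]; last first.
  by apply: big1 => i _; rewrite mulmnE mnm1E (negbTE (neq_lift _ _)) mul0n.
rewrite sum_nat_eq0 => /forallP m0; apply/mnmP => l; rewrite mulmnE mnm1E.
case: (unliftP ord0 l) => [i ->|->]; last by rewrite eqxx mul1n.
by rewrite (negbTE (neq_lift _ _)) mul0n; apply/eqP; have := m0 i.
Qed.

Lemma hom_subst_x1 f : hom_deg 0 (subst_x1 f).
Proof.
move=> m; rewrite subst_x1E; case: ifP => [/eqP E _|_]; last by rewrite eqxx.
exact: (mnm_x1P m).2 E.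
Qed.

Lemma hom_psX (i : 'I_4) d p : hom_deg d p -> hom_deg d.+1 (psX K (lift ord0 i) * p).
Proof.
move=> Hp m; rewrite psX_mulE; case: ifP => [mi /Hp <-|]; last by rewrite eqxx.
rewrite (bigD1 i) //= [in RHS](bigD1 i) //= mnmBE mnm1E eqxx subn1 -addSn prednK //.
congr (_ + _)%N; apply: eq_bigr => j ji.
by rewrite mnmBE mnm1E (inj_eq (@lift_inj _ _)) eq_sym (negbTE ji) subn0.
Qed.

Lemma hom_xrow M j : hom_deg 1 ((xrow K *m hat M) 0 j).
Proof.
rewrite mxE; apply: hom_sum => i; rewrite !mxE; apply: hom_psX.
exact: hom_subst_x1.
Qed.

Lemma hom_deg0E p : hom_deg 0 p -> p = subst_x1 (fun k => p (U_(ord0) *+ k)%MM : K^o).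
Proof.
move=> Hp; apply/funext => m; rewrite subst_x1E.
case: eqP => [{1}-> //|m0]; apply/eqP; apply: contrapT => /negP /Hp.
by move/(mnm_x1P m).1.
Qed.

Lemma hom_deg1E p : hom_deg 1 p -> p = \sum_i psX K (lift ord0 i) *
  subst_x1 (fun k => p (U_(ord0) *+ k + U_(lift ord0 i))%MM : K^o).
Proof.
move=> Hp; apply/funext => m; rewrite psr_sumE.
(* A monomial of degree 1 in x_2, ..., x_5 is a power of x_1 times x_i for exactly one i, and T
   selects this i. *)
pose T (i : 'I_4) := m == (U_(ord0) *+ m ord0 + U_(lift ord0 i))%MM.
rewrite (eq_bigr (fun i => if T i then p m else 0)); last first.
  move=> i _; rewrite psX_mulE subst_x1E /T mnmBE mnm1E.
  rewrite [lift _ _ == ord0]eq_sym (negbTE (neq_lift _ _)) subn0.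
  have [mi|mi] := boolP (0 < m (lift ord0 i))%N.
    have mE : (m - U_(lift ord0 i) + U_(lift ord0 i))%MM = m by rewrite submK // lep1mP -lt0n.
    case: eqP => [E|nE]; first by rewrite -{1}E mE -{1}E mE eqxx.
    case: eqP => // E; case: nE; rewrite {1}E.
    by apply/mnmP => l; rewrite mnmBE mnmDE addnK.
  case: eqP => // /(congr1 (fun l : 'X_{1..5} => l (lift ord0 i))).
  by rewrite mnmDE mnm1E eqxx addn1 => mi'; rewrite mi' in mi.
have [p0|p0] := eqVneq (p m) 0; first by rewrite p0 big1 // => i _; case: ifP.
have m1 := Hp _ p0.
have [i mi] : exists i : 'I_4, (0 < m (lift ord0 i))%N.
  apply: contrapT => no; move: m1; rewrite big1 // => i _.
  by apply/eqP; rewrite -leqn0 leqNgt; apply/negP => mi; apply: no; exists i.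
move: m1; rewrite (bigD1 i) //=; case mi1 : (m (lift ord0 i)) mi => [//|[|n]] _ //.
rewrite add1n => -[] /eqP; rewrite sum_nat_eq0 => /forallP m0.
have Ti : T i.
  apply/eqP/mnmP => l; rewrite mnmDE mulmnE !mnm1E.
  case: (unliftP ord0 l) => [j ->|->]; last first.
    by rewrite eqxx mul1n [lift _ _ == ord0]eq_sym (negbTE (neq_lift _ _)) addn0.
  rewrite (negbTE (neq_lift _ _)) mul0n (inj_eq (@lift_inj _ _)).
  case: (eqVneq i j) => [<- //|ij]; apply/eqP.
  by have := m0 j; rewrite eq_sym ij.
rewrite (bigD1 i) //= Ti big1 ?addr0 // => j ji; case: ifP => // /eqP Tj.
have := congr1 (fun l : 'X_{1..5} => l (lift ord0 j)) Tj.
rewrite mnmDE mnm1E eqxx addn1 => mj; have := m0 j.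
by rewrite ji /= mj.
Qed.

Lemma deg0_homog f M N w : E510_homog 0 (deg0 f M N w).
Proof.
split=> [l m|S m] /=.
  rewrite mondegE /gvf; case: (unliftP ord0 l) => [j ->|->].
    by move/hom_xrow->; rewrite xdeg_lift subrr.
  by move/hom_subst_x1->; rewrite xdeg0 subrr.
have [S2|S2] := boolP (#|S| == 2); last first.
  by rewrite /gform (form2_is_kform _ S2) eqxx.
have [i [j [ij ->]]] : exists i j : 'I_5, (i < j)%N /\ S = [set i; j].
  case/cards2P: S2 => i [j [ij SE]]; case: (ltngtP i j) => [lt|gt|/eqP].
  - by exists i, j.
  - by exists j, i; rewrite finset.setUC.
  - by rewrite val_eqE (negbTE ij).
rewrite mondegE big_setU1 ?inE -?val_eqE /= ?ltn_eqF // big_set1.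
case: (unliftP ord0 i) ij => [i' ->|->]; case: (unliftP ord0 j) => [j' ->|->] //= ij.
  rewrite gform_set2 // -/(asym _) -hat_asym mxE => /hom_subst_x1->.
  by rewrite !xdeg_lift subrr.
by rewrite gform_set2_0 => /hom_xrow->; rewrite xdeg_lift xdeg0.
Qed.

Lemma gform0_eq0 (X : 'M[A]_4) : asym X = 0 -> gform 0 X = 0.
Proof.
move=> X0; rewrite -(gform00 K); apply: gform_eq; first by [].
by rewrite trmx0 subrr; exact: X0.
Qed.

(** The component at {1, i, j} is the (i, j) entry of asym X up to a sign, and multiplying by the
    same sign removes it. *)
Lemma wedge_dx0_gform0 (X : 'M[A]_4) :
  wedge (dx K ord0) (gform 0 X) = 0 -> asym X = 0.
Proof.
move=> E; apply: altmx_ext; first exact: altmx_asym.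
  by split=> *; rewrite !mxE ?oppr0.
move=> i j ij; rewrite [RHS]mxE.
have := congr1 (fun a : form 5 K => a (ord0 |: [set lift ord0 i; lift ord0 j])) E.
rewrite wedge_dxE !inE eqxx /= setU1K; last by rewrite !inE negb_or !neq_lift.
rewrite gform_set2 // -/(asym X); set s := ninv _ _ => /(congr1 (fun y : A => (-1) ^+ s * y)).
by rewrite mulrA -exprMn mulrNN mulr1 expr1n mul1r => ->; exact: mulr0.
Qed.

Lemma deg0_E510 f M N w : deg0_cond f M N w -> E510_deg 0 (deg0 f M N w).
Proof.
move=> /deg0_condE [fM Nw]; split; last exact: deg0_homog.
split=> /=; first by rewrite diverg_gvf //; exact: hat_x1only.
  exact: form2_is_kform.
rewrite extd_gform; try exact: hat_x1only.
by rewrite gform0_eq0 ?wedge0r // asymB Nw subrr.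
Qed.

Lemma E510_deg0 u : E510_deg 0 u ->
  exists f M N w, deg0_cond f M N w /\ u = deg0 f M N w.
Proof.
case: u => Y a [[/= divY a2 da] [/= hY ha]].
pose f k : K^o := Y ord0 (U_(ord0) *+ k)%MM.
pose M k : 'M[K]_4 := \matrix_(i, j) Y (lift ord0 j) (U_(ord0) *+ k + U_(lift ord0 i))%MM.
pose N k : 'M[K]_4 := \matrix_(i, j)
  a [set ord0; lift ord0 j] (U_(ord0) *+ k + U_(lift ord0 i))%MM.
(* Taking w strictly upper triangular makes its skew part equal to the given coefficients for i < j,
   without a factor 2. *)
pose w k : 'M[K]_4 := \matrix_(i, j) if (i < j)%N
  then a [set lift ord0 i; lift ord0 j] (U_(ord0) *+ k)%MM else 0.
have xrowE (F : 'I_4 -> A) (Q : nat -> 'M[K]_4) j : hom_deg 1 (F j) ->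
    (forall k i, Q k i j = F j (U_(ord0) *+ k + U_(lift ord0 i))%MM) ->
    (xrow K *m hat Q) 0 j = F j.
  move=> /hom_deg1E FE QE; rewrite [RHS]FE mxE; apply: eq_bigr => i _.
  rewrite [xrow K 0 i]mxE [hat Q i j]mxE; congr (_ * subst_x1 _).
  by apply/funext => k; exact: QE.
have natE (n d : nat) (z : int) : n%:Z + z = 0 -> z = - d%:Z -> n = d.
  by move=> + zE; rewrite zE => /eqP; rewrite subr_eq0 => /eqP [].
have YE : Y = gvf (subst_x1 f) (hat M).
  apply/funext => l; rewrite /gvf; case: (unliftP ord0 l) => [j ->|->].
    apply/esym; apply: (xrowE (fun j => Y (lift ord0 j))) => [m /hY|k i].
      by rewrite mondegE => /natE; apply; rewrite xdeg_lift.
    by rewrite mxE.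
  apply: hom_deg0E => m /hY; rewrite mondegE => /natE; apply.
  by rewrite xdeg0.
(* As d has degree -1, dx_1 has degree -1 and the other dx_k have degree 0. Coefficients of dx_1
   dx_j are therefore linear in x_2, ..., x_5, and the others involve x_1 only. *)
have sumdeg (i j : 'I_5) : (i < j)%N ->
    \sum_(k in [set i; j]) (xdeg k - 1) = (xdeg i - 1) + (xdeg j - 1).
  by move=> ij; rewrite big_setU1 ?inE -?val_eqE /= ?ltn_eqF // big_set1.
have aE : a = gform (hat N) (hat w).
  apply: kform2_ext => //; first exact: form2_is_kform.
  move=> i j; case: (unliftP ord0 i) => [i' ->|->]; case: (unliftP ord0 j) => [j' ->|->] // ij.
    rewrite gform_set2 // -/(asym _) -hat_asym mxE.
    have /hom_deg0E -> : hom_deg 0 (a [set lift ord0 i'; lift ord0 j']).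
      move=> m /ha; rewrite mondegE => /natE; apply.
      by rewrite sumdeg // !xdeg_lift.
    congr subst_x1; apply/funext => k; rewrite /= !mxE.
    have ij' : (i' < j')%N by [].
    by rewrite ij' ltnNge ltnW // subr0.
  rewrite gform_set2_0; apply/esym.
  apply: (xrowE (fun j => a [set ord0; lift ord0 j])) => [m /ha|k l].
    by rewrite mondegE => /natE; apply; rewrite sumdeg // xdeg_lift xdeg0.
  by rewrite mxE.
exists f, M, N, w; split; last by rewrite YE aE.
apply/deg0_condE; split.
  by move: divY; rewrite YE diverg_gvf //; exact: hat_x1only.
move: da; rewrite aE extd_gform; try exact: hat_x1only.
by move/wedge_dx0_gform0/eqP; rewrite asymB subr_eq0 => /eqP ->.
Qed.

Lemma deg0D (a : K) f M N w g M' N' w' :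
  a *: deg0 f M N w + deg0 g M' N' w' =
  deg0 (a *: f + g) (a *: M + M') (a *: N + N') (a *: w + w').
Proof.
rewrite /deg0 !hatD !hatZ subst_x1D subst_x1Z -gvfD -gformD -gvfZ -gformZ.
by [].
Qed.

Lemma e16D (a : K) f B c w g B' c' w' :
  a *: e16 f B c w + e16 g B' c' w' =
  e16 (a *: f + g) (a *: B + B') (a *: c + c') (a *: w + w').
Proof.
have Lv := @vfm_is_linear K; have Lq := @qf_is_linear K; have La := @al_is_linear K.
rewrite /e16 (lin_compD Lv) (lin_compD Lq) (lin_compD La).
by rewrite (lin_compZ Lv) (lin_compZ Lq) (lin_compZ La).
Qed.

Lemma psi_linear (a : K) u v : E16 u -> E16 v ->
  psi (a *: u + v) = a *: psi u + psi v.
Proof.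
move=> /E16P [f [B [c [w [_ ->]]]]] /E16P [g [B' [c' [w' [_ ->]]]]].
rewrite e16D; apply: etrans (psi_e16_deg0 _ _ _ _) _.
apply: etrans (esym (congr2 (fun y z => a *: y + z)
  (psi_e16_deg0 f B c w) (psi_e16_deg0 g B' c' w'))).
rewrite deg0D.
have tderD (V : lmodType K) (y z : nat -> V) k :
    tder (a *: y + z) k = a *: tder y k + tder z k.
  rewrite /tder -[(a *: y + z) _]/(a *: y k.+1 + z k.+1) mulrnDl.
  by rewrite scalerMnr.
have EM : psi_M (a *: f + g) (a *: B + B') = a *: psi_M f B + psi_M g B'.
  apply/funext => k; rewrite /psi_M tderD; apply/matrixP => i j.
  rewrite !mxE -[(_ *: _ : K^o)]/(a * (tder f k : K)).
  by case: (i == j); rewrite ?mulr1n ?mulr0n; ring.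
have EN : psi_N (a *: c + c') (a *: w + w') = a *: psi_N c w + psi_N c' w'.
  apply/funext => k; rewrite /psi_N tderD.
  rewrite -[RHS]/(a *: (sym (c k) + _) + (sym (c' k) + _)).
  rewrite -[(a *: c + c') k]/(a *: c k + c' k).
  move: (c k) (c' k) (tder w k) (tder w' k) (2%:R^-1 : K) => {}c {}c' z z' t.
  by apply/matrixP => i j; rewrite !mxE; ring.
by rewrite EM EN.
Qed.

Lemma psi_parity (u : E16_space K) : E16 u ->
  (u.2 = 0 -> (psi u).2 = 0) /\ (u.1 = 0 -> (psi u).1 = 0).
Proof.
have comp0 (V : lmodType K) (phi : 'M[K]_4 -> V) : linear phi -> phi \o (0 : nat -> 'M[K]_4) = 0.
  move=> L; apply/funext => k /=; have := L (-1) 0 0.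
  by rewrite scaler0 addr0 scaleN1r addNr.
have hat0 : hat (0 : nat -> 'M[K]_4) = 0.
  by have := hatZ 0 (0 : nat -> 'M[K]_4); rewrite !scale0r.
move=> /E16P [f [B [c [w [_ ->]]]]]; split=> E.
  have cE : @qf K \o c = 0 := congr1 fst E.
  have wE : @al K \o w = 0 := congr1 snd E.
  have -> : e16 f B c w = e16 f B 0 0.
    by rewrite /e16 cE wE (comp0 _ _ (@qf_is_linear K)) (comp0 _ _ (@al_is_linear K)).
  rewrite psi_e16 -[LHS]/(gform _ _) hat0 -[RHS](gform00 K); apply: gform_eq => //.
  by apply/matrixP => i j; rewrite !mxE !pd0 !subrr mulr0 !addr0.
have fE : f = 0 := congr1 fst E.
have BE : @vfm K \o B = 0 := congr1 snd E.
have -> : e16 f B c w = e16 0 0 c w.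
  by rewrite /e16 fE BE (comp0 _ _ (@vfm_is_linear K)).
rewrite psi_e16 -[LHS]/(gvf _ _) hat0 subst_x10 pd0 mulr0 sub0r; apply/funext => l.
by rewrite /gvf; case: unliftP => // j _; rewrite raddf0 oppr0 mulmx0 mxE.
Qed.

Theorem psi_iso : lie_superalgebra_iso (U0 := E16_even K) (U1 := E16_odd K)
    (V0 := E510_even K) (V1 := E510_odd K)
    (@E16 K) (@E16_bracket K) (@E510_deg K 0%R) (@E510_bracket K) (@psi K).
Proof.
have psiB (u : E16_space K) : E16 u -> E510_deg 0 (psi u).
  move=> /E16P [f [B [c [w [B0 ->]]]]]; rewrite psi_e16_deg0.
  exact/deg0_E510/psi_cond.
have surj (v : E510_space K) : E510_deg 0 v -> exists2 u, E16 u & psi u = v.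
  move=> /E510_deg0 [f [M [N [w [cond ->]]]]].
  have [B [c [B0 ->]]] := deg0_psi cond; exists (e16 f B c w) => //.
  by apply/E16P; exists f, B, c, w.
have morph (u v : E16_space K) : E16 u -> E16 v ->
    psi (E16_bracket u v) = E510_bracket (psi u) (psi v).
  move=> /E16P [f [B [c [w [_ ->]]]]] /E16P [g [B' [c' [w' [_ ->]]]]].
  exact: psi_morph.
split.
- split; first exact: E16_closed.
  (* Closure of the degree-zero part under its bracket is transported from E(1,6) through
     surjectivity and the morphism property. *)
  move=> _ _ /surj [u Au <-] /surj [v Av <-]; rewrite -morph //.
  exact/psiB/E16_closed.
- by split; [exact: psiB | exact: psi_inj | exact: surj].
- exact: psi_linear.
- exact: psi_parity.
- exact: morph.
Qed.

End DegreeZeroPart.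

Theorem theorem3p1 (R : realType) :
  lie_superalgebra_iso (U0 := E16_even R[i]%C) (U1 := E16_odd R[i]%C)
    (V0 := E510_even R[i]%C) (V1 := E510_odd R[i]%C)
    (@E16 R[i]%C) (@E16_bracket R[i]%C)
    (@E510_deg R[i]%C 0%R) (@E510_bracket R[i]%C)
    (@psi R[i]%C).
Proof. exact: psi_iso. Qed.
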